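(* Let $(M,\omega)$ be a $2s$-dimensional symplectic manifold, $H\in C^{\infty}(M)$, and $m\in M$ a point with $\mathsf{d}H(m)\neq0$. Then, for every integer $k$ with $1\leq k\leq s$, there exist an open neighborhood $U$ of $m$, a fibration $\pi:U\to\pi(U)\subseteq\mathbb{R}^{k}$, and an isotropic complete solution of the $\pi$-Hamilton-Jacobi equation ($\pi$-HJE) for $X_H|_U$.
   Context: All manifolds and maps are smooth ($C^\infty$) and finite-dimensional. A fibration is a surjective submersion. Here $\pi(U)$ is an open subset of $\mathbb{R}^k$. The Hamiltonian vector field $X_H$ is defined by $\mathfrak{i}_{X_H}\omega=\mathsf{d}H$. Given a symplectic manifold $(M,\omega)$ of dimension $d=2s$, a function $H:M\to\mathbb{R}$ and a fibration $\Pi:M\to N$ with $\dim N=k$, a complete solution of the $\Pi$-HJE for $X_H$ is a surjective local diffeomorphism $\Sigma:N\times\Lambda\to M$, where $\Lambda$ is a manifold of dimension $d-k$, such that $$\mathfrak{i}_{X_H^{\Sigma}}\Sigma^{*}\omega=\Sigma^{*}\mathsf{d}H\quad\text{and}\quad \Pi\circ\Sigma=p_N,$$ where $p_N:N\times\Lambda\to N$ is the projection onto the first factor and $X_H^{\Sigma}\in\mathfrak{X}(N\times\Lambda)$ is the vector field $X_H^{\Sigma}(n,\lambda)=\left(\Pi_{*}(X_H(\Sigma(n,\lambda))),0\right)$. It is isotropic if $\sigma_\lambda^{*}\omega=0$ for all $\lambda\in\Lambda$, where $\sigma_\lambda(n)=\Sigma(n,\lambda)$. In the claim these notions are applied to $(U,\omega|_U)$,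 $H|_U$ and the fibration $\pi:U\to\pi(U)$. *)

(* Defs.v *)
From HB Require Import structures.
From mathcomp Require Import all_boot all_order all_algebra.
From mathcomp Require Import all_classical all_reals all_analysis.

Set Implicit Arguments.
Unset Strict Implicit.
Unset Printing Implicit Defensive.

Import Order.TTheory GRing.Theory Num.Theory.
Import numFieldNormedType.Exports.

Local Open Scope classical_set_scope.
Local Open Scope ring_scope.

Section SmoothEuclidean.
Context {R : realType} {n : nat} {W : normedModType R}.

Fixpoint Ck_on (k : nat) (A : set 'rV[R]_n) (f : 'rV[R]_n -> W) : Prop :=
  (forall x, A x -> {for x, continuous f}) /\
  match k with
  | 0 => True
  | k'.+1 => forall i : 'I_n,
      (forall x, A x -> derivable f x (delta_mx 0 i)) /\
      Ck_on k' A (fun x => 'D_(delta_mx 0 i) f x)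
  end.

(* Meaningful for open A: the derivatives are the two-sided ones. *)
Definition smooth_on (A : set 'rV[R]_n) (f : 'rV[R]_n -> W) : Prop :=
  forall k, Ck_on k A f.

End SmoothEuclidean.

(* A chart is a partial homeomorphism between an open subset [cdom] of T and
   an open subset of R^n. Since [cmap] and [cinv] are total functions, their
   values off [cdom] and off [cmap @` cdom] carry no information. *)
Record chart (R : realType) (T : topologicalType) (n : nat) := Chart {
  cdom : set T;
  cmap : T -> 'rV[R]_n;
  cinv : 'rV[R]_n -> T }.

(* A manifold is presented by its atlas; its underlying space is the union
   [carrier A] of the chart domains, an open subset of the ambient space T.
   Open submanifolds thus live in the same ambient type. *)
Definition atlas (R : realType) (T : topologicalType) (n : nat) :=
  set (chart R T n).

Definition tvec (R : realType) (T : topologicalType) := (T -> R) -> R.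

Section Manifold.
Context {R : realType} {T : topologicalType} {n : nat}.
Implicit Types (c : chart R T n) (A : atlas R T n).

Definition is_chart c : Prop :=
  [/\ open (cdom c), open (cmap c @` cdom c),
      (forall p, cdom c p -> cinv c (cmap c p) = p),
      (forall p, cdom c p -> {for p, continuous (cmap c)}) &
      (forall x, (cmap c @` cdom c) x -> {for x, continuous (cinv c)})].

Definition carrier A : set T := \bigcup_(c in A) cdom c.

Definition is_manifold A : Prop :=
  [/\ (forall c, A c -> is_chart c),
      (forall c c', A c -> A c' ->
         smooth_on (cmap c @` (cdom c `&` cdom c')) (cmap c' \o cinv c)),
      (forall p q, carrier A p -> carrier A q -> p <> q ->
         exists V W : set T,
           [/\ open V, open W, V p, W q & V `&` W = set0]) &
      (exists2 B : set (set T), countable B &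
         (forall O, B O -> open O) /\
         (forall p V, carrier A p -> open V -> V p ->
            exists O, [/\ B O, O p & O `<=` V]))].

Definition smooth_fun A (V : set T) (f : T -> R) : Prop :=
  forall c, A c -> smooth_on (cmap c @` (cdom c `&` V)) (f \o cinv c : _ -> R^o).

Definition smooth_near A (p : T) (f : T -> R) : Prop :=
  exists V, [/\ open V, V p & smooth_fun A V f].

(* The tangent vector at p with coordinates v in the chart c, i.e.
   \sum_i v_i d/dx^i, acting on functions that are smooth near p. The value 0
   is assigned to the other functions, so that equality of tangent vectors is
   equality of operators. *)
Definition coord_tvec A c (v : 'rV[R]_n) (p : T) : tvec R T :=
  fun f => if `[< smooth_near A p f >]
           then 'D_v (f \o cinv c : _ -> R^o) (cmap c p) else 0.

(* T_pM. Since only germs at p matter, an open submanifold has the same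
   tangent spaces as the manifold. *)
Definition tangent A (p : T) (u : tvec R T) : Prop :=
  exists c v, [/\ A c, cdom c p & u = coord_tvec A c v p].

(* omega (d/dv, d/dw) read in the chart c, with v and w constant. *)
Definition form_coord A (omega : T -> tvec R T -> tvec R T -> R) c
    (v w : 'rV[R]_n) : 'rV[R]_n -> R^o :=
  fun x => omega (cinv c x) (coord_tvec A c v (cinv c x))
                            (coord_tvec A c w (cinv c x)).

Definition is_two_form A (omega : T -> tvec R T -> tvec R T -> R) : Prop :=
  [/\ (forall p u v w (a : R), carrier A p ->
         tangent A p u -> tangent A p v -> tangent A p w ->
         omega p (fun f => a * u f + v f) w = a * omega p u w + omega p v w),
      (forall p u v, carrier A p -> tangent A p u -> tangent A p v ->
         omega p u v = - omega p v u) &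
      (forall c v w, A c ->
         smooth_on (cmap c @` cdom c) (form_coord A omega c v w))].

(* d omega = 0, evaluated on coordinate (hence commuting) vector fields. *)
Definition is_closed_form A (omega : T -> tvec R T -> tvec R T -> R) : Prop :=
  forall c u v w x, A c -> (cmap c @` cdom c) x ->
    'D_u (form_coord A omega c v w) x + 'D_v (form_coord A omega c w u) x
    + 'D_w (form_coord A omega c u v) x = 0.

Definition is_nondegenerate A (omega : T -> tvec R T -> tvec R T -> R) : Prop :=
  forall p u, carrier A p -> tangent A p u ->
    (forall v, tangent A p v -> omega p u v = 0) -> u = (fun=> 0).

Definition symplectic_form A (omega : T -> tvec R T -> tvec R T -> R) : Prop :=
  [/\ is_two_form A omega, is_closed_form A omega & is_nondegenerate A omega].

(* X_H(p) is the tangent vector u with omega(u, v) = dH(v) for all v in T_pM,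
   where dH(v) = v H. *)
Definition ham_vf A (omega : T -> tvec R T -> tvec R T -> R) (H : T -> R)
    (p : T) : tvec R T :=
  xget (fun=> 0) [set u | tangent A p u /\
                          forall v, tangent A p v -> omega p u v = v H].

Definition restr_chart c (U : set T) : chart R T n :=
  Chart (cdom c `&` U) (cmap c) (cinv c).

(* The open submanifold carried by an open set U. *)
Definition restr A (U : set T) : atlas R T n :=
  [set restr_chart c U | c in A].

End Manifold.

Definition euclid (R : realType) (n : nat) : atlas R 'rV[R]_n n :=
  [set Chart setT id id].
Arguments euclid R n : clear implicits.

Section ProductManifold.
Context {R : realType} {T1 T2 : topologicalType} {n1 n2 : nat}.

Definition prod_chart (c1 : chart R T1 n1) (c2 : chart R T2 n2) :
    chart R (T1 * T2)%type (n1 + n2) :=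
  Chart (cdom c1 `*` cdom c2)
        (fun z => row_mx (cmap c1 z.1) (cmap c2 z.2))
        (fun x => (cinv c1 (lsubmx x), cinv c2 (rsubmx x))).

Definition prod_atlas (A1 : atlas R T1 n1) (A2 : atlas R T2 n2) :
    atlas R (T1 * T2)%type (n1 + n2) :=
  [set c | exists c1 c2, [/\ A1 c1, A2 c2 & c = prod_chart c1 c2]].

End ProductManifold.

Section SmoothMaps.
Context {R : realType} {T1 T2 : topologicalType} {n1 n2 : nat}.
Implicit Types (A : atlas R T1 n1) (B : atlas R T2 n2) (F : T1 -> T2).

Definition smooth_map A B F : Prop :=
  (forall p, carrier A p -> carrier B (F p)) /\
  forall c c', A c -> B c' ->
    open (cdom c `&` F @^-1` cdom c') /\
    smooth_on (cmap c @` (cdom c `&` F @^-1` cdom c'))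
              (cmap c' \o F \o cinv c).

(* F_{*p} : T_pM -> T_{F p}N, by precomposition of functions with F. *)
Definition push B F (p : T1) (u : tvec R T1) : tvec R T2 :=
  fun g => if `[< smooth_near B (F p) g >] then u (g \o F) else 0.

Definition is_fibration A B F : Prop :=
  [/\ smooth_map A B F, F @` carrier A = carrier B &
      forall p, carrier A p -> forall w, tangent B (F p) w ->
        exists2 u, tangent A p u & push B F p u = w].

End SmoothMaps.

Section LocalDiffeo.
Context {R : realType} {T1 T2 : topologicalType} {n1 n2 : nat}.

Definition is_local_diffeo (A : atlas R T1 n1) (B : atlas R T2 n2)
    (F : T1 -> T2) : Prop :=
  smooth_map A B F /\
  forall p, carrier A p ->
    exists (V : set T1) (G : T2 -> T1),
      [/\ open V, V p, V `<=` carrier A, open (F @` V) &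
          (forall q, V q -> G (F q) = q) /\
          smooth_map (restr B (F @` V)) (restr A V) G].

(* (u, w) in T_p A x T_q B, seen in T_(p,q) (A x B). *)
Definition tpair (A : atlas R T1 n1) (B : atlas R T2 n2)
    (p : T1) (q : T2) (u : tvec R T1) (w : tvec R T2) : tvec R (T1 * T2)%type :=
  fun g => push (prod_atlas A B) (fun p' => (p', q)) p u g
         + push (prod_atlas A B) (fun q' => (p, q')) q w g.

End LocalDiffeo.

Section HamiltonJacobi.
Context {R : realType} {TM TN TL : topologicalType} {d k : nat}.
Variables (M : atlas R TM d) (omega : TM -> tvec R TM -> tvec R TM -> R).
Variables (H : TM -> R) (N : atlas R TN k) (Pi : TM -> TN).
Variables (L : atlas R TL (d - k)) (Sigma : TN * TL -> TM).

(* X_H^Sigma (n, l) = (Pi_* (X_H (Sigma (n, l))), 0) *)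
Definition lifted_vf (z : TN * TL) : tvec R (TN * TL)%type :=
  tpair N L z.1 z.2 (push N Pi (Sigma z) (ham_vf M omega H (Sigma z))) (fun=> 0).

(* The last clause is i_X Sigma^*omega = Sigma^*dH for X = X_H^Sigma, evaluated
   on v. *)
Definition complete_solution : Prop :=
  [/\ is_manifold L,
      is_local_diffeo (prod_atlas N L) M Sigma,
      Sigma @` carrier (prod_atlas N L) = carrier M,
      (forall z, carrier (prod_atlas N L) z -> Pi (Sigma z) = z.1) &
      (forall z v, carrier (prod_atlas N L) z -> tangent (prod_atlas N L) z v ->
         omega (Sigma z) (push M Sigma z (lifted_vf z)) (push M Sigma z v)
         = push M Sigma z v H)].

Definition isotropic : Prop :=
  forall l n u v, carrier L l -> carrier N n ->
    tangent N n u -> tangent N n v ->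
    omega (Sigma (n, l)) (push M (fun n' => Sigma (n', l)) n u)
                         (push M (fun n' => Sigma (n', l)) n v) = 0.

End HamiltonJacobi.

(* Main.v *)
(** In a chart around [m], functions [f_0 = H], [f_1], ..., [f_(k-1)] in
    involution are built one at a time, together with a chart [(F, G)] whose
    first coordinate fields span the Hamiltonian fields [X_(f_a)]. Given [j]
    functions with [2 j < d], the coordinates of [F] of index [>= j] are
    constant along [X_(f_0)], ..., [X_(f_(j-1))]. Their brackets cannot all
    vanish at the base point, since the Poisson matrix is invertible, so that
    some coordinate [g] among them has a field [X_g] pointing out of the span of
    the previous ones. Since [X_g] commutes with the [X_(f_a)], it can be
    straightened modulo their span without disturbing the first [j] coordinate
    directions, and [f_j := g] extends the family. For [j = 0] the choice
    [g := H] is possible because [dH(m) <> 0].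

    The projection onto the first [k] coordinates is the fibration, and the
    inverse chart [G] is the complete solution: its slices are isotropic since
    they are tangent to the span of the [X_(f_a)], and [X_H] is tangent to
    them, so that [Sigma] carries [(Pi_* X_H, 0)] to [X_H]. *)
Require Import Defs.
From HB Require Import structures.
From mathcomp Require Import all_boot all_order all_algebra.
From mathcomp Require Import all_classical all_reals all_analysis.
From mathcomp Require Import ring lra.
Import Order.TTheory GRing.Theory Num.Theory.
Import numFieldNormedType.Exports.
Set Implicit Arguments.
Unset Strict Implicit.
Unset Printing Implicit Defensive.
Local Open Scope classical_set_scope.
Local Open Scope ring_scope.

(** * Calculus of C^k functions on R^n *)

(** The first coordinate fields are only asked to span the [X_(f_a)], not to coincide with them.
    This lets each step straighten a single field [Y], normalised to have components 0 before index
    [j] and 1 at index [j]. Along its flow the first [j] coordinates do not move and the coordinate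
    of index [j] is the time, so the straightening map has an explicit inverse: the time needed to
    flow back to the hyperplane [z_j = 0] is read off [z] itself. Charts are therefore carried
    everywhere as pairs [(F, G)] of mutually inverse smooth maps. The analytic cost is the smooth
    dependence of flows on the initial point, obtained by induction on the order through the
    linearised flow. Closedness of the form enters through the commutation of Hamiltonian fields
    with vanishing bracket. The bound on [k] comes from linear algebra: an invertible matrix of size
    [n] whose block of indices [>= j] vanishes satisfies [n <= 2 j]. *)

Section NormTools.
Context {R : realType}.

Lemma rVnorm_coord n (v : 'rV[R]_n) i : `|v 0 i| <= `|v|.
Proof.
rewrite [leRHS]/Num.Def.normr/= mx_normrE.
exact: (le_bigmax _ (fun ij : 'I_1 * 'I_n => `|v ij.1 ij.2|) (0, i)).
Qed.

Lemma rVnorm_le n (v : 'rV[R]_n) r : 0 <= r -> (forall i, `|v 0 i| <= r) -> `|v| <= r.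
Proof.
move=> r0 h; rewrite [leLHS]/Num.Def.normr/= mx_normrE bigmax_le//= => -[i j] _ /=.
by rewrite ord1.
Qed.

Lemma rVnorm_lt n (v : 'rV[R]_n) r : 0 < r -> (forall i, `|v 0 i| < r) -> `|v| < r.
Proof.
move=> r0 h; rewrite [ltLHS]/Num.Def.normr/= mx_normrE bigmax_lt//= => -[i j] _ /=.
by rewrite ord1.
Qed.

Lemma delta_norm n (i : 'I_n) : `|delta_mx 0 i : 'rV[R]_n| = 1.
Proof.
apply/eqP; rewrite eq_le; apply/andP; split.
  by apply: rVnorm_le => // j; rewrite mxE; case: (_ && _); rewrite ?normr1 ?normr0.
by apply: le_trans (rVnorm_coord _ i); rewrite mxE !eqxx normr1.
Qed.

Lemma row_sum_coord n (v : 'rV[R]_n) : v = \sum_i v 0 i *: delta_mx 0 i.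
Proof. by rewrite {1}(row_sum_delta v). Qed.

Lemma continuous_normP (V W : normedModType R) (f : V -> W) x :
  {for x, continuous f} <->
  forall e, 0 < e -> exists2 d, 0 < d & forall y, `|y - x| < d -> `|f y - f x| < e.
Proof.
split.
  move=> /cvgrPdist_lt h e e0; have /nbhs_normP[d /= d0 hd] := h e e0.
  by exists d => // y yx; rewrite distrC; apply: hd; rewrite /= distrC.
move=> h; apply/cvgrPdist_lt => e e0; have [d d0 hd] := h e e0.
by apply/nbhs_normP; exists d => // y /= yx; rewrite distrC; apply: hd; rewrite distrC.
Qed.

Lemma open_normP (V : normedModType R) (A : set V) :
  open A <-> forall x, A x -> exists2 d, 0 < d & forall y, `|y - x| < d -> A y.
Proof.
rewrite openE; split.
  move=> h x /h /nbhs_normP[d /= d0 hd]; exists d => // y yx; apply: hd.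
  by rewrite /= distrC.
move=> h x /h[d d0 hd]; apply/nbhs_normP; exists d => // y /= yx; apply: hd.
by rewrite distrC.
Qed.

Lemma continuous_rV (V : normedModType R) n (f : V -> 'rV[R]_n) x :
  {for x, continuous f} <-> forall i, {for x, continuous (fun y => f y 0 i : R^o)}.
Proof.
split.
  move=> h i; apply: (@continuous_comp _ _ _ f (fun v : 'rV[R]_n => v 0 i : R^o)) => //.
  exact: coord_continuous.
move=> h; apply/continuous_normP => e e0.
have /choice[d hd] : forall i, exists d, 0 < d /\ forall y, `|y - x| < d -> `|f y 0 i - f x 0 i| < e.
  by move=> i; have /continuous_normP/(_ e e0)[d d0 hd] := h i; exists d.
exists (\big[Num.min/1]_i d i).
  by apply: lt_bigmin => // i _; case: (hd i).
move=> y yx; apply: rVnorm_lt => // i; rewrite !mxE; apply: (hd i).2.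
by apply: lt_le_trans yx _; exact: bigmin_le_cond.
Qed.

Lemma open_preimage_for (T U : topologicalType) (A : set T) (B : set U) (f : T -> U) :
  open A -> open B -> (forall x, A x -> {for x, continuous f}) -> open (A `&` f @^-1` B).
Proof.
move=> oA oB cf; rewrite openE => x [Ax Bx]; apply: filterI.
  exact: open_nbhs_nbhs.
by apply: (cf x Ax); apply: open_nbhs_nbhs.
Qed.

Lemma diff_normP (V W : normedModType R) (f : V -> W) x (L : {linear V -> W}) :
  continuous L ->
  (forall e, 0 < e -> exists2 d, 0 < d & forall h, `|h| < d -> `|f (x + h) - f x - L h| <= e * `|h|) ->
  differentiable f x /\ 'd f x = L :> (V -> W).
Proof.
move=> cL H.
have E : f \o shift x = cst (f x) + L +o_ 0 id.
  apply/eqaddoP => e e0; have [d d0 hd] := H e e0.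
  apply/nbhs_normP; exists d => // h /=; rewrite sub0r normrN => /hd.
  by rewrite /= !fctE opprD addrA [h + x]addrC.
have D := diff_unique cL E.
by split => //; apply/diff_locallyP; rewrite D.
Qed.

Lemma is_derive_line (V W : normedModType R) (f : V -> W) x v (t : R) :
  derivable f (x + t *: v) v ->
  is_derive t 1 (fun s : R => f (x + s *: v)) ('D_v f (x + t *: v)).
Proof.
have E : (fun h : R => h^-1 *: (((fun s : R => f (x + s *: v)) \o shift t) (h *: 1) - f (x + t *: v)))
       = (fun h : R => h^-1 *: ((f \o shift (x + t *: v)) (h *: v) - f (x + t *: v))).
  apply: funext => h /=; congr (_ *: (f _ - _)).
  by rewrite scaler1 scalerDl addrCA.
by move=> d; split; rewrite /derivable /derive E.
Qed.

(** No order between [a] and [b] is assumed, so that increments of either sign along an axis are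
    covered at once. *)
Lemma MVT_abs (g dg : R -> R) a b :
  (forall c : R, `|c - a| <= `|b - a| -> is_derive c 1 g (dg c)) ->
  exists2 c, `|c - a| <= `|b - a| & g b - g a = dg c * (b - a).
Proof.
move=> h; case: (ltgtP a b) => [ab|ba|->]; last first.
- by exists b; rewrite ?subrr ?mulr0.
- have H c : c \in `[b, a] -> `|c - a| <= `|b - a|.
    by rewrite in_itv /= => /andP[bc ca]; rewrite !ler0_norm ?subr_le0 ?(ltW ba)// !opprB lerB.
  have [c cI E] := @MVT R g dg b a ba
     (fun x hx => h x (H x (subset_itv_oo_cc hx)))
     (derivable_within_continuous (fun x hx => (h x (H x hx)).(ex_derive))).
  exists c; first exact/H/subset_itv_oo_cc.
  by rewrite -opprB E -mulrN opprB.
- have H c : c \in `[a, b] -> `|c - a| <= `|b - a|.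
    by rewrite in_itv /= => /andP[ac cb]; rewrite !ger0_norm ?subr_ge0 ?(ltW ab)// lerB.
  have [c cI E] := @MVT R g dg a b ab
     (fun x hx => h x (H x (subset_itv_oo_cc hx)))
     (derivable_within_continuous (fun x hx => (h x (H x hx)).(ex_derive))).
  by exists c => //; apply/H/subset_itv_oo_cc.
Qed.

End NormTools.

(** * Algebra of C^k functions and differentiability from continuous partial derivatives *)

Section CkTheory.
Context {R : realType}.

Lemma Ck_cont n (W : normedModType R) k (A : set 'rV[R]_n) (f : 'rV[R]_n -> W) :
  Ck_on k A f -> forall x, A x -> {for x, continuous f}.
Proof. by case: k => [|k] []. Qed.

Lemma CkS n (W : normedModType R) k (A : set 'rV[R]_n) (f : 'rV[R]_n -> W) i :
  Ck_on k.+1 A f -> Ck_on k A (fun x => 'D_(delta_mx 0 i) f x).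
Proof. by case=> _ /(_ i)[]. Qed.

Lemma Ck_derivable n (W : normedModType R) k (A : set 'rV[R]_n) (f : 'rV[R]_n -> W) i x :
  Ck_on k.+1 A f -> A x -> derivable f x (delta_mx 0 i).
Proof. by case=> _ /(_ i)[h _] /h. Qed.

Lemma Ck_sub n (W : normedModType R) k (A B : set 'rV[R]_n) (f : 'rV[R]_n -> W) :
  B `<=` A -> Ck_on k A f -> Ck_on k B f.
Proof.
move=> BA; elim: k f => [|k IH] f [c d]; split => //; try by move=> x /BA /c.
by move=> i; have [d1 d2] := d i; split; [move=> x /BA /d1|exact: IH].
Qed.

(** Openness of [A] turns equality on [A] into equality near each of its points, which is what
    two-sided derivatives can see. *)
Lemma Ck_ext n (W : normedModType R) k (A : set 'rV[R]_n) (f g : 'rV[R]_n -> W) :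
  open A -> (forall x, A x -> f x = g x) -> Ck_on k A f -> Ck_on k A g.
Proof.
move=> oA.
have N (f' g' : 'rV[R]_n -> W) : (forall x, A x -> f' x = g' x) -> forall x, A x -> {near x, f' =1 g'}.
  move=> fg x Ax; have /= nA : nbhs x A by exact: open_nbhs_nbhs.
  by near=> y; apply: fg; near: y.
elim: k f g => [|k IH] f g fg [c d]; split => //.
- move=> x Ax; have h : f y @[y --> x] --> g x by rewrite -fg //; exact: c.
  by apply: cvg_trans h; exact: near_eq_cvg (N _ _ fg x Ax).
- move=> x Ax; have h : f y @[y --> x] --> g x by rewrite -fg //; exact: c.
  by apply: cvg_trans h; exact: near_eq_cvg (N _ _ fg x Ax).
- move=> i; have [d1 d2] := d i; split.
    by move=> x Ax; apply: near_eq_derivable (d1 x Ax); exact: N.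
  apply: IH d2 => x Ax; apply: near_eq_derive; exact: N.
Unshelve. all: by end_near. Qed.

Lemma CkW n (W : normedModType R) k (A : set 'rV[R]_n) (f : 'rV[R]_n -> W) :
  Ck_on k.+1 A f -> Ck_on k A f.
Proof.
elim: k f => [|k IH] f h; first by case: h.
split; first exact: Ck_cont h.
by move=> i; split; [move=> x Ax; exact: Ck_derivable h Ax|apply: IH; exact: CkS h].
Qed.

Lemma Ck_local n (W : normedModType R) k (A : set 'rV[R]_n) (f : 'rV[R]_n -> W) :
  (forall x, A x -> exists2 B, B x & Ck_on k B f) -> Ck_on k A f.
Proof.
elim: k f => [|k IH] f h; split => //.
- by move=> x /h[B Bx] /Ck_cont; exact.
- by move=> x /h[B Bx] /Ck_cont; exact.
- move=> i; split; first by move=> x /h[B Bx] /Ck_derivable; exact.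
  by apply: IH => x /h[B Bx H]; exists B => //; exact: CkS H.
Qed.

Lemma Ck_cst n (W : normedModType R) k (A : set 'rV[R]_n) (c : W) :
  Ck_on k A (fun _ : 'rV[R]_n => c).
Proof.
elim: k c => [|k IH] c; split => //; try by move=> x _; exact: cst_continuous.
move=> i; split; first by move=> x _; exact: derivable_cst.
have -> : (fun x : 'rV[R]_n => 'D_(delta_mx 0 i) (fun _ : 'rV[R]_n => c) x) = (fun=> 0).
  by apply: funext => x; exact: derive_cst.
exact: IH.
Qed.

Lemma Ck_D n (W : normedModType R) k (A : set 'rV[R]_n) (f g : 'rV[R]_n -> W) :
  open A -> Ck_on k A f -> Ck_on k A g -> Ck_on k A (fun x => f x + g x).
Proof.
move=> oA; elim: k f g => [|k IH] f g hf hg; split => //.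
- by move=> x Ax; apply: continuousD; [exact: Ck_cont hf _ Ax|exact: Ck_cont hg _ Ax].
- by move=> x Ax; apply: continuousD; [exact: Ck_cont hf _ Ax|exact: Ck_cont hg _ Ax].
- move=> i; split.
    by move=> x Ax; apply: derivableD; [exact: Ck_derivable hf Ax|exact: Ck_derivable hg Ax].
  apply: Ck_ext (IH _ _ (CkS i hf) (CkS i hg)) => // x Ax.
  by rewrite deriveD //; [exact: Ck_derivable hf Ax|exact: Ck_derivable hg Ax].
Qed.

Lemma Ck_M n k (A : set 'rV[R]_n) (f g : 'rV[R]_n -> R^o) :
  open A -> Ck_on k A f -> Ck_on k A g -> Ck_on k A (fun x => f x * g x : R^o).
Proof.
move=> oA; elim: k f g => [|k IH] f g hf hg; split => //.
- by move=> x Ax; apply: continuousM; [exact: Ck_cont hf _ Ax|exact: Ck_cont hg _ Ax].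
- by move=> x Ax; apply: continuousM; [exact: Ck_cont hf _ Ax|exact: Ck_cont hg _ Ax].
- move=> i; split.
    by move=> x Ax; apply: derivableM; [exact: Ck_derivable hf Ax|exact: Ck_derivable hg Ax].
  apply: Ck_ext (Ck_D oA (IH _ _ (CkW hf) (CkS i hg)) (IH _ _ (CkW hg) (CkS i hf))) => // x Ax.
  by rewrite deriveM //; [exact: Ck_derivable hf Ax|exact: Ck_derivable hg Ax].
Qed.

Lemma Ck_Z n k (A : set 'rV[R]_n) (c : R) (f : 'rV[R]_n -> R^o) :
  open A -> Ck_on k A f -> Ck_on k A (fun x => c * f x : R^o).
Proof. by move=> oA hf; apply: Ck_M => //; exact: Ck_cst. Qed.

Lemma Ck_N n k (A : set 'rV[R]_n) (f : 'rV[R]_n -> R^o) :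
  open A -> Ck_on k A f -> Ck_on k A (fun x => - f x : R^o).
Proof.
by move=> oA hf; apply: Ck_ext (Ck_Z (-1) oA hf) => // x _; rewrite mulN1r.
Qed.

Lemma Ck_V n k (A : set 'rV[R]_n) (f : 'rV[R]_n -> R^o) :
  open A -> (forall x, A x -> f x != 0) -> Ck_on k A f -> Ck_on k A (fun x => (f x)^-1 : R^o).
Proof.
move=> oA f0; elim: k f f0 => [|k IH] f f0 hf; split => //.
- by move=> x Ax; have C := Ck_cont hf Ax; apply: (cvgV (f0 x Ax) C).
- by move=> x Ax; have C := Ck_cont hf Ax; apply: (cvgV (f0 x Ax) C).
- move=> i; split.
    by move=> x Ax; apply: derivableV; [exact: f0|exact: Ck_derivable hf Ax].
  have H := IH _ f0 (CkW hf).
  apply: Ck_ext (Ck_N oA (Ck_M oA (Ck_M oA H H) (CkS i hf))) => // x Ax.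
  rewrite deriveV //; [|exact: f0|exact: Ck_derivable hf Ax].
  by rewrite -mulNr expr2 invfM.
Qed.

Lemma Ck_sum n (W : normedModType R) k (A : set 'rV[R]_n) (I : Type) (r : seq I) (P : pred I) (f : I -> 'rV[R]_n -> W) :
  open A -> (forall i, P i -> Ck_on k A (f i)) -> Ck_on k A (fun x => \sum_(i <- r | P i) f i x).
Proof.
move=> oA h; elim: r => [|i r IH].
  by apply: Ck_ext (Ck_cst k A 0) => // x _; rewrite big_nil.
case Pi : (P i).
  by apply: Ck_ext (Ck_D oA (h i Pi) IH) => // x _; rewrite big_cons Pi.
by apply: Ck_ext IH => // x _; rewrite big_cons Pi.
Qed.

Lemma Ck_prod n k (A : set 'rV[R]_n) (I : Type) (r : seq I) (P : pred I) (f : I -> 'rV[R]_n -> R^o) :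
  open A -> (forall i, P i -> Ck_on k A (f i)) -> Ck_on k A (fun x => \prod_(i <- r | P i) f i x : R^o).
Proof.
move=> oA h; elim: r => [|i r IH].
  by apply: Ck_ext (Ck_cst k A (1 : R^o)) => // x _; rewrite big_nil.
case Pi : (P i).
  by apply: Ck_ext (Ck_M oA (h i Pi) IH) => // x _; rewrite big_cons Pi.
by apply: Ck_ext IH => // x _; rewrite big_cons Pi.
Qed.

Lemma Ck_coord n m k (A : set 'rV[R]_n) (f : 'rV[R]_n -> 'rV[R]_m) :
  open A -> Ck_on k A f <-> forall j, Ck_on k A (fun x => f x 0 j : R^o).
Proof.
move=> oA; elim: k f => [|k IH] f.
  split.
    by move=> h j; split => // x Ax; have /continuous_rV := Ck_cont h Ax; exact.
  by move=> h; split => // x Ax; apply/continuous_rV => i; exact: Ck_cont (h i) _ Ax.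
split.
  move=> h j; split; first by move=> x Ax; have /continuous_rV := Ck_cont h Ax; exact.
  move=> i; split.
    by move=> x Ax; have /derivable_mxP/(_ 0 j) := Ck_derivable (i := i) h Ax.
  have /IH/(_ j) := CkS i h; apply: Ck_ext => // x Ax.
  by rewrite derive_mx ?mxE //; exact: Ck_derivable h Ax.
move=> h; split; first by move=> x Ax; apply/continuous_rV => i; exact: Ck_cont (h i) _ Ax.
have D i x : A x -> derivable f x (delta_mx 0 i).
  by move=> Ax; apply/derivable_mxP => a b; rewrite ord1; exact: Ck_derivable (h b) Ax.
move=> i; split; first by move=> x; exact: D.
apply/IH => j; apply: Ck_ext (CkS i (h j)) => // x Ax.
by rewrite derive_mx ?mxE //; exact: D.
Qed.

Lemma Ck_proj n k (A : set 'rV[R]_n) (j : 'I_n) : Ck_on k A (fun x : 'rV[R]_n => x 0 j : R^o).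
Proof.
have D (v x : 'rV[R]_n) : is_derive x v (fun x : 'rV[R]_n => x 0 j : R^o) (v 0 j).
  have dd := differentiable_coord x 0 j.
  split; first exact: diff_derivable.
  have := @derive_mx R _ _ _ (id : 'rV[R]_n -> 'rV[R]_n) x v (@derivable_id _ _ _ _).
  by rewrite derive_id => /matrixP/(_ 0 j); rewrite mxE.
case: k => [|k]; split => //; try by move=> x _; exact: coord_continuous.
move=> i; split; first by move=> x _; exact: ex_derive.
have -> : (fun x : 'rV[R]_n => 'D_(delta_mx 0 i) (fun y : 'rV[R]_n => y 0 j : R^o) x)
        = (fun=> (delta_mx 0 i : 'rV[R]_n) 0 j).
  by apply: funext => x; exact: derive_val.
exact: Ck_cst.
Qed.

(* The increment along [h] is split into moves along one axis at a time. *)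
Lemma partial_differentiable n (A : set 'rV[R]_n) (f : 'rV[R]_n -> R^o) x :
  open A -> Ck_on 1 A f -> A x ->
  differentiable f x /\
  forall v, 'd f x v = \sum_i v 0 i * 'D_(delta_mx 0 i) f x.
Proof.
move=> oA hf Ax.
pose L (v : 'rV[R]_n) : R^o := \sum_i v 0 i * 'D_(delta_mx 0 i) f x.
have Llin : linear L.
  move=> a u v; rewrite /L scaler_sumr -big_split /=; apply: eq_bigr => i _.
  by rewrite !mxE mulrDl /GRing.scale /= mulrA.
pose LM := GRing.isLinear.Build _ _ _ _ _ Llin.
pose LL : {linear 'rV[R]_n -> R^o} := HB.pack L LM.
have cL : continuous LL.
  move=> v; have : Ck_on 0 setT L; last by move=> /Ck_cont; exact.
  apply: Ck_sum => [|i _]; first exact: openT.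
  by apply: Ck_M; [exact: openT|exact: Ck_proj|exact: Ck_cst].
suff H e : 0 < e -> exists2 d, 0 < d & forall h, `|h| < d -> `|f (x + h) - f x - LL h| <= e * `|h|.
  by have [df E] := diff_normP cL H; split => // v; rewrite E.
move=> e0.
pose tr j (h : 'rV[R]_n) : 'rV[R]_n := \row_i (if (i < j)%N then h 0 i else 0).
have ntr j h : `|tr j h| <= `|h|.
  apply: rVnorm_le => // i; rewrite mxE; case: ifP; rewrite ?normr0 // => _.
  exact: rVnorm_coord.
have trS (j : 'I_n) h : tr j.+1 h = tr j h + h 0 j *: delta_mx 0 j.
  apply/rowP => i; rewrite !mxE /=; have [->|ij] := eqVneq i j.
    by rewrite ltnSn ltnn add0r mulr1.
  by rewrite ltnS leq_eqVlt val_eqE (negPf ij) mulr0 addr0.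
have [d1 d10 hd1] := (open_normP A).1 oA x Ax.
(* The error [e] is shared between the [n] axes; dividing by [n.+1] also covers [n = 0]. *)
pose e' := e / n.+1%:R.
have e'0 : 0 < e' by rewrite divr_gt0.
have /choice[d hd] : forall i, exists d, 0 < d /\ forall y, `|y - x| < d ->
    `|'D_(delta_mx 0 i) f y - 'D_(delta_mx 0 i) f x| < e'.
  move=> i; have /continuous_normP/(_ e' e'0)[d d0 Hd] := Ck_cont (CkS i hf) Ax.
  by exists d.
pose d2 := Num.min d1 (\big[Num.min/1]_i d i).
exists d2.
  by rewrite lt_min d10 /=; apply: lt_bigmin => // i _; case: (hd i).
move=> h; rewrite lt_min => /andP[hd1' hd2].
have P j : (j <= n)%N -> `|f (x + tr j h) - f x - \sum_(i < n | (i < j)%N) h 0 i * 'D_(delta_mx 0 i) f x| <= j%:R * e' * `|h|.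
  elim: j => [_|j IH jn].
    have -> : tr 0 h = 0 by apply/rowP => i; rewrite !mxE.
    by rewrite big1 // addr0 subrr subr0 normr0 !mul0r.
  pose J := Ordinal jn.
  (* Every point of the broken path stays within [|h|] of [x]: for the sup norm, a vector whose
     coordinates are each bounded by those of [h] is no longer than [h]. *)
  have step (c : R) : `|c - 0| <= `|h 0 J - 0| -> `|x + tr j h + c *: delta_mx 0 J - x| <= `|h|.
    rewrite !subr0 -(addrA x) [x + (_ + _)]addrC addrK => ch.
    apply: rVnorm_le => // i; rewrite !mxE /=; have [->|ij] := eqVneq i J.
      by rewrite ltnn mulr1 add0r; exact: le_trans ch (rVnorm_coord _ _).
    rewrite mulr0 addr0.
    by case: ifP => _; rewrite ?normr0 ?rVnorm_coord.
  have [c hc] := @MVT_abs R (fun s => f (x + tr j h + s *: delta_mx 0 J))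
    (fun s => 'D_(delta_mx 0 J) f (x + tr j h + s *: delta_mx 0 J)) 0 (h 0 J)
    (fun c hc => is_derive_line (Ck_derivable hf (hd1 _ (le_lt_trans (step c hc) hd1')))).
  rewrite scale0r addr0 subr0 -[_ + h 0 J *: _]addrA -(trS J) => Ec.
  rewrite (bigD1 J) /=; last exact: ltnSn.
  rewrite (eq_bigl (fun i : 'I_n => (i < j)%N)); last first.
    move=> i; rewrite ltnS [in LHS]leq_eqVlt; have [->|ij] := eqVneq i J.
      by rewrite ltnn andbF.
    by rewrite andbT (_ : (i == j :> nat) = false) //; exact: negPf ij.
  set S := \sum_(i < n | _) _.
  set q := f (x + tr j.+1 h); set p := f (x + tr j h); set Dx := 'D_(delta_mx 0 J) f x.
  have -> : q - f x - (h 0 J * Dx + S) =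
     (p - f x - S) + ('D_(delta_mx 0 J) f (x + tr j h + c *: delta_mx 0 J) - Dx) * h 0 J.
    by rewrite mulrBl -Ec /q /p; ring.
  rewrite (le_trans (ler_normD _ _)) // -natr1 [(_ + 1) * e']mulrDl [_ * `|h|]mulrDl mul1r lerD //.
    exact: IH (ltnW jn).
  rewrite normrM ler_pM // ?rVnorm_coord // ltW // (hd J).2 //.
  apply: le_lt_trans (step c hc) _; apply: lt_le_trans hd2 _; exact: bigmin_le_cond.
have := P n (leqnn n).
have -> : tr n h = h by apply/rowP => i; rewrite mxE ltn_ord.
rewrite (eq_bigl xpredT) => [|i]; last by rewrite ltn_ord.
move=> /le_trans; apply; rewrite ler_wpM2r // /e' mulrC -mulrA ger_pMr //.
by rewrite mulrC ler_pdivrMr // mul1r ler_nat.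
Qed.

End CkTheory.

(** * Chain rule and symmetry of second derivatives *)

Section CkComp.
Context {R : realType}.

Lemma C1_differentiable n m (A : set 'rV[R]_n) (f : 'rV[R]_n -> 'rV[R]_m) x :
  open A -> Ck_on 1 A f -> A x -> differentiable f x.
Proof.
move=> oA hf Ax.
have -> : f = \sum_(j < m) (fun y => f y 0 j *: (delta_mx 0 j : 'rV[R]_m)).
  by apply: funext => y; rewrite fct_sumE; exact: row_sum_coord.
apply: differentiable_sum => j; apply: differentiableZl.
by have [] := partial_differentiable oA ((Ck_coord _ _ oA).1 hf j) Ax.
Qed.

Lemma derive_partial n (A : set 'rV[R]_n) (f : 'rV[R]_n -> R^o) x v :
  open A -> Ck_on 1 A f -> A x ->
  'D_v f x = \sum_i v 0 i * 'D_(delta_mx 0 i) f x.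
Proof.
by move=> oA hf Ax; have [D E] := partial_differentiable oA hf Ax; rewrite deriveE // E.
Qed.

Lemma derive_chain n m (W : normedModType R) (f : 'rV[R]_n -> 'rV[R]_m) (g : 'rV[R]_m -> W) x v :
  differentiable f x -> differentiable g (f x) ->
  'D_v (fun y => g (f y)) x = 'D_('D_v f x) g (f x).
Proof.
move=> df dg; rewrite (deriveE _ df) (deriveE _ dg) deriveE.
  by rewrite (diff_comp df dg).
exact: differentiable_comp.
Qed.

(** By the chain rule a partial derivative of the composite is a sum of products of partial
    derivatives of [f] with partial derivatives of [g] composed with the same [f]; the latter have
    one order less, so the induction lets [g] vary. *)
Lemma Ck_comp n m k (A : set 'rV[R]_n) (B : set 'rV[R]_m) (f : 'rV[R]_n -> 'rV[R]_m)
  (g : 'rV[R]_m -> R^o) : open A -> open B -> (forall x, A x -> B (f x)) ->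
  Ck_on k A f -> Ck_on k B g -> Ck_on k A (fun x => g (f x)).
Proof.
move=> oA oB AB; elim: k f g AB => [|k IH] f g AB hf hg.
  split => // x Ax; have C1 := Ck_cont hf Ax; have C2 := Ck_cont hg (AB x Ax).
  exact: continuous_comp C1 C2.
split.
  move=> x Ax; have C1 := Ck_cont hf Ax; have C2 := Ck_cont hg (AB x Ax).
  exact: continuous_comp C1 C2.
have C1 k' (W : normedModType R) p (E : set 'rV[R]_p) (h : 'rV[R]_p -> W) : Ck_on k'.+1 E h -> Ck_on 1 E h.
  by elim: k' => // k' IH' /CkW.
have Df x : A x -> differentiable f x by move=> Ax; exact: C1_differentiable oA (C1 _ _ _ _ _ hf) Ax.
have Dg x : A x -> differentiable g (f x).
  by move=> Ax; have [] := partial_differentiable oB (C1 _ _ _ _ _ hg) (AB x Ax).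
move=> i; split.
  by move=> x Ax; apply/diff_derivable/differentiable_comp; [exact: Df|exact: Dg].
apply: (@Ck_ext _ _ _ _ _ (fun x => \sum_j ('D_(delta_mx 0 i) f x) 0 j * 'D_(delta_mx 0 j) g (f x))) => //.
  move=> x Ax; rewrite (derive_chain _ (Df x Ax) (Dg x Ax)).
  by rewrite (derive_partial _ oB (C1 _ _ _ _ _ hg) (AB x Ax)).
apply: Ck_sum => // j _; apply: Ck_M => //.
  by apply (Ck_coord _ _ oA).1; exact: CkS hf.
by apply: (IH f (fun z => 'D_(delta_mx 0 j) g z) AB); [exact: CkW hf|exact: CkS hg].
Qed.

Lemma Ck_comp_rV n m p k (A : set 'rV[R]_n) (B : set 'rV[R]_m) (f : 'rV[R]_n -> 'rV[R]_m)
  (g : 'rV[R]_m -> 'rV[R]_p) : open A -> open B -> (forall x, A x -> B (f x)) ->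
  Ck_on k A f -> Ck_on k B g -> Ck_on k A (fun x => g (f x)).
Proof.
move=> oA oB AB hf hg; apply (Ck_coord _ _ oA).2 => j.
exact: (Ck_comp oA oB AB hf ((Ck_coord _ _ oB).1 hg j)).
Qed.

Lemma half_dist_absurd (a b w : R) : `|w - a| < `|a - b| / 2 -> `|w - b| < `|a - b| / 2 -> False.
Proof.
move=> h1 h2; have : `|a - b| < `|a - b| / 2 + `|a - b| / 2.
  rewrite -{1}(subrKA w) (le_lt_trans (ler_normD _ _)) // ltrD //.
  by rewrite distrC.
by rewrite -splitr ltxx.
Qed.

(** The mean value theorem is used twice: along [u] for the difference of two translates of [f],
    then along [v] for ['D_u f]. *)
Lemma second_difference_mvt (V : normedModType R) (A : set V) (f : V -> R^o) x u v (s : R) :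
  (forall a b, `|a| <= `|s| -> `|b| <= `|s| -> A (x + a *: u + b *: v)) ->
  (forall y, A y -> derivable f y u) ->
  (forall y, A y -> derivable (fun z => 'D_u f z) y v) ->
  exists c d, [/\ `|c| <= `|s|, `|d| <= `|s| &
    f (x + s *: u + s *: v) - f (x + s *: u) - (f (x + s *: v) - f x) =
    'D_v (fun z => 'D_u f z) (x + c *: u + d *: v) * s * s].
Proof.
move=> HA du dvu.
pose g (t : R) : R^o := f (x + s *: v + t *: u) - f (x + t *: u).
have Dg (c : R) : `|c - 0| <= `|s - 0| ->
    is_derive c 1 g ('D_u f (x + s *: v + c *: u) - 'D_u f (x + c *: u)).
  rewrite !subr0 => cs; apply: is_deriveB; apply: is_derive_line; apply: du.
    by rewrite addrAC; exact: HA.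
  by rewrite -[_ + _ *: u]addr0 -(scale0r v); apply: HA => //; rewrite normr0.
have [c hc Ec] := MVT_abs Dg.
rewrite !subr0 in hc.
have Dh (d : R) : `|d - 0| <= `|s - 0| ->
   is_derive d 1 (fun t : R => 'D_u f (x + c *: u + t *: v)) ('D_v (fun z => 'D_u f z) (x + c *: u + d *: v)).
  rewrite !subr0 => ds.
  by apply: (@is_derive_line _ _ _ (fun z => 'D_u f z)); apply: dvu; exact: HA.
have [d hd Ed] := MVT_abs Dh.
rewrite !subr0 in hd.
exists c, d; split => //.
move: Ec; rewrite /g scale0r !addr0 subr0.
rewrite scale0r addr0 subr0 in Ed.
rewrite [x + s *: v + c *: u]addrAC Ed [x + s *: v + s *: u]addrAC.
by move=> <-.
Qed.

(** The second difference is symmetric in [u] and [v], so the two mixed derivatives share a value,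
    taken at two points close to [x]. If they differed at [x], continuity would keep these values
    apart. *)
Lemma mixed_partials (V : normedModType R) (A : set V) (f : V -> R^o) x u v :
  open A -> A x ->
  (forall y, A y -> derivable f y u) -> (forall y, A y -> derivable f y v) ->
  (forall y, A y -> derivable (fun z => 'D_u f z) y v) ->
  (forall y, A y -> derivable (fun z => 'D_v f z) y u) ->
  {for x, continuous (fun z => 'D_v (fun z => 'D_u f z) z : R^o)} ->
  {for x, continuous (fun z => 'D_u (fun z => 'D_v f z) z : R^o)} ->
  'D_v (fun z => 'D_u f z) x = 'D_u (fun z => 'D_v f z) x.
Proof.
move=> oA Ax du dv dvu duv c1 c2; apply: contrapT => /eqP ne.
set a := 'D_v _ x in ne *; set b := 'D_u _ x in ne *.
pose e := `|a - b| / 2.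
have e0 : 0 < e by rewrite divr_gt0 // normr_gt0 subr_eq0.
have [d0 d00 hd0] := (open_normP A).1 oA x Ax.
have [d1 d10 hd1] := (continuous_normP _ _).1 c1 e e0.
have [d2 d20 hd2] := (continuous_normP _ _).1 c2 e e0.
pose d := Num.min d0 (Num.min d1 d2).
have dgt0 : 0 < d by rewrite !lt_min d00 d10 d20.
(* With this [N], the product [s * N] is [d / 2], so the points with both parameters at most [s]
   stay within [d] of [x]; the summand 1 keeps [N] positive when [u] and [v] vanish. *)
pose N := `|u| + `|v| + 1.
have N0 : 0 < N by rewrite ltr_wpDl.
pose s := d / (2 * N).
have s0 : 0 < s by rewrite divr_gt0 // mulr_gt0.
have small (p q : R) : `|p| <= `|s| -> `|q| <= `|s| -> `|x + p *: u + q *: v - x| < d.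
  rewrite (gtr0_norm s0) => ps qs; rewrite -(addrA x) [x + _]addrC addrK.
  rewrite (le_lt_trans (ler_normD _ _)) // !normrZ.
  apply: (@le_lt_trans _ _ (s * N)).
    rewrite !mulrDr mulr1; have := ler_wpM2r (normr_ge0 u) ps.
    by have := ler_wpM2r (normr_ge0 v) qs; lra.
  by rewrite /s invfM mulrA divfK ?gt_eqF //; lra.
have dA p q : `|p| <= `|s| -> `|q| <= `|s| -> A (x + p *: u + q *: v).
  by move=> ps qs; apply: hd0; have := small p q ps qs; rewrite lt_min => /andP[].
have dA' p q : `|p| <= `|s| -> `|q| <= `|s| -> A (x + p *: v + q *: u).
  by move=> ps qs; rewrite addrAC; exact: dA.
have [p1 [q1 [hp1 hq1 E1]]] := second_difference_mvt dA du dvu.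
have [p2 [q2 [hp2 hq2 E2]]] := second_difference_mvt dA' dv duv.
have : 'D_v (fun z => 'D_u f z) (x + p1 *: u + q1 *: v) = 'D_u (fun z => 'D_v f z) (x + p2 *: v + q2 *: u).
  have s0' : s != 0 by rewrite gt_eqF.
  rewrite [x + s *: v + s *: u]addrAC in E2.
  move: E1 E2; move: ('D_v _ _) ('D_u _ _) (f _) (f _) (f _) (f _) => p q f1 f2 f3 f4 E1 E2.
  have : p * s * s = q * s * s by rewrite -E1 -E2; ring.
  by move=> /(mulIf s0')/(mulIf s0').
have := hd1 _ (lt_le_trans (small p1 q1 hp1 hq1) _).
have := hd2 (x + p2 *: v + q2 *: u).
rewrite -/a -/b [x + p2 *: v + q2 *: u]addrAC.
move=> H2 H1 E.
have K1 : `|'D_v (fun z => 'D_u f z) (x + p1 *: u + q1 *: v) - a| < e.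
  by apply: H1; rewrite /d !ge_min lexx !orbT.
have K2 : `|'D_u (fun z => 'D_v f z) (x + q2 *: u + p2 *: v) - b| < e.
  by apply: H2; apply: lt_le_trans (small _ _ hq2 hp2) _; rewrite /d !ge_min lexx !orbT.
rewrite -E in K2.
exact: half_dist_absurd K1 K2.
Qed.

End CkComp.

(** * Ordinary differential equations and smoothness of flows *)

Section ScalarODE.
Context {R : realType}.

Lemma is_derive_rV n (g : R -> 'rV[R]_n) t v :
  is_derive t (1 : R) g v <-> forall i, is_derive t (1 : R) (fun s => g s 0 i) (v 0 i).
Proof.
split.
  move=> [d E] i; split; first by have /derivable_mxP/(_ 0 i) := d.
  by rewrite -E derive_mx // mxE.
move=> h; have d : derivable g t (1 : R).
  by apply/derivable_mxP => a b; rewrite ord1; case: (h b).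
split => //; rewrite derive_mx //; apply/rowP => i; rewrite mxE.
by case: (h i).
Qed.

Lemma is_derive_near (V W : normedModType R) (f g : V -> W) a v d :
  {near a, f =1 g} -> is_derive a v f d -> is_derive a v g d.
Proof. by move=> fg; apply: near_eq_is_derive. Qed.

Lemma is_derive_continuous (g : R -> R) t d : is_derive t (1 : R) g d -> {for t, continuous g}.
Proof. by move=> [/derivable1_diffP D _]; exact: differentiable_continuous. Qed.

Lemma is_derive_expM (l s : R) : is_derive s (1 : R) (fun x => expR (l * x)) (l * expR (l * s)).
Proof.
have H : is_derive s (1 : R) (fun x : R => l * x) l.
  have H := @is_deriveZ R R^o R^o id l s 1 1 (is_derive_id s 1).
  by move: H; rewrite /GRing.scale /= mulr1.
have := @is_derive1_comp R expR (fun x => l * x) s _ _ (is_derive_expR (l * s)) H.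
by rewrite mulrC.
Qed.

(** The right-hand side is the increment of [K * expR (l * s) + e * s], whose derivative dominates
    [|dg|]; the mean value theorem is applied to its difference with [b * g], for both signs [b]. *)
Lemma growth_pos (g dg : R -> R) (t K l e : R) : 0 <= t ->
  (forall s, 0 <= s <= t -> is_derive s (1 : R) g (dg s) /\ `|dg s| <= K * l * expR (l * s) + e) ->
  `|g t - g 0| <= K * (expR (l * t) - 1) + e * t.
Proof.
rewrite le_eqVlt => /predU1P[<- _|t0 h].
  by rewrite subrr normr0 !mulr0 expR0 subrr mulr0 addr0.
have key (b : R) : `|b| = 1 -> b * (g t - g 0) <= K * (expR (l * t) - 1) + e * t.
  move=> b1.
  pose q (s : R) := K * expR (l * s) + e * s - b * g s.
  have dq s : 0 <= s <= t -> is_derive s (1 : R) q (K * (l * expR (l * s)) + e - b * dg s).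
    move=> /h[Dg _]; rewrite /q.
    have D1 := @is_deriveZ R R^o R^o (fun x => expR (l * x)) K s 1 _ (is_derive_expM l s).
    have D2 := @is_deriveZ R R^o R^o id e s 1 1 (is_derive_id s 1).
    have D3 := @is_deriveZ R R^o R^o g b s 1 _ Dg.
    have := is_deriveB (is_deriveD D1 D2) D3.
    by rewrite /GRing.scale /= mulr1.
  have I x : x \in `]0, t[ -> 0 <= x <= t.
    by rewrite in_itv /= => /andP[a c]; rewrite !ltW.
  have I' x : x \in `[0, t] -> 0 <= x <= t by rewrite in_itv.
  have [c /I cI] := @MVT R q _ 0 t t0 (fun x hx => dq x (I x hx))
     (derivable_within_continuous (fun x hx => (dq x (I' x hx)).(ex_derive))).
  have [_ hc] := h c cI.
  have bd : b * dg c <= K * l * expR (l * c) + e.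
    by apply: le_trans hc; rewrite (le_trans (ler_norm _)) // normrM b1 mul1r.
  have : 0 <= (K * (l * expR (l * c)) + e - b * dg c) * (t - 0).
    by rewrite subr0 mulr_ge0 ?(ltW t0) // mulrA subr_ge0.
  move=> pos E; rewrite -E /q mulr0 expR0 mulr0 in pos.
  by nra.
rewrite ler_norml; apply/andP; split.
  by have := key (-1); rewrite normrN normr1 => /(_ erefl); lra.
by have := key 1; rewrite normr1 => /(_ erefl); lra.
Qed.

Lemma growth (g dg : R -> R) (t K l e : R) :
  (forall s, `|s| <= `|t| -> is_derive s (1 : R) g (dg s) /\ `|dg s| <= K * l * expR (l * `|s|) + e) ->
  `|g t - g 0| <= K * (expR (l * `|t|) - 1) + e * `|t|.
Proof.
move=> h; have [t0|t0] := leP 0 t.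
  rewrite ger0_norm // in h *; apply: (growth_pos (dg := dg)) => // s /andP[s0 st].
  by have := h s; rewrite (ger0_norm s0); apply.
have tn : 0 <= - t by rewrite oppr_ge0 ltW.
rewrite ltr0_norm // in h *.
have := @growth_pos (fun s => g (- s)) (fun s => - dg (- s)) (- t) K l e tn.
rewrite opprK oppr0; apply => s /andP[s0 st].
have [D B] : is_derive (- s) (1 : R) g (dg (- s)) /\ `|dg (- s)| <= K * l * expR (l * `|- s|) + e.
  by apply: h; rewrite normrN ger0_norm.
split; last by rewrite normrN; rewrite normrN (ger0_norm s0) in B.
have := @is_derive1_comp R g (fun x => - x) s _ _ D (@is_deriveNid R R^o s 1).
by rewrite mulrN1.
Qed.

Lemma growth_rV n (g dg : R -> 'rV[R]_n) (t K l e : R) : 0 <= K -> 0 <= l -> 0 <= e ->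
  (forall s, `|s| <= `|t| -> is_derive s (1 : R) g (dg s) /\ `|dg s| <= K * l * expR (l * `|s|) + e) ->
  `|g t - g 0| <= K * (expR (l * `|t|) - 1) + e * `|t|.
Proof.
move=> K0 l0 e0 h; apply: rVnorm_le.
  rewrite addr_ge0 // ?mulr_ge0 // subr_ge0 -expR0 ler_expR mulr_ge0 //.
move=> i; rewrite !mxE; apply: (@growth (fun s => g s 0 i) (fun s => dg s 0 i)) => s /h[D B].
split; first by have /is_derive_rV := D; exact.
exact: le_trans (rVnorm_coord _ _) B.
Qed.

(* [S] is the maximum of [|g s| exp (- 2 L |s|)]; the bound on the derivative gives [S <= |g 0| + e T + S / 2]. *)
Lemma gronwall n (g dg : R -> 'rV[R]_n) (T L e t : R) : 0 <= L -> 0 <= e -> `|t| < T ->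
  (forall s, `|s| < T -> is_derive s (1 : R) g (dg s) /\ `|dg s| <= L * `|g s| + e) ->
  `|g t| <= 2 * (`|g 0| + e * T) * expR (2 * L * T).
Proof.
move=> L0 e0 tT h.
pose F (s : R) := `|g s| * expR (- (2 * L) * `|s|).
have st (s : R) : s \in `[- `|t|, `|t|] -> `|s| <= `|t| by rewrite in_itv /= ler_norml.
have cF : {within `[- `|t|, `|t|], continuous F}.
  apply: continuous_in_subspaceT => s /set_mem /st sI.
  have [D _] := h s (le_lt_trans sI tT).
  have cg : {for s, continuous g}.
    by apply/continuous_rV => i; move/is_derive_rV/(_ i)/is_derive_continuous : D.
  have c1 : {for s, continuous (fun x => `|g x|)} := continuous_comp cg (@norm_continuous _ _ _).
  have c2 : {for s, continuous (fun x : R => - (2 * L) * `|x|)}.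
    by apply: (@continuousM R R (cst (- (2 * L))) (fun x : R => `|x|)); [exact: cst_continuous|exact: norm_continuous].
  have c3 : {for s, continuous (fun x : R => expR (- (2 * L) * `|x|))} := continuous_comp c2 (@continuous_expR _ _).
  exact: (continuousM c1 c3).
have [c cI cmax] := EVT_max (ge0_cp (normr_ge0 t)).2 cF.
set S := F c in cmax.
have S0 : 0 <= S by rewrite mulr_ge0 // expR_ge0.
have Eexp (s : R) : expR (- (2 * L) * `|s|) * expR (2 * L * `|s|) = 1.
  by rewrite -expRD mulNr addNr expR0.
have gS s : `|s| <= `|t| -> `|g s| <= S * expR (2 * L * `|s|).
  move=> sI; have : F s <= S by apply: cmax; rewrite in_itv /= -ler_norml.
  rewrite -(ler_pM2r (expR_gt0 (2 * L * `|s|))); apply: le_trans.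
  by rewrite /F -(mulrA `|g s|) Eexp mulr1.
have T0 : 0 < T by exact: le_lt_trans tT.
have ct := st c cI.
have Sb : S <= 2 * (`|g 0| + e * T).
  have B : `|g c - g 0| <= S / 2 * (expR (2 * L * `|c|) - 1) + e * `|c|.
    apply: (@growth_rV n g dg); rewrite ?mulr_ge0 // => s sc; have sI := le_trans sc ct.
    have [D B'] := h s (le_lt_trans sI tT); split => //.
    apply: le_trans B' _; rewrite lerD2r.
    have := ler_wpM2l L0 (gS s sI).
    by move=> /le_trans; apply; rewrite le_eqVlt; apply/orP; left; apply/eqP; field.
  have : `|g c| <= `|g 0| + e * T + S / 2 * expR (2 * L * `|c|).
    have := ler_normD (g 0) (g c - g 0); rewrite addrC subrK.
    have : e * `|c| <= e * T by rewrite ler_wpM2l // ltW // (le_lt_trans ct).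
    by lra.
  move=> /(ler_wpM2r (expR_ge0 (- (2 * L) * `|c|))); rewrite -/(F c) -/S.
  rewrite mulrDl -(mulrA (S / 2)) [expR (_ * _) * expR _]mulrC Eexp mulr1.
  have : (`|g 0| + e * T) * expR (- (2 * L) * `|c|) <= `|g 0| + e * T.
    rewrite ler_piMr //; first by rewrite addr_ge0 // mulr_ge0 // ltW.
    by rewrite -expR0 ler_expR mulNr oppr_le0 mulr_ge0 // mulr_ge0.
  by lra.
apply: le_trans (gS t (lexx _)) _.
apply: ler_pM => //.
by rewrite ler_expR ler_wpM2l // ?mulr_ge0 // ltW.
Qed.

(** The intervals of centre [u j] and half-width [2 * C / 2 ^+ j] are nested, that half-width being
    the tail of the geometric series from [j] on. The limit is the supremum of their left ends, and
    the rate comes with it. *)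
Lemma geometric_limit (u : nat -> R) (C : R) :
  (forall j, `|u j.+1 - u j| <= C / 2 ^+ j) ->
  exists l, forall j, `|u j - l| <= 2 * C / 2 ^+ j.
Proof.
move=> h.
have C0 : 0 <= C by have := h 0%N; rewrite expr0 divr1; exact: le_trans.
pose a j := u j - 2 * C / 2 ^+ j.
pose b j := u j + 2 * C / 2 ^+ j.
have half j : 2 * C / 2 ^+ j.+1 = C / 2 ^+ j.
  by rewrite exprS; field; rewrite expf_neq0.
have half' j : 2 * C / 2 ^+ j = C / 2 ^+ j + C / 2 ^+ j by rewrite -mulrA mulr2n mulrDl mul1r.
have amono j k : a j <= a (j + k)%N.
  elim: k => [|k IH]; first by rewrite addn0.
  rewrite addnS (le_trans IH) // /a half half'.
  by have := h (j + k)%N; rewrite ler_norml => /andP[]; lra.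
have bmono j k : b (j + k)%N <= b j.
  elim: k => [|k IH]; first by rewrite addn0.
  rewrite addnS (le_trans _ IH) // /b half half'.
  by have := h (j + k)%N; rewrite ler_norml => /andP[]; lra.
have ab j : a j <= b j.
  have : 0 <= 2 * C / 2 ^+ j by rewrite divr_ge0 ?mulr_ge0 // exprn_ge0.
  by rewrite /a /b; lra.
have aleb i j : a i <= b j.
  rewrite (le_trans (amono i j)) // (le_trans (ab _)) // addnC; exact: bmono.
exists (sup (range a)) => j.
have ub : ubound (range a) (b j) by move=> _ [i _ <-].
have l1 : a j <= sup (range a) by apply: ub_le_sup; [exists (b j)|exists j].
have l2 : sup (range a) <= b j by apply: ge_sup => //; exists (a 0%N), 0%N.
by rewrite ler_norml; move: l1 l2; rewrite /a /b => l1 l2; apply/andP; split; lra.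
Qed.

(** Retraction of the line onto [[-T, T]]. Composing with it extends data known only there, in time
    or coordinatewise in space, to global data with the same Lipschitz constant. *)
Definition clamp (T t : R) : R := Num.max (- T) (Num.min T t).

Lemma clamp_id T t : `|t| <= T -> clamp T t = t.
Proof.
by rewrite ler_norml => /andP[a b]; rewrite /clamp (min_idPr b) (max_idPr a).
Qed.

Lemma clamp_le T t : 0 <= T -> `|clamp T t| <= T.
Proof.
move=> T0; rewrite /clamp ler_norml le_max ge_max lexx /= ge_min lexx /= andbT.
by rewrite (le_trans _ T0) // oppr_le0.
Qed.

Lemma clamp_lip T s t : `|clamp T s - clamp T t| <= `|s - t|.
Proof.
wlog st : s t / s <= t.
  by move=> H; case: (leP s t) => [/H//|/ltW/H]; rewrite distrC (distrC t).
have [a b] : clamp T s <= clamp T t /\ clamp T t - clamp T s <= t - s.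
  rewrite /clamp !maxEle !minEle.
  by case: (leP T s) => ?; case: (leP T t) => ?; case: (leP (- T) T) => ?; case: (leP (- T) s) => ?;
  case: (leP (- T) t) => ?; split; lra.
by rewrite distrC ger0_norm ?subr_ge0 // distrC ger0_norm ?subr_ge0.
Qed.

Lemma clamp_continuous T : continuous (clamp T).
Proof.
move=> t; apply/continuous_normP => e e0; exists e => // s st.
exact: le_lt_trans (clamp_lip _ _ _) st.
Qed.

Lemma is_derive_derive1 (F : R -> R) (t d : R) :
  derivable F t 1 /\ F^`()%classic t = d -> is_derive t (1 : R) F d.
Proof. by move=> [D E]; split => //; rewrite -derive1E. Qed.

Lemma primitive_exists (h : R -> R) (T : R) : 0 < T -> continuous h ->
  exists F : R -> R, [/\ F 0 = 0, continuous F & forall t, `|t| < T -> is_derive t (1 : R) F (h t)].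
Proof.
move=> T0 ch.
(* Integrating from [- (T + 1)] keeps every [t] with [|t| <= T] in the interior of the interval,
   where the fundamental theorem gives a two-sided derivative. *)
pose F0 (x : R) := (\int[lebesgue_measure]_(t in `[(- (T + 1))%R, x]) (h t))%R.
have D0 t : `|t| <= T -> is_derive t (1 : R) F0 (h t).
  rewrite ler_norml => /andP[a b]; rewrite /F0.
  apply: is_derive_derive1; apply: (@continuous_FTC1_closed R h (- (T + 1)) t (T + 1)).
  - by lra.
  - apply: continuous_compact_integrable; first exact: segment_compact.
    exact: continuous_subspaceT.
  - by lra.
  - exact: ch.
(* Clamping makes the primitive continuous on the whole line, so that it can be fed back into a
   Picard iteration. *)
exists (fun t => F0 (clamp T t) - F0 0); split.
- by rewrite clamp_id ?normr0 ?subrr // ltW.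
- move=> t; have cT : `|clamp T t| <= T by apply: clamp_le; exact: ltW.
  have c1 : {for t, continuous (F0 \o clamp T)} :=
    continuous_comp (@clamp_continuous T t) (is_derive_continuous (D0 _ cT)).
  have c2 : {for t, continuous (fun _ : R => F0 0)} by exact: cst_continuous.
  exact: (continuousB c1 c2).
- move=> t tT.
  have  D : is_derive t (1 : R) (F0 - cst (F0 0)) (h t - 0).
    by apply: is_deriveB; exact: (D0 _ (ltW tT)).
  rewrite subr0 in D; apply: is_derive_near D.
  have oT : open [set s : R | `|s| < T].
    by apply: (open_comp (f := fun s : R => `|s|) (D := [set x | x < T])); [move=> *; exact: norm_continuous|exact: open_lt].
  have : nbhs t [set s : R | `|s| < T] by exact: open_nbhs_nbhs.
  by apply: filterS => s /= sT; rewrite clamp_id // ltW.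
Qed.

Lemma primitive_rV_exists n (h : R -> 'rV[R]_n) (T : R) : 0 < T -> continuous h ->
  exists F : R -> 'rV[R]_n, [/\ F 0 = 0, continuous F & forall t, `|t| < T -> is_derive t (1 : R) F (h t)].
Proof.
move=> T0 ch.
have ci i : continuous (fun t => h t 0 i : R) by move=> t; have /continuous_rV := ch t; exact.
have /choice[F hF] := fun i => primitive_exists T0 (ci i).
exists (fun t => \row_i F i t); split.
- by apply/rowP => i; rewrite !mxE; have [] := hF i.
- move=> t; apply/continuous_rV => i.
  rewrite (_ : (fun y => _) = F i); last by apply: funext => s; rewrite mxE.
  by have [_ c _] := hF i; exact: c.
- move=> t tT; apply/is_derive_rV => i.
  rewrite (_ : (fun y => _) = F i); last by apply: funext => s; rewrite mxE.
  by have [_ _] := hF i; exact.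
Qed.

End ScalarODE.

(** * Picard iteration for globally Lipschitz equations *)

Section Picard.
Context {R : realType}.

Lemma geometric_small (D e : R) : 0 <= D -> 0 < e -> exists j : nat, D / 2 ^+ j < e.
Proof.
move=> D0 e0; exists (Num.bound (D / e)).
have h : D / e < (Num.bound (D / e))%:R by apply: archi_boundP; rewrite divr_ge0 // ltW.
rewrite ltr_pdivrMr ?exprn_gt0 // mulrC -ltr_pdivrMr //; apply: lt_le_trans h _.
by rewrite -natrX ler_nat ltnW // ltn_expl.
Qed.

Lemma geometric_limit_rV n (u : nat -> 'rV[R]_n) (C : R) :
  (forall j, `|u j.+1 - u j| <= C / 2 ^+ j) ->
  exists l, forall j, `|u j - l| <= 2 * C / 2 ^+ j.
Proof.
move=> h.
have hi (i : 'I_n) : exists l, forall j, `|u j 0 i - l| <= 2 * C / 2 ^+ j.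
  apply: (@geometric_limit R (fun j => u j 0 i)) => j.
  by apply: le_trans (h j); have := rVnorm_coord (u j.+1 - u j) i; rewrite !mxE.
have C0 : 0 <= C by have := h 0%N; rewrite expr0 divr1; exact: le_trans.
have /choice[l hl] := hi.
exists (\row_i l i) => j; apply: rVnorm_le => [|i]; last by rewrite !mxE.
by rewrite divr_ge0 ?mulr_ge0 // exprn_ge0.
Qed.

Lemma continuous_bounded_segment n (g : R -> 'rV[R]_n) (T : R) : 0 <= T -> continuous g ->
  exists2 M : R, 0 <= M & forall t, `|t| <= T -> `|g t| <= M.
Proof.
move=> T0 cg.
have cF : {within `[- T, T], continuous (fun t => `|g t|)}.
  apply: continuous_subspaceT => s.
  exact: (continuous_comp (cg s) (@norm_continuous _ _ _)).
have [c _ cmax] := EVT_max (ge0_cp T0).2 cF.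
by exists `|g c| => // t tT; apply: cmax; rewrite in_itv /= -ler_norml.
Qed.

(** In the weight [expR (2 * L * |t|)] each Picard iterate halves the distance to the next, so the
    iteration converges for every [T], however large [L * T] is. *)
Lemma global_ode n (f : R -> 'rV[R]_n -> 'rV[R]_n) (L T : R) x : 0 <= L -> 0 < T ->
  (forall y : R -> 'rV[R]_n, continuous y -> continuous (fun t => f t (y t))) ->
  (forall t a b, `|f t a - f t b| <= L * `|a - b|) ->
  exists y : R -> 'rV[R]_n, y 0 = x /\ forall t, `|t| < T -> is_derive t (1 : R) y (f t (y t)).
Proof.
move=> L0 T0 cf lf.
have T'0 : 0 < T + 1 by rewrite addr_gt0.
(* [P] is a primitive operator vanishing at 0, with an arbitrary value on discontinuous curves. The
   margin 1 in time makes the primitives differentiable up to [|t| = T] included. *)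
have /choice[P hP] : forall h : R -> 'rV[R]_n, exists F : R -> 'rV[R]_n, continuous h ->
    [/\ F 0 = 0, continuous F & forall t, `|t| < T + 1 -> is_derive t (1 : R) F (h t)].
  move=> h; have [ch|nch] := pselect (continuous h); last by exists h.
  by have [F hF] := primitive_rV_exists T'0 ch; exists F.
pose G (y : R -> 'rV[R]_n) t := x + P (fun s => f s (y s)) t.
have cG y : continuous y -> continuous (G y).
  move=> cy t; have [_ c _] := hP _ (cf y cy).
  have c1 : {for t, continuous (fun _ : R => x)} by exact: cst_continuous.
  exact: (continuousD c1 (c t)).
have G0 y : continuous y -> G y 0 = x.
  by move=> cy; have [e _ _] := hP _ (cf y cy); rewrite /G e addr0.
have dG y t : continuous y -> `|t| < T + 1 -> is_derive t (1 : R) (G y) (f t (y t)).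
  move=> cy tT; have [_ _ d] := hP _ (cf y cy).
  have := is_deriveD (@is_derive_cst R R^o _ x t 1) (d t tT).
  by rewrite add0r.
pose y j := iter j G (fun=> x).
have cy j : continuous (y j).
  by elim: j => [|j IH]; [move=> t; exact: cst_continuous|exact: cG].
have y0 j : y j 0 = x by case: j => [//|j]; apply: G0; exact: cy.
have cd : continuous (fun t => y 1%N t - y 0%N t).
  by move=> t; exact: (continuousB (cy 1%N t) (cy 0%N t)).
have [M M0 hM] := continuous_bounded_segment (ltW T0) cd.
(* For [K = M / 2^(j+1)] and [l = 2 * L], the product [K * l] is [L * (M / 2^j)], the bound that the
   Lipschitz condition gives for the derivative; [growth_rV] then returns half of the previous
   constant. *)
have est j t : `|t| <= T -> `|y j.+1 t - y j t| <= M / 2 ^+ j * expR (2 * L * `|t|).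
  elim: j t => [|j IH] t tT.
    rewrite expr0 divr1 (le_trans (hM t tT)) // ler_peMr // -expR0 ler_expR.
    by rewrite !mulr_ge0.
  have K0 : 0 <= M / 2 ^+ j.+1 by rewrite divr_ge0 // exprn_ge0.
  have := @growth_rV R n (fun t => y j.+2 t - y j.+1 t)
     (fun s => f s (y j.+1 s) - f s (y j s)) t (M / 2 ^+ j.+1) (2 * L) 0 K0.
  rewrite !y0 subrr subr0 mul0r addr0 => H.
  apply: (le_trans (H _ _ _)) => //; first by rewrite mulr_ge0.
    move=> s st; have sT := le_trans st tT; split.
      have sT' : `|s| < T + 1 by rewrite (le_lt_trans sT) // ltrDl.
      exact: is_deriveB (dG _ _ (cy j.+1) sT') (dG _ _ (cy j) sT').
    rewrite addr0 (le_trans (lf _ _ _)) //.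
    have := ler_wpM2l L0 (IH s sT).
    move=> /le_trans; apply; rewrite exprS le_eqVlt; apply/orP; left; apply/eqP.
    by field; rewrite expf_neq0.
  by rewrite ler_wpM2l // gerBl.
pose C := M * expR (2 * L * T).
have est' j t : `|t| <= T -> `|y j.+1 t - y j t| <= C / 2 ^+ j.
  move=> tT; rewrite (le_trans (est j t tT)) // mulrAC ler_wpM2r ?invr_ge0 ?exprn_ge0 //.
  by rewrite ler_wpM2l // ler_expR ler_wpM2l // mulr_ge0.
have C0 : 0 <= C by rewrite mulr_ge0 // expR_ge0.
have /choice[l hl] : forall t, exists l, `|t| <= T -> forall j, `|y j t - l| <= 2 * C / 2 ^+ j.
  move=> t; have [tT|nT] := boolP (`|t| <= T); last by exists 0.
  by have [l hl] := geometric_limit_rV (fun j => est' j t tT); exists l.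
(* The limit is known on [[-T, T]] only; clamping gives a curve continuous everywhere, to which the
   operator [G] can be applied. *)
pose Y t := l (clamp T t).
have YE t : `|t| <= T -> Y t = l t by move=> tT; rewrite /Y clamp_id.
have hY j t : `|y j (clamp T t) - Y t| <= 2 * C / 2 ^+ j.
  by apply: hl; apply: clamp_le; exact: ltW.
have cY : continuous Y.
  move=> t; apply/continuous_normP => e e0.
  have e3 : 0 < e / 3 by rewrite divr_gt0.
  have [j hj] := geometric_small (mulr_ge0 (ler0n R 2) C0) e3.
  have cyj : {for t, continuous (y j \o clamp T)} := continuous_comp (@clamp_continuous R T t) (cy j _).
  have [d d0 hd] := (continuous_normP _ _).1 cyj _ e3.
  exists d => // s /hd /= H.
  have h1 := le_lt_trans (hY j s) hj; have h2 := le_lt_trans (hY j t) hj.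
  rewrite -(subrKA (y j (clamp T s))) (le_lt_trans (ler_normD _ _)) //.
  rewrite -(subrKA (y j (clamp T t)) (y j (clamp T s))).
  have := ler_normD (y j (clamp T s) - y j (clamp T t)) (y j (clamp T t) - Y t).
  rewrite distrC in h1; by lra.
(* Both sides are within a constant multiple of [2^-j] of the iterate [y j.+1], for every [j]. *)
have YG t : `|t| < T -> Y t = G Y t.
  move=> tT; apply: contrapT => /eqP; rewrite -subr_eq0 -normr_gt0 => pos.
  have D0 : 0 <= 2 * C + L * (2 * C) * T.
    by rewrite addr_ge0 ?mulr_ge0 // ltW.
  have [j hj] := geometric_small D0 pos.
  suff : `|Y t - G Y t| <= (2 * C + L * (2 * C) * T) / 2 ^+ j by rewrite leNgt hj.
  have E0 : 0 <= L * (2 * C / 2 ^+ j) by rewrite mulr_ge0 // divr_ge0 ?exprn_ge0 // mulr_ge0.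
  have := @growth_rV R n (fun t => y j.+1 t - G Y t) (fun s => f s (y j s) - f s (Y s))
     t 0 0 (L * (2 * C / 2 ^+ j)) (lexx _) (lexx _) E0.
  rewrite y0 (G0 _ cY) subrr subr0 => H.
  have B : `|y j.+1 t - G Y t| <= L * (2 * C / 2 ^+ j) * `|t|.
    rewrite -[leRHS]add0r -[X in _ <= X + _](mul0r (expR (0 * `|t|) - 1)).
    apply: H => s st; have sT := le_lt_trans st tT; split.
      have sT' : `|s| < T + 1 by rewrite (lt_trans sT) // ltrDl.
      exact: is_deriveB (dG _ _ (cy j) sT') (dG _ _ cY sT').
    rewrite mul0r mul0r add0r (le_trans (lf _ _ _)) // ler_wpM2l //.
    by have := hY j s; rewrite clamp_id; last exact: ltW.
  have B' : `|y j.+1 t - Y t| <= 2 * C / 2 ^+ j.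
    have := hY j.+1 t; rewrite clamp_id; last exact: ltW.
    move=> /le_trans; apply.
    rewrite ler_wpM2l ?mulr_ge0 // lef_pV2 ?posrE ?exprn_gt0 //.
    by rewrite ler_weXn2l // ler1n.
  rewrite -(subrKA (y j.+1 t)) (le_trans (ler_normD _ _)) // mulrDl lerD //; first by rewrite distrC.
  apply: le_trans B _; rewrite (_ : L * (2 * C) * T / 2 ^+ j = L * (2 * C / 2 ^+ j) * T); last by ring.
  by rewrite ler_wpM2l // ltW.
exists Y; split.
  by rewrite YG ?normr0 // G0.
move=> t tT; have tT' : `|t| < T + 1 by rewrite (lt_trans tT) // ltrDl.
apply: is_derive_near (dG _ _ cY tT').
have oT : open [set s : R | `|s| < T].
  by apply: (open_comp (f := fun s : R => `|s|) (D := [set x | x < T])); [move=> *; exact: norm_continuous|exact: open_lt].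
have : nbhs t [set s : R | `|s| < T] by exact: open_nbhs_nbhs.
by apply: filterS => s /= sT; rewrite YG.
Qed.

End Picard.

(** * Uniform estimates on compact boxes *)

Section BoxEstimates.
Context {R : realType}.

(** Compact and convex, hence a domain with uniform constants. Each coordinate has its own
    half-width, so that a box of positions times a box of tangent vectors is again a box. *)
Definition cbox n (c r : 'rV[R]_n) : set 'rV[R]_n := [set y | forall i, `|y 0 i - c 0 i| <= r 0 i].

Lemma cbox_compact n (c r : 'rV[R]_n) : compact (cbox c r).
Proof.
have := @rV_compact R n (fun i => `[c 0 i - r 0 i, c 0 i + r 0 i]%classic) (fun i => @segment_compact R _ _).
congr compact; apply: funext => y; apply: propext; split => h i; have := h i; rewrite /= in_itv /= ler_distl.
  by [].
by [].
Qed.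

Lemma cbox_convex n (c r a b : 'rV[R]_n) (s : R) : cbox c r a -> cbox c r b -> 0 <= s <= 1 ->
  cbox c r (a + s *: (b - a)).
Proof.
move=> ha hb /andP[s0 s1] i; rewrite !mxE.
have -> : a 0 i + s * (b 0 i - a 0 i) - c 0 i = (1 - s) * (a 0 i - c 0 i) + s * (b 0 i - c 0 i) by ring.
rewrite (le_trans (ler_normD _ _)) // !normrM ger0_norm ?subr_ge0 // (ger0_norm s0).
have := ler_wpM2l s0 (hb i).
have s1' : 0 <= 1 - s by rewrite subr_ge0.
have := ler_wpM2l s1' (ha i); lra.
Qed.

Lemma cbox_bounded n (c r : 'rV[R]_n) (f : 'rV[R]_n -> R) :
  (forall x, cbox c r x -> {for x, continuous f}) ->
  exists2 M : R, 0 <= M & forall x, cbox c r x -> `|f x| <= M.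
Proof.
move=> cf; have [[x0 hx0]|ne] := pselect (cbox c r !=set0); last first.
  by exists 0 => // x hx; exfalso; apply: ne; exists x.
have cF : {within cbox c r, continuous (fun x => `|f x|)}.
  apply: continuous_in_subspaceT => x /set_mem hx.
  exact: (continuous_comp (cf x hx) (@norm_continuous _ _ _)).
have [x _ hmax] := compact_EVT_max (ex_intro _ _ hx0) (@cbox_compact n c r) cF.
by exists `|f x| => // y hy; apply: hmax; exact/mem_set.
Qed.

Lemma MVT01 (g dg : R -> R) : (forall c : R, 0 <= c <= 1 -> is_derive c (1 : R) g (dg c)) ->
  exists2 c, 0 <= c <= 1 & g 1 - g 0 = dg c.
Proof.
move=> h.
have I x : x \in `]0, 1[ -> 0 <= x <= (1 : R).
  by rewrite in_itv /= => /andP[a c]; rewrite !ltW.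
have I' x : x \in `[0, 1] -> 0 <= x <= (1 : R) by rewrite in_itv.
have [c /I cI E] := @MVT R g dg 0 1 ltr01 (fun x hx => h x (I x hx))
     (derivable_within_continuous (fun x hx => (h x (I' x hx)).(ex_derive))).
by exists c => //; rewrite E subr0 mulr1.
Qed.

Lemma segment_mvt n (O : set 'rV[R]_n) c r (f : 'rV[R]_n -> R^o) a b :
  open O -> cbox c r `<=` O -> Ck_on 1 O f -> cbox c r a -> cbox c r b ->
  exists2 p, cbox c r p /\ `|p - a| <= `|b - a| & f b - f a = \sum_i (b - a) 0 i * 'D_(delta_mx 0 i) f p.
Proof.
move=> oO KO hf ha hb.
have [s sI] := @MVT01 (fun s => f (a + s *: (b - a))) (fun s => 'D_(b - a) f (a + s *: (b - a)))
  (fun s hs => is_derive_line (diff_derivable (partial_differentiable oO hf (KO _ (cbox_convex ha hb hs))).1)).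
rewrite scale1r scale0r addr0 subrKC => E.
have hp := cbox_convex ha hb sI.
exists (a + s *: (b - a)); last by rewrite E (derive_partial _ oO hf (KO _ hp)).
split => //; rewrite addrC addKr normrZ; case/andP: sI => s0 s1.
by rewrite ger0_norm // ler_piMl.
Qed.

Lemma cbox_lipschitz n (O : set 'rV[R]_n) c r (f : 'rV[R]_n -> R^o) :
  open O -> cbox c r `<=` O -> Ck_on 1 O f ->
  exists2 L : R, 0 <= L & forall a b, cbox c r a -> cbox c r b -> `|f b - f a| <= L * `|b - a|.
Proof.
move=> oO KO hf.
have /choice[M hM] : forall i, exists M, 0 <= M /\ forall x, cbox c r x -> `|'D_(delta_mx 0 i) f x| <= M.
  move=> i; have [|M M0 hM] := @cbox_bounded n c r (fun x => 'D_(delta_mx 0 i) f x).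
    by move=> x /KO Ox; have C := Ck_cont (CkS i hf) Ox; exact: C.
  by exists M.
exists (\sum_i M i); first by apply: sumr_ge0 => i _; case: (hM i).
move=> a b ha hb; have [p [hp _] ->] := segment_mvt oO KO hf ha hb.
rewrite mulr_suml (le_trans (ler_norm_sum _ _ _)) //; apply: ler_sum => i _.
rewrite normrM mulrC ler_pM //; first exact: (hM i).2.
exact: rVnorm_coord.
Qed.

(** The intermediate point [p] is within [|b - a|] of [a], so the Lipschitz bound on the partial
    derivatives gives a quadratic remainder with one constant for the whole box. *)
Lemma cbox_taylor n (O : set 'rV[R]_n) c r (f : 'rV[R]_n -> R^o) :
  open O -> cbox c r `<=` O -> Ck_on 2 O f ->
  exists2 L : R, 0 <= L & forall a b, cbox c r a -> cbox c r b ->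
    `|f b - f a - 'D_(b - a) f a| <= L * `|b - a| ^+ 2.
Proof.
move=> oO KO hf.
have /choice[M hM] : forall i, exists M, 0 <= M /\ forall a b, cbox c r a -> cbox c r b ->
    `|'D_(delta_mx 0 i) f b - 'D_(delta_mx 0 i) f a| <= M * `|b - a|.
  by move=> i; have [M M0 h] := cbox_lipschitz oO KO (CkS i hf); exists M.
exists (\sum_i M i); first by apply: sumr_ge0 => i _; case: (hM i).
move=> a b ha hb; have [p [hp pa] ->] := segment_mvt oO KO (CkW hf) ha hb.
rewrite (derive_partial _ oO (CkW hf) (KO _ ha)) -sumrB mulr_suml.
rewrite (le_trans (ler_norm_sum _ _ _)) //; apply: ler_sum => i _.
rewrite -mulrBr normrM expr2 mulrCA ler_pM //; first exact: rVnorm_coord.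
by rewrite (le_trans ((hM i).2 _ _ ha hp)) // ler_wpM2l //; case: (hM i).
Qed.

Lemma cbox_lipschitz_rV n m (O : set 'rV[R]_n) c r (f : 'rV[R]_n -> 'rV[R]_m) :
  open O -> cbox c r `<=` O -> Ck_on 1 O f ->
  exists2 L : R, 0 <= L & forall a b, cbox c r a -> cbox c r b -> `|f b - f a| <= L * `|b - a|.
Proof.
move=> oO KO hf.
have /choice[M hM] : forall j, exists M, 0 <= M /\ forall a b, cbox c r a -> cbox c r b ->
    `|f b 0 j - f a 0 j| <= M * `|b - a|.
  by move=> j; have [M M0 h] := cbox_lipschitz oO KO ((Ck_coord _ _ oO).1 hf j); exists M.
have S0 : 0 <= \sum_j M j by apply: sumr_ge0 => i _; case: (hM i).
exists (\sum_j M j) => // a b ha hb; apply: rVnorm_le => [|j]; first by rewrite mulr_ge0.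
rewrite !mxE (le_trans ((hM j).2 _ _ ha hb)) // ler_wpM2r // (bigD1 j) //= lerDl.
by apply: sumr_ge0 => i _; case: (hM i).
Qed.

Lemma cbox_taylor_rV n m (O : set 'rV[R]_n) c r (f : 'rV[R]_n -> 'rV[R]_m) :
  open O -> cbox c r `<=` O -> Ck_on 2 O f ->
  exists2 L : R, 0 <= L & forall a b, cbox c r a -> cbox c r b ->
    `|f b - f a - 'D_(b - a) f a| <= L * `|b - a| ^+ 2.
Proof.
move=> oO KO hf.
have /choice[M hM] : forall j, exists M, 0 <= M /\ forall a b, cbox c r a -> cbox c r b ->
    `|f b 0 j - f a 0 j - 'D_(b - a) (fun x => f x 0 j : R^o) a| <= M * `|b - a| ^+ 2.
  by move=> j; have [M M0 h] := cbox_taylor oO KO ((Ck_coord _ _ oO).1 hf j); exists M.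
have S0 : 0 <= \sum_j M j by apply: sumr_ge0 => i _; case: (hM i).
exists (\sum_j M j) => // a b ha hb; apply: rVnorm_le => [|j]; first by rewrite mulr_ge0 // exprn_ge0.
have D : derivable f a (b - a).
  by apply: diff_derivable; exact: C1_differentiable oO (CkW hf) (KO _ ha).
rewrite derive_mx // !mxE (le_trans ((hM j).2 _ _ ha hb)) // ler_wpM2r ?exprn_ge0 // (bigD1 j) //= lerDl.
by apply: sumr_ge0 => i _; case: (hM i).
Qed.

Lemma derive_partial_rV n m (A : set 'rV[R]_n) (f : 'rV[R]_n -> 'rV[R]_m) x v :
  open A -> Ck_on 1 A f -> A x ->
  'D_v f x = \sum_i v 0 i *: 'D_(delta_mx 0 i) f x.
Proof.
move=> oA hf Ax; have D := C1_differentiable oA hf Ax.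
rewrite deriveE // {1}(row_sum_coord v) linear_sum /=; apply: eq_bigr => i _.
by rewrite linearZ /= deriveE.
Qed.

Lemma cbox_derive_bound n m (O : set 'rV[R]_n) c r (f : 'rV[R]_n -> 'rV[R]_m) :
  open O -> cbox c r `<=` O -> Ck_on 1 O f ->
  exists2 L : R, 0 <= L & forall a v, cbox c r a -> `|'D_v f a| <= L * `|v|.
Proof.
move=> oO KO hf.
have /choice[M hM] : forall ij : 'I_n * 'I_m, exists M, 0 <= M /\ forall x, cbox c r x -> `|('D_(delta_mx 0 ij.1) f x) 0 ij.2| <= M.
  move=> [i j] /=; have [|M M0 hM] := @cbox_bounded n c r (fun x => ('D_(delta_mx 0 i) f x) 0 j).
    move=> x /KO Ox; have /continuous_rV C := Ck_cont (CkS i hf) Ox; exact: C.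
  by exists M.
have S0 : 0 <= \sum_i \sum_j M (i, j).
  by apply: sumr_ge0 => i _; apply: sumr_ge0 => j _; case: (hM (i, j)).
exists (\sum_i \sum_j M (i, j)) => // a v ha.
apply: rVnorm_le => [|j]; first by rewrite mulr_ge0.
rewrite (derive_partial_rV _ oO hf (KO _ ha)) summxE (le_trans (ler_norm_sum _ _ _)) //.
apply: (@le_trans _ _ (\sum_i M (i, j) * `|v|)).
  apply: ler_sum => i _; rewrite mxE normrM mulrC ler_pM //; first exact: (hM (i, j)).2.
  exact: rVnorm_coord.
rewrite -mulr_suml ler_wpM2r //; apply: ler_sum => i _.
by rewrite (bigD1 j) //= lerDl; apply: sumr_ge0 => k _; case: (hM (i, k)).
Qed.

End BoxEstimates.

(** * Smooth dependence of flows on time and initial point *)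

Section FlowSmoothness.
Context {R : realType}.

Lemma Ck_linear n m k (A : set 'rV[R]_n) (f : 'rV[R]_n -> 'rV[R]_m) :
  open A -> linear f -> Ck_on k A f.
Proof.
move=> oA lf; pose fM := GRing.isLinear.Build _ _ _ _ _ lf.
pose fL : {linear 'rV[R]_n -> 'rV[R]_m} := HB.pack f fM.
apply/Ck_coord => // j.
apply: (@Ck_ext _ _ _ _ _ (fun x => \sum_i x 0 i * (f (delta_mx 0 i)) 0 j)) => //.
  move=> x _; rewrite -[f x]/(fL x) {2}(row_sum_coord x) linear_sum summxE; apply: eq_bigr => i _.
  by rewrite linearZ mxE.
apply: Ck_sum => // i _; apply: Ck_M => //; [exact: Ck_proj|exact: Ck_cst].
Qed.

Lemma Ck_row_mx n m1 m2 k (A : set 'rV[R]_n) (f : 'rV[R]_n -> 'rV[R]_m1) (g : 'rV[R]_n -> 'rV[R]_m2) :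
  open A -> Ck_on k A f -> Ck_on k A g -> Ck_on k A (fun x => row_mx (f x) (g x)).
Proof.
move=> oA hf hg; apply/Ck_coord => // j; case: (split_ordP j) => i ->.
  by apply: Ck_ext ((Ck_coord _ _ oA).1 hf i) => // x _; rewrite row_mxEl.
by apply: Ck_ext ((Ck_coord _ _ oA).1 hg i) => // x _; rewrite row_mxEr.
Qed.

Lemma Ck_scale n m k (A : set 'rV[R]_n) (f : 'rV[R]_n -> R^o) (g : 'rV[R]_n -> 'rV[R]_m) :
  open A -> Ck_on k A f -> Ck_on k A g -> Ck_on k A (fun x => f x *: g x).
Proof.
move=> oA hf hg; apply/Ck_coord => // j.
by apply: Ck_ext (Ck_M oA hf ((Ck_coord _ _ oA).1 hg j)) => // x _; rewrite mxE.
Qed.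

Lemma Ck_lsubmx n1 n2 k (A : set 'rV[R]_(n1 + n2)) : open A ->
  Ck_on k A (lsubmx : 'rV[R]_(n1 + n2) -> 'rV[R]_n1).
Proof. by move=> oA; apply: Ck_linear => // a u v; rewrite linearP. Qed.

Lemma Ck_rsubmx n1 n2 k (A : set 'rV[R]_(n1 + n2)) : open A ->
  Ck_on k A (rsubmx : 'rV[R]_(n1 + n2) -> 'rV[R]_n2).
Proof. by move=> oA; apply: Ck_linear => // a u v; rewrite linearP. Qed.

(** A directional derivative sees only the restriction to a line. This converts partial derivatives
    in the joint variable (time, position) into derivatives along a trajectory or along initial
    points. *)
Lemma is_derive_reparam (V V' W : normedModType R) (f : V -> W) (g : V' -> W) a v a' v' d :
  (forall h : R, f (h *: v + a) = g (h *: v' + a')) -> is_derive a' v' g d -> is_derive a v f d.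
Proof.
move=> E.
have Q : (fun h : R => h^-1 *: ((f \o shift a) (h *: v) - f a)) = (fun h : R => h^-1 *: ((g \o shift a') (h *: v') - g a')).
  apply: funext => h /=; rewrite E; congr (_ *: (_ - _)).
  by have := E 0; rewrite !scale0r !add0r.
by move=> [D <-]; split; rewrite /derivable /derive Q.
Qed.

Lemma is_derive_quadratic (V W : normedModType R) (f : V -> W) x v w (D d : R) : 0 < d -> 0 <= D ->
  (forall h : R, `|h| < d -> `|f (x + h *: v) - f x - h *: w| <= D * h ^+ 2) -> is_derive x v f w.
Proof.
move=> d0 D0 H.
have C : (fun h : R => h^-1 *: ((f \o shift x) (h *: v) - f x)) @ 0^' --> w.
  apply/cvgrPdist_lt => e e0.
  have D1 : 0 < D + 1 by rewrite ltr_wpDl.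
  near=> h.
  have h0 : h != 0 by near: h; exact: nbhs_dnbhs_neq.
  have hd : `|h| < d by near: h; exact: dnbhs0_lt.
  have he : `|h| < e / (D + 1) by near: h; apply: dnbhs0_lt; rewrite divr_gt0.
  rewrite distrC /= -[w](scalerK h0) -scalerBr normrZ normfV [h *: v + x]addrC.
  rewrite ltr_pdivrMl ?normr_gt0 // (le_lt_trans (H h hd)) // -[h ^+ 2]real_normK ?num_real // expr2 mulrCA.
  rewrite ltr_pM2l ?normr_gt0 //.
  rewrite ltr_pdivlMr // in he; apply: le_lt_trans he.
  by rewrite mulrC ler_wpM2l // lerDl.
by split; [apply/cvg_ex; exists w|exact: cvg_lim C].
Unshelve. all: by end_near. Qed.

Lemma continuous_sum_fun (T : topologicalType) (V : normedModType R) m (f : 'I_m -> T -> V) (x : T) :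
  (forall i, {for x, continuous (f i)}) -> {for x, continuous (fun y => \sum_i f i y)}.
Proof.
elim: m f => [|m IH] f h.
  rewrite (_ : (fun _ => _) = (fun=> 0)); first exact: cst_continuous.
  by apply: funext => y; rewrite big_ord0.
rewrite (_ : (fun _ => _) = (fun y => \sum_i f (widen_ord (leqnSn m) i) y + f ord_max y)).
  exact: (continuousD (IH _ (fun i => h _)) (h ord_max)).
by apply: funext => y; rewrite big_ord_recr.
Qed.

(** All trajectories starting in [B] live for the same time [T] and stay in [K], which will be a box
    on which the field has uniform Lipschitz and Taylor constants. *)
Definition is_flow n (X : 'rV[R]_n -> 'rV[R]_n) (T : R) (B K : set 'rV[R]_n)
    (phi : R -> 'rV[R]_n -> 'rV[R]_n) :=
  forall x, B x -> phi 0 x = x /\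
    forall t, `|t| < T -> K (phi t x) /\ is_derive t (1 : R) (fun s => phi s x) (X (phi t x)).

(** Time is stored as the first coordinate of a row vector, so that joint smoothness in time and
    position is an instance of [Ck_on]. *)
Definition time_space n (T : R) (B : set 'rV[R]_n) : set 'rV[R]_(1 + n) :=
  [set z | `|lsubmx z 0 0| < T /\ B (rsubmx z)].

Definition uncurry_flow n m (phi : R -> 'rV[R]_n -> 'rV[R]_m) (z : 'rV[R]_(1 + n)) :=
  phi (lsubmx z 0 0) (rsubmx z).

Lemma continuous_time n : continuous (fun z : 'rV[R]_(1 + n) => lsubmx z 0 0 : R).
Proof.
move=> z; have C := @continuous_lsubmx R 1 1 n z.
by have /continuous_rV := C; exact.
Qed.

Lemma open_norm_lt (V : normedModType R) (r : R) : open [set x : V | `|x| < r].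
Proof.
by apply: (open_comp (f := fun s : V => `|s|) (D := [set x | x < r])); [move=> *; exact: norm_continuous|exact: open_lt].
Qed.

Lemma open_time_space n T (B : set 'rV[R]_n) : open B -> open (time_space T B).
Proof.
move=> oB; apply: openI.
  apply: (open_comp (f := fun z : 'rV[R]_(1 + n) => lsubmx z 0 0 : R) (D := [set t : R | `|t| < T])).
    by move=> z _; exact: continuous_time.
  exact: (@open_norm_lt R).
apply: (open_comp (f := rsubmx) (D := B)) => // z _; exact: continuous_rsubmx.
Qed.

Lemma is_derive_continuous_rV n (g : R -> 'rV[R]_n) t d : is_derive t (1 : R) g d -> {for t, continuous g}.
Proof.
by move=> D; apply/continuous_rV => i; move/is_derive_rV/(_ i)/is_derive_continuous : D.
Qed.

Section Flow.
Context {n : nat} (X : 'rV[R]_n -> 'rV[R]_n) (O B : set 'rV[R]_n) (c r : 'rV[R]_n) (T : R)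
  (phi : R -> 'rV[R]_n -> 'rV[R]_n).
Hypotheses (oO : open O) (KO : cbox c r `<=` O) (hX : Ck_on 2 O X) (oB : open B)
  (hphi : is_flow X T B (cbox c r) phi).

Lemma flow_lipschitz : exists2 E : R, 0 <= E &
  forall t x y, `|t| < T -> B x -> B y -> `|phi t y - phi t x| <= E * `|y - x|.
Proof.
have [L L0 hL] := cbox_lipschitz_rV oO KO (CkW hX).
exists (2 * expR (2 * L * T)); first by rewrite mulr_ge0 // expR_ge0.
move=> t x y tT Bx By; have [x0 hx] := hphi Bx; have [y0 hy] := hphi By.
have := @gronwall R n (fun s => phi s y - phi s x) (fun s => X (phi s y) - X (phi s x)) T L 0 t L0 (lexx _) tT.
rewrite x0 y0 mul0r addr0 mulrAC; apply => s sT.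
have [Kx dx] := hx s sT; have [Ky dy] := hy s sT.
by split; [exact: is_deriveB|rewrite addr0 hL].
Qed.

(** The Lipschitz bound in the initial point is uniform in time, so it only has to be combined with
    the continuity in time of the single trajectory through [x0]. *)
Lemma flow_continuous : Ck_on 0 (time_space T B) (uncurry_flow phi).
Proof.
split => // z0 [/= t0T Bx0]; have [E E0 hE] := flow_lipschitz.
set t0 := lsubmx z0 0 0 in t0T; set x0 := rsubmx z0 in Bx0.
apply/continuous_normP => e e0.
have [_ /(_ _ t0T)[_ dt]] := hphi Bx0.
have [d1 d10 hd1] := (continuous_normP _ _).1 (is_derive_continuous_rV dt) (e / 2) (divr_gt0 e0 (ltr0n R 2)).
have [d2 d20 hd2] := (open_normP _).1 (open_time_space (T := T) oB) z0 (conj t0T Bx0).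
have E1 : 0 < 2 * (E + 1) by rewrite mulr_gt0 // ltr_wpDl.
exists (Num.min d1 (Num.min d2 (e / (2 * (E + 1))))).
  by rewrite !lt_min d10 d20 divr_gt0.
move=> z; rewrite !lt_min => /and3P[h1 /hd2[tT Bx] h3].
have nt : `|lsubmx z 0 0 - t0| <= `|z - z0|.
  by have := rVnorm_coord (z - z0) (lshift n 0); rewrite /t0 !mxE.
have nx : `|rsubmx z - x0| <= `|z - z0|.
  by apply: rVnorm_le => // i; have := rVnorm_coord (z - z0) (rshift 1 i); rewrite /x0 !mxE.
have K1 := hE _ _ _ tT Bx0 Bx.
have K2 := hd1 _ (le_lt_trans nt h1).
rewrite /uncurry_flow -/t0 -/x0 -(subrKA (phi (lsubmx z 0 0) x0)) (le_lt_trans (ler_normD _ _)) //.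
rewrite ltr_pdivlMr // in h3.
have := ler_wpM2l E0 nx; have := normr_ge0 (z - z0); lra.
Qed.

(** Gronwall is applied to [phi s (x + h *: v) - phi s x - h *: w s]: it vanishes at time 0 and
    satisfies the linearised equation up to a Taylor remainder of order [h ^+ 2], hence is itself of
    order [h ^+ 2]. *)
Lemma flow_variation (T1 : R) x v (w : R -> 'rV[R]_n) : T1 <= T -> B x -> w 0 = v ->
  (forall t, `|t| < T1 -> is_derive t (1 : R) w ('D_(w t) X (phi t x))) ->
  forall t, `|t| < T1 -> is_derive x v (fun y => phi t y) (w t).
Proof.
move=> T1T Bx w0 hw t tT1; have tT := lt_le_trans tT1 T1T.
have T10 : 0 < T1 by exact: le_lt_trans tT1.
have [E E0 hE] := flow_lipschitz.
have [L L0 hL] := cbox_derive_bound oO KO (CkW hX).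
have [C C0 hC] := cbox_taylor_rV oO KO hX.
have [d1 d10 hd1] := (open_normP _).1 oB x Bx.
have v1 : 0 < `|v| + 1 by rewrite ltr_wpDl.
(* The two trajectories stay within [E * |h| * |v|] of each other, so [e0 * h ^+ 2] bounds the
   Taylor remainder of [X] between them. *)
pose e0 := C * (E * `|v|) ^+ 2.
have e00 : 0 <= e0 by rewrite mulr_ge0 // exprn_ge0 // mulr_ge0.
apply: (@is_derive_quadratic _ _ _ _ _ _ (2 * (e0 * T1) * expR (2 * L * T1)) (d1 / (`|v| + 1))).
- by rewrite divr_gt0.
- by rewrite mulr_ge0 // ?expR_ge0 // mulr_ge0 // mulr_ge0 // ltW.
move=> h; rewrite ltr_pdivlMr // => hh.
have Bxh : B (x + h *: v).
  by apply: hd1; rewrite addrC addKr normrZ; have := normr_ge0 h; lra.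
have [x0 hx] := hphi Bx; have [y0 hy] := hphi Bxh.
have := @gronwall R n (fun s => phi s (x + h *: v) - phi s x - h *: w s)
  (fun s => X (phi s (x + h *: v)) - X (phi s x) - h *: 'D_(w s) X (phi s x)) T1 L (e0 * h ^+ 2) t L0.
rewrite x0 y0 w0 [x + _ - x]addrC addKr subrr normr0 add0r => H.
apply: (le_trans (H _ tT1 _)).
- by rewrite mulr_ge0 // sqr_ge0.
- move=> s sT1; have sT := lt_le_trans sT1 T1T.
  have [Kx dx] := hx s sT; have [Ky dy] := hy s sT; split.
    have D1 := is_deriveB dy dx; have D2 := @is_deriveZ R _ _ w h s _ _ (hw s sT1).
    exact: is_deriveB D1 D2.
  have DX : differentiable X (phi s x) by exact: C1_differentiable oO (CkW hX) (KO Kx).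
  have -> : X (phi s (x + h *: v)) - X (phi s x) - h *: 'D_(w s) X (phi s x) =
     (X (phi s (x + h *: v)) - X (phi s x) - 'D_(phi s (x + h *: v) - phi s x) X (phi s x))
     + 'D_(phi s (x + h *: v) - phi s x - h *: w s) X (phi s x).
    rewrite !(deriveE _ DX) [in X in _ = _ + X]linearB [in X in _ = _ + X]linearZ /=.
    by rewrite addrA subrK.
  rewrite addrC (le_trans (ler_normD _ _)) // lerD //; first exact: hL.
  rewrite (le_trans (hC _ _ Kx Ky)) // /e0 -mulrA ler_wpM2l //.
  have := hE s x (x + h *: v) sT Bx Bxh.
  rewrite [x + _ - x]addrC addKr normrZ => hEs.
  have -> : (E * `|v|) ^+ 2 * h ^+ 2 = (E * (`|h| * `|v|)) ^+ 2 by rewrite -[h ^+ 2]real_normK ?num_real //; ring.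
  by rewrite ler_pXn2r ?nnegrE // mulr_ge0 // mulr_ge0.
by rewrite le_eqVlt; apply/orP; left; apply/eqP; ring.
Qed.

(** The coefficients of the variational equation are defined along trajectories, for [|t| < T] only.
    Freezing them beyond [T1 < T] makes the equation global, at the price of a shorter time; [M] is
    uniform in [x] and [v] by Gronwall. *)
Lemma flow_linearization (T1 : R) : 0 < T1 < T ->
  exists (w : 'rV[R]_n -> 'rV[R]_n -> R -> 'rV[R]_n) (M : R), 0 <= M /\ forall x v, B x ->
    w x v 0 = v /\ forall t, `|t| < T1 ->
      is_derive t (1 : R) (w x v) ('D_(w x v t) X (phi t x)) /\ `|w x v t| <= M * `|v|.
Proof.
move=> /andP[T10 T1T].
have [L L0 hL] := cbox_derive_bound oO KO (CkW hX).
have clT s : `|clamp T1 s| < T by rewrite (le_lt_trans _ T1T) // clamp_le // ltW.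
have ex (x v : 'rV[R]_n) : exists w : R -> 'rV[R]_n, B x ->
   w 0 = v /\ forall t, `|t| < T1 -> is_derive t (1 : R) w ('D_(w t) X (phi t x)).
  have [Bx|nB] := pselect (B x); last by exists (fun=> 0).
  have [x0 hx] := hphi Bx.
  have Kc s : cbox c r (phi (clamp T1 s) x) by case: (hx _ (clT s)).
  have DX s : differentiable X (phi (clamp T1 s) x) by exact: C1_differentiable oO (CkW hX) (KO (Kc s)).
  have [|s a b|w [w0 hw]] := @global_ode R n (fun s y => 'D_y X (phi (clamp T1 s) x)) L T1 v L0 T10.
  - move=> y cy s.
    have -> : (fun t => 'D_(y t) X (phi (clamp T1 t) x)) =
       (fun t => \sum_i y t 0 i *: 'D_(delta_mx 0 i) X (phi (clamp T1 t) x)).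
      by apply: funext => t; rewrite (derive_partial_rV _ oO (CkW hX) (KO (Kc t))).
    apply: continuous_sum_fun => i.
    have cyi : {for s, continuous (fun t => y t 0 i : R)} by have /continuous_rV := cy s; exact.
    have [_ dxs] := hx _ (clT s).
    have c1 : {for s, continuous (fun t => phi (clamp T1 t) x)} :=
      continuous_comp (@clamp_continuous R T1 s) (is_derive_continuous_rV dxs).
    have c2 := Ck_cont (CkS i hX) (KO (Kc s)).
    exact: (cvgZ cyi (continuous_comp c1 c2)).
  - rewrite !(deriveE _ (DX s)) -linearB /= -(deriveE _ (DX s)); exact: hL.
  exists w => _; split => // t tT; have := hw t tT.
  by rewrite clamp_id // ltW.
have /choice[w hw] : forall p : 'rV[R]_n * 'rV[R]_n, exists w : R -> 'rV[R]_n, B p.1 ->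
   w 0 = p.2 /\ forall t, `|t| < T1 -> is_derive t (1 : R) w ('D_(w t) X (phi t p.1)).
  by move=> [x v]; exact: ex.
exists (fun x v => w (x, v)), (2 * expR (2 * L * T1)); split; first by rewrite mulr_ge0 // expR_ge0.
move=> x v Bx; have [w0 dw] := hw (x, v) Bx; split => // t tT1; split; first exact: dw.
have := @gronwall R n (w (x, v)) (fun s => 'D_(w (x, v) s) X (phi s x)) T1 L 0 t L0 (lexx _) tT1.
rewrite w0 /= mul0r addr0 mulrAC; apply => s sT1; split; first exact: dw.
rewrite addr0; apply: hL; have [_ hx] := hphi Bx; by case: (hx s (lt_trans sT1 T1T)).
Qed.

End Flow.

(* The flow of this field on the tangent bundle is the derivative of the flow of
   [X], so each application of the C^k regularity of flows to it gains one order
   of differentiability for the flow of [X]. *)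
Lemma Ck_tangent n k (X : 'rV[R]_n -> 'rV[R]_n) (O : set 'rV[R]_n) : open O ->
  (forall k, Ck_on k O X) ->
  Ck_on k [set p : 'rV[R]_(n + n) | O (lsubmx p)]
    (fun p => row_mx (X (lsubmx p)) ('D_(rsubmx p) X (lsubmx p))).
Proof.
move=> oO hX; set O' := [set p | _].
have oO' : open O' by apply: (open_comp (f := lsubmx) (D := O)) => // z _; exact: continuous_lsubmx.
apply: Ck_row_mx => //; first exact: (Ck_comp_rV oO' oO _ (Ck_lsubmx _ oO') (hX k)).
apply: (@Ck_ext _ _ _ _ _ (fun p : 'rV[R]_(n + n) => \sum_i rsubmx p 0 i *: 'D_(delta_mx 0 i) X (lsubmx p))) => //.
  by move=> p Op; rewrite -(derive_partial_rV _ oO (hX 1%N)).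
apply: Ck_sum => // i _; apply: Ck_scale => //.
  by apply: (Ck_coord _ _ oO').1; exact: Ck_rsubmx.
apply: (@Ck_comp_rV _ _ _ _ _ _ O lsubmx (fun y => 'D_(delta_mx 0 i) X y)) => //.
  exact: Ck_lsubmx.
exact: CkS (hX k.+1).
Qed.

(** The induction quantifies over all dimensions and fields, since order [k.+1] for [X] rests on
    order [k] for its lift to tangent vectors, in dimension [n + n]. *)
Lemma flow_smooth k : forall n (X : 'rV[R]_n -> 'rV[R]_n) (O B : set 'rV[R]_n) c r T phi,
  open O -> cbox c r `<=` O -> (forall k, Ck_on k O X) -> open B ->
  is_flow X T B (cbox c r) phi -> Ck_on k (time_space T B) (uncurry_flow phi).
Proof.
elim: k => [|k IH] n X O B c r T phi oO KO hX oB hphi.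
  exact: flow_continuous oO KO (hX 2%N) oB hphi.
have oTB : open (time_space T B) := open_time_space oB.
have F z : time_space T B z -> O (uncurry_flow phi z).
  by move=> [tT Bx]; apply: KO; have [_ /(_ _ tT)[]] := hphi _ Bx.
split; first exact: Ck_cont (flow_continuous oO KO (hX 2%N) oB hphi).
move=> i; case: (split_ordP i) => {i} i ->; last first.
  have key z0 : time_space T B z0 -> exists T1 (B1 : set 'rV[R]_(n + n)) (phi1 : R -> 'rV[R]_(n + n) -> 'rV[R]_(n + n)),
     [/\ `|lsubmx z0 0 0| < T1,
         T1 <= T,
         forall z, time_space T1 B z -> is_derive z (delta_mx 0 (rshift 1 i)) (uncurry_flow phi)
           (rsubmx (uncurry_flow phi1 (row_mx (lsubmx z) (row_mx (rsubmx z) (delta_mx 0 i))))),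
         open B1 /\ (forall x, B x -> B1 (row_mx x (delta_mx 0 i))) &
         Ck_on k (time_space T1 B1) (uncurry_flow phi1)].
    (* [T1] is halfway between the time of [z0] and [T]: the linearisation shortens the time
       interval, which must still contain that time. *)
    move=> [t0T _]; pose T1 := (`|lsubmx z0 0 0| + T) / 2.
    have T0 : 0 < T by exact: le_lt_trans t0T.
    have T1b : 0 < T1 < T.
      by rewrite /T1; have := normr_ge0 (lsubmx z0 0 0) => ?; apply/andP; split; lra.
    have [w [M [M0 hw]]] := flow_linearization oO KO (hX 2%N) hphi T1b.
    pose phi1 (t : R) (p : 'rV[R]_(n + n)) := row_mx (phi t (lsubmx p)) (w (lsubmx p) (rsubmx p) t).
    (* The radius 2 makes the basis vectors [delta_mx 0 i], of norm 1, admissible initial tangent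
       vectors of an open set. *)
    pose B1 : set 'rV[R]_(n + n) := [set p | B (lsubmx p)] `&` [set p | `|rsubmx p| < 2].
    have oB1 : open B1.
      apply: openI; first by apply: (open_comp (f := lsubmx) (D := B)) => // z _; exact: continuous_lsubmx.
      apply: (open_comp (f := rsubmx) (D := [set x : 'rV[R]_n | `|x| < 2])); last exact: open_norm_lt.
      by move=> z _; exact: continuous_rsubmx.
    exists T1, B1, phi1; split.
    - by rewrite /T1; lra.
    - by case/andP: T1b => _ /ltW.
    - move=> z [tT1 Bx]; rewrite /uncurry_flow /phi1 !(row_mxKl, row_mxKr).
      have [w0 dw] := hw (rsubmx z) (delta_mx 0 i) Bx.
      have T1T : T1 <= T by case/andP: T1b => _ /ltW.
      have := flow_variation oO KO (hX 2%N) oB hphi T1T Bx w0 (fun t ht => (dw t ht).1) tT1.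
      apply: is_derive_reparam => h.
      congr (phi _ _); first by rewrite !mxE /= mulr0 add0r.
      by apply/rowP => j; rewrite !mxE /= eq_rshift.
    - split => // x Bx; split; first by rewrite /= row_mxKl.
      by rewrite /= row_mxKr delta_norm ltr1n.
    (* The half-width [M * 2] of the tangent part comes from the bound [M * |v|] with [|v| < 2]. *)
    - apply: (IH _ _ [set p | O (lsubmx p)] B1 (row_mx c 0) (row_mx r (const_mx (M * 2)))) => //.
      + by apply: (open_comp (f := lsubmx) (D := O)) => // z _; exact: continuous_lsubmx.
      + move=> p hp; apply: KO => j; have := hp (lshift n j); by rewrite !row_mxEl !mxE.
      + by move=> k'; exact: Ck_tangent.
      move=> p [Bp np]; have [x0 hx] := hphi _ Bp; have [w0 dw] := hw (lsubmx p) (rsubmx p) Bp.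
      split; first by rewrite /phi1 x0 w0 hsubmxK.
      move=> t tT1; have tT : `|t| < T by case/andP: T1b => _; exact: lt_trans.
      have [Kx dx] := hx t tT; have [dwt bw] := dw t tT1; split.
        move=> j; rewrite /phi1; case: (split_ordP j) => l ->.
          by rewrite !row_mxEl; exact: Kx.
        rewrite !row_mxEr !mxE subr0 (le_trans (rVnorm_coord _ _)) // (le_trans bw) //.
        by rewrite ler_wpM2l // ltW.
      apply/is_derive_rV => j; rewrite /phi1 row_mxKl row_mxKr; case: (split_ordP j) => l ->.
        rewrite row_mxEl (_ : (fun _ => _) = (fun s => phi s (lsubmx p) 0 l)); last by apply: funext => s; rewrite row_mxEl.
        by move/is_derive_rV : dx; exact.
      rewrite row_mxEr (_ : (fun _ => _) = (fun s => w (lsubmx p) (rsubmx p) s 0 l)); last by apply: funext => s; rewrite row_mxEr.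
      by move/is_derive_rV : dwt; exact.
  split.
    move=> z hz; have [T1 [B1 [phi1 [tT1 _ D _ _]]]] := key z hz.
    by have [] := D z (conj tT1 hz.2).
  apply: Ck_local => z hz; have [T1 [B1 [phi1 [tT1 T1T D [oB1 BB1] C]]]] := key z hz.
  exists (time_space T1 B); first by split => //; case: hz.
  have oT1 : open (time_space T1 B) := open_time_space oB.
  apply: (@Ck_ext _ _ _ _ _ (fun z : 'rV[R]_(1 + n) => rsubmx (uncurry_flow phi1 (row_mx (lsubmx z) (row_mx (rsubmx z) (delta_mx 0 i)))))) => //.
    by move=> y /D [].
  have oT : open (@setT 'rV[R]_(n + n)) by exact: openT.
  apply: (@Ck_comp_rV _ _ _ _ _ _ setT _ (fun y : 'rV[R]_(n + n) => rsubmx y)) => //; last exact: Ck_rsubmx.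
  apply: (Ck_comp_rV oT1 (open_time_space (T := T1) oB1)) C.
    by move=> y [ty By]; split; rewrite /= ?row_mxKl // row_mxKr; exact: BB1.
  apply: Ck_row_mx => //; first exact: Ck_lsubmx.
  by apply: Ck_row_mx => //; [exact: Ck_rsubmx|exact: Ck_cst].
(* The derivative in time is [X] composed with the flow, so order [k] for the flow itself is enough
   in this direction. *)
have D z : time_space T B z ->
    is_derive z (delta_mx 0 (lshift n i)) (uncurry_flow phi) (X (uncurry_flow phi z)).
  move=> [tT Bx]; have [_ /(_ _ tT)[_]] := hphi _ Bx.
  apply: is_derive_reparam => h; congr (phi _ _).
    by rewrite !mxE /= (ord1 i) eqxx mulr1 /GRing.scale /= mulr1.
  by apply/rowP => j; rewrite !mxE /= eq_rlshift mulr0 add0r.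
split; first by move=> z /D[].
apply: (@Ck_ext _ _ _ _ _ (fun z => X (uncurry_flow phi z))) => //; first by move=> z /D[].
exact: Ck_comp_rV oTB oO F (IH _ _ _ _ _ _ _ _ oO KO hX oB hphi) (hX k).
Qed.

End FlowSmoothness.

(** * Local flows and flow boxes *)

Section FlowBox.
Context {R : realType}.

(** Composing the field with the retraction onto a box makes it globally Lipschitz. For a short time
    its solutions do not leave the box, where the retraction is the identity. *)
Lemma local_flow n (X : 'rV[R]_n -> 'rV[R]_n) (O : set 'rV[R]_n) x0 :
  open O -> O x0 -> Ck_on 1 O X ->
  exists (T d : R) (c r : 'rV[R]_n) phi,
    [/\ 0 < T, 0 < d, cbox c r `<=` O & is_flow X T [set x | `|x - x0| < d] (cbox c r) phi].
Proof.
move=> oO Ox0 hX; have [rho rho0 hrho] := (open_normP _).1 oO x0 Ox0.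
pose q := rho / 2; have q0 : 0 < q by rewrite divr_gt0.
pose r : 'rV[R]_n := const_mx q.
have KE y : cbox x0 r y <-> `|y - x0| <= q.
  split=> [h|h i].
    by apply: rVnorm_le => [|i]; [exact: ltW|rewrite !mxE; have := h i; rewrite mxE].
  by rewrite mxE (le_trans _ h) //; have := rVnorm_coord (y - x0) i; rewrite !mxE.
have KO : cbox x0 r `<=` O.
  by move=> y /KE h; apply: hrho; rewrite (le_lt_trans h) // /q; lra.
have [L L0 hL] := cbox_lipschitz_rV oO KO hX.
pose ck (y : 'rV[R]_n) : 'rV[R]_n := \row_i (x0 0 i + clamp q (y 0 i - x0 0 i)).
have ckK y : cbox x0 r (ck y).
  by move=> i; rewrite !mxE addrC addKr clamp_le // ltW.
have ckid y : cbox x0 r y -> ck y = y.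
  move=> hy; apply/rowP => i; rewrite mxE clamp_id; first by rewrite subrKC.
  by have := hy i; rewrite mxE.
have cklip a b : `|ck a - ck b| <= `|a - b|.
  apply: rVnorm_le => // i; rewrite !mxE opprD addrACA subrr add0r.
  rewrite (le_trans (clamp_lip _ _ _)) // opprB addrA subrK.
  by have := rVnorm_coord (a - b) i; rewrite !mxE.
have lipX a b : `|X (ck a) - X (ck b)| <= L * `|a - b|.
  by rewrite (le_trans (hL _ _ (ckK b) (ckK a))) // ler_wpM2l.
pose M := `|X x0| + L * q.
have M0 : 0 <= M by rewrite addr_ge0 // mulr_ge0 // ltW.
have Kx0 : cbox x0 r x0 by apply/KE; rewrite subrr normr0 ltW.
have hM y : `|X (ck y)| <= M.
  have H := hL _ _ Kx0 (ckK y).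
  have := (KE _).1 (ckK y) => /(ler_wpM2l L0) H2.
  rewrite -(subrK (X x0) (X (ck y))) (le_trans (ler_normD _ _)) // addrC lerD2l.
  exact: le_trans H H2.
(* A solution starts within [d] of [x0] and moves by at most [M * T <= d], so it stays within
   [2 * d = q], the radius of the box. *)
pose d := rho / 4; have d0 : 0 < d by rewrite divr_gt0.
pose T := d / (M + 1).
have M1 : 0 < M + 1 by rewrite ltr_wpDl.
have T0 : 0 < T by rewrite divr_gt0.
have cX (y : R -> 'rV[R]_n) : continuous y -> continuous (fun t => X (ck (y t))).
  move=> cy t; apply/continuous_normP => e e0.
  have L1 : 0 < L + 1 by rewrite ltr_wpDl.
  have [dd dd0 hd] := (continuous_normP _ _).1 (cy t) (e / (L + 1)) (divr_gt0 e0 L1).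
  exists dd => // s /hd; rewrite ltr_pdivlMr // => H.
  by rewrite (le_lt_trans (lipX _ _)) //; have := normr_ge0 (y s - y t); lra.
have /choice[phi hphi] : forall x, exists y : R -> 'rV[R]_n, y 0 = x /\
    forall t, `|t| < T -> is_derive t (1 : R) y (X (ck (y t))).
  by move=> x; exact: (@global_ode R n (fun _ y => X (ck y)) L T x L0 T0 cX (fun _ => lipX)).
exists T, d, x0, r, (fun t x => phi x t); split => // x /= xd.
have [p0 dp] := hphi x; split => // t tT.
have K : cbox x0 r (phi x t).
  apply/KE; have := @growth_rV R n (phi x) (fun s => X (ck (phi x s))) t 0 0 M (lexx _) (lexx _) M0.
  rewrite p0 => H.
  have : `|phi x t - x| <= 0 * (expR (0 * `|t|) - 1) + M * `|t|.
    apply: H => s st; split; first by apply: dp; exact: le_lt_trans tT.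
    by rewrite !mul0r add0r.
  rewrite mul0r add0r => B.
  have MT : M * `|t| <= d.
    have : (M + 1) * `|t| <= (M + 1) * T by rewrite ler_wpM2l // ltW.
    rewrite (_ : (M + 1) * T = d); last by rewrite /T mulrC divfK ?gt_eqF.
    by rewrite mulrDl mul1r; have := normr_ge0 t; lra.
  rewrite -(subrKA x) (le_trans (ler_normD _ _)) //.
  by move: B MT xd; rewrite /q /d; lra.
by split => //; have := dp t tT; rewrite ckid.
Qed.

(** The inverse is part of the data: each chart is built together with an explicit smooth
    inverse. *)
Definition local_diffeo n (V W : set 'rV[R]_n) (F G : 'rV[R]_n -> 'rV[R]_n) :=
  [/\ open V, open W, smooth_on V F, smooth_on W G &
      (forall x, V x -> W (F x) /\ G (F x) = x) /\ (forall z, W z -> V (G z) /\ F (G z) = z)].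

Section FlowGroup.
Context {n : nat} (X : 'rV[R]_n -> 'rV[R]_n) (O B : set 'rV[R]_n) (c r : 'rV[R]_n) (T : R)
  (phi : R -> 'rV[R]_n -> 'rV[R]_n).
Hypotheses (oO : open O) (KO : cbox c r `<=` O) (hX : Ck_on 1 O X)
  (hphi : is_flow X T B (cbox c r) phi).

(** Both [phi t (phi s x)] and [phi (t + s) x] solve the equation with the same value at [t = 0], so
    Gronwall identifies them, in particular at [t = - s]. The bound [T / 2] keeps [t + s] in the
    range of the flow. *)
Lemma flow_inverse s x : `|s| < T / 2 -> B x -> B (phi s x) -> phi (- s) (phi s x) = x.
Proof.
move=> sT Bx By; have [x0 hx] := hphi Bx; have [y0 hy] := hphi By.
have T0 : 0 < T by have := normr_ge0 s; lra.
have [L L0 hL] := cbox_lipschitz_rV oO KO hX.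
have sT' : `|- s| < T / 2 by rewrite normrN.
have := @gronwall R n (fun t => phi t (phi s x) - phi (t + s) x)
  (fun t => X (phi t (phi s x)) - X (phi (t + s) x)) (T / 2) L 0 (- s) L0 (lexx _) sT'.
rewrite y0 add0r subrr normr0 mul0r addr0 mulr0 mul0r addNr x0 => H.
apply/subr0_eq/eqP; rewrite -normr_le0; apply: H => t tT.
have t1 : `|t| < T by lra.
have t2 : `|t + s| < T by have := ler_normD t s; lra.
have [K1 D1] := hy t t1; have [K2 D2] := hx _ t2; split; last by rewrite addr0 hL.
apply: is_deriveB => //; apply: is_derive_reparam D2 => h; by rewrite addrA.
Qed.

Lemma flow_coord_affine i (a : R) : (forall x, O x -> X x 0 i = a) ->
  forall t x, `|t| < T -> B x -> phi t x 0 i = x 0 i + a * t.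
Proof.
move=> ha t x tT Bx; have [x0 hx] := hphi Bx.
have := @growth R (fun s => phi s x 0 i - a * s) (fun s => a - a * 1) t 0 0 0.
rewrite x0 (mulr0 a) subr0 => H.
have : `|phi t x 0 i - a * t - x 0 i| <= 0 * (expR (0 * `|t|) - 1) + 0 * `|t|.
  apply: H => s st; have [K D] := hx s (le_lt_trans st tT); split; last by rewrite mulr1 subrr normr0 !mul0r addr0.
  have D1 : is_derive s (1 : R) (fun s => phi s x 0 i) a.
    by move/is_derive_rV/(_ i) : D; rewrite (ha _ (KO K)).
  exact: is_deriveB D1 (@is_deriveZ R R^o R^o id a s 1 1 (is_derive_id s 1)).
by rewrite !mul0r addr0 normr_le0 => /eqP; lra.
Qed.

End FlowGroup.

(* The field [Y] does not involve the coordinates of index [< j], which are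
   therefore kept: [eta w] is the point reached at time [w_j] from the point of
   the hyperplane [z_j = 0] with the other coordinates of [w]. *)
Lemma flow_box n (j : 'I_n) (Y : 'rV[R]_n -> 'rV[R]_n) (O : set 'rV[R]_n) :
  open O -> O 0 -> smooth_on O Y ->
  (forall z, O z -> (forall i : 'I_n, (i < j)%N -> Y z 0 i = 0) /\ Y z 0 j = 1) ->
  (forall z z' : 'rV[R]_n, (forall i : 'I_n, (j <= i)%N -> z 0 i = z' 0 i) -> Y z = Y z') ->
  exists A B theta eta, [/\ local_diffeo A B theta eta, A 0, B 0 /\ eta 0 = 0 &
    forall w, B w -> (forall b : 'I_n, (b < j)%N -> is_derive w (delta_mx 0 b) eta (delta_mx 0 b)) /\
      is_derive w (delta_mx 0 j) eta (Y (eta w))].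
Proof.
move=> oO O0 hY Yc Yinv.
have [T [d [c [r [phi [T0 d0 KO hphi]]]]]] := local_flow oO O0 (hY 1%N).
set B0 := [set x | _] in hphi.
have B0E x : B0 x <-> `|x| < d by rewrite /B0 /= subr0.
have oB0 : open B0.
  rewrite (_ : B0 = [set x | `|x| < d]); first exact: open_norm_lt.
  by apply: funext => x; apply: propext; exact: B0E.
pose S (z : 'rV[R]_n) : 'rV[R]_n := \row_i (if (i < j)%N then z 0 i else 0).
pose S' (z : 'rV[R]_n) : 'rV[R]_n := \row_i (if (i <= j)%N then z 0 i else 0).
pose P (z : 'rV[R]_n) : 'rV[R]_n := \row_i (if (i <= j)%N then 0 else z 0 i).
pose Q (z : 'rV[R]_n) : 'rV[R]_n := \row_i (if (i < j)%N then 0 else z 0 i).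
(* The flow starts from [P w], whose first [j] coordinates are 0 and remain so; adding [S w]
   restores them. *)
pose eta w := S w + phi (w 0 j) (P w).
(* Since [Y] has component 1 at index [j], flowing back for the time [z 0 j] reaches the hyperplane;
   [S'] then records this time as the coordinate of index [j]. *)
pose theta z := S' z + phi (- z 0 j) (Q z).
(* The bound [T / 2] is the one that [flow_inverse] asks for. *)
pose D : set 'rV[R]_n := [set w | `|w| < Num.min d (T / 2)].
have oD : open D by exact: open_norm_lt.
have mask_lin (m : pred 'I_n) : linear (fun z : 'rV[R]_n => \row_i (if m i then z 0 i else 0) : 'rV[R]_n).
  by move=> a u v; apply/rowP => i; rewrite !mxE; case: ifP => _; rewrite ?mulr0 ?addr0.
have maskN_lin (m : pred 'I_n) : linear (fun z : 'rV[R]_n => \row_i (if m i then 0 else z 0 i) : 'rV[R]_n).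
  by move=> a u v; apply/rowP => i; rewrite !mxE; case: ifP => _; rewrite ?mulr0 ?addr0.
have maskN_norm (m : pred 'I_n) (z : 'rV[R]_n) : `|\row_i (if m i then 0 else z 0 i) : 'rV[R]_n| <= `|z|.
  by apply: rVnorm_le => // i; rewrite mxE; case: ifP => _; rewrite ?normr0 ?rVnorm_coord.
have DB (z : 'rV[R]_n) : D z -> `|z 0 j| < T / 2 /\ `|z| < d.
  rewrite /D /= lt_min => /andP[h1 h2]; split => //.
  exact: le_lt_trans (rVnorm_coord _ _) h2.
have half (t : R) : `|t| < T / 2 -> `|t| < T by lra.
have PB z : D z -> B0 (P z) by move=> /DB[_ h]; apply/B0E; exact: le_lt_trans (maskN_norm _ _) h.
have QB z : D z -> B0 (Q z) by move=> /DB[_ h]; apply/B0E; exact: le_lt_trans (maskN_norm _ _) h.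
have PhiC k : Ck_on k (time_space T B0) (uncurry_flow phi) := flow_smooth k oO KO hY oB0 hphi.
have smooth_part k (s : R) (L L' : 'rV[R]_n -> 'rV[R]_n) : linear L -> linear L' ->
   `|s| = 1 -> (forall z, D z -> B0 (L z)) ->
   Ck_on k D (fun z => L' z + phi (s * z 0 j) (L z)).
  move=> lL lL' s1 BL; apply: Ck_D => //; first exact: Ck_linear.
  have oT : open (time_space T B0) := open_time_space oB0.
  have H : Ck_on k D (fun z : 'rV[R]_n => row_mx (const_mx (s * z 0 j) : 'rV[R]_1) (L z)).
    apply: Ck_row_mx => //; last exact: Ck_linear.
    apply: Ck_linear => // a u v; apply/rowP => i; rewrite !mxE mulrDr mulrCA.
    by [].
  have HD z : D z -> time_space T B0 (row_mx (const_mx (s * z 0 j) : 'rV[R]_1) (L z)).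
    move=> Dz; split => /=; last by rewrite row_mxKr; exact: BL.
    by rewrite row_mxKl mxE normrM s1 mul1r; apply: half; case: (DB z Dz).
  apply: Ck_ext (Ck_comp_rV oD oT HD H (PhiC k)) => // z Dz.
  by rewrite /uncurry_flow row_mxKl row_mxKr mxE.
have Ceta k : Ck_on k D eta.
  apply: Ck_ext (@smooth_part k 1 P S (maskN_lin _) (mask_lin _) (normr1 _) PB) => // z _.
  by rewrite mul1r.
have Ctheta k : Ck_on k D theta.
  have n1 : `|-1 : R| = 1 by rewrite normrN normr1.
  apply: Ck_ext (@smooth_part k (-1) Q S' (maskN_lin _) (mask_lin _) n1 QB) => // z _.
  by rewrite mulN1r.
have phi_lt (i : 'I_n) (t : R) x : (i < j)%N -> `|t| < T -> B0 x -> phi t x 0 i = x 0 i.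
  move=> ij tT Bx; rewrite (flow_coord_affine KO hphi (a := 0) _ tT Bx) ?mul0r ?addr0 //.
  by move=> z /Yc[/(_ i ij)].
have phi_j (t : R) x : `|t| < T -> B0 x -> phi t x 0 j = x 0 j + t.
  move=> tT Bx; rewrite (flow_coord_affine KO hphi (a := 1) _ tT Bx) ?mul1r //.
  by move=> z /Yc[].
have SE z i : S z 0 i = if (i < j)%N then z 0 i else 0 by rewrite mxE.
have S'E z i : S' z 0 i = if (i <= j)%N then z 0 i else 0 by rewrite mxE.
have PE z i : P z 0 i = if (i <= j)%N then 0 else z 0 i by rewrite mxE.
have QE z i : Q z 0 i = if (i < j)%N then 0 else z 0 i by rewrite mxE.
have etaE w i : eta w 0 i = S w 0 i + phi (w 0 j) (P w) 0 i by rewrite mxE.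
have thetaE z i : theta z 0 i = S' z 0 i + phi (- z 0 j) (Q z) 0 i by rewrite mxE.
have E := (etaE, thetaE, SE, S'E, PE, QE).
have Qeta w : D w -> Q (eta w) = phi (w 0 j) (P w).
  move=> Dw; apply/rowP => i; rewrite !E; case: (ltnP i j) => ij; last by rewrite add0r.
  by rewrite phi_lt ?E ?(ltnW ij) //; [apply: half; case: (DB w Dw)|exact: PB].
have Ptheta z : D z -> P (theta z) = phi (- z 0 j) (Q z).
  move=> Dz; have tT : `|- z 0 j| < T by rewrite normrN; apply: half; case: (DB z Dz).
  apply/rowP => i; rewrite !E; case: (leqP i j) => ij; last by rewrite add0r.
  move: ij; rewrite leq_eqVlt => /orP[/eqP/val_inj ->|ij].
    by rewrite phi_j ?E ?ltnn ?subrr //; exact: QB.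
  by rewrite phi_lt ?E ?ij //; exact: QB.
have theta_eta w : D w -> D (eta w) -> theta (eta w) = w.
  move=> Dw De; have [wT wd] := DB w Dw.
  have ej : eta w 0 j = w 0 j.
    by rewrite !E ltnn add0r phi_j ?E ?leqnn ?add0r //; [exact: half|exact: PB].
  rewrite /theta Qeta // ej (flow_inverse oO KO (hY 1%N) hphi wT (PB _ Dw)); last first.
    by rewrite -Qeta //; exact: QB.
  apply/rowP => i; rewrite [LHS]mxE !E; case: (leqP i j) => ij; last by rewrite add0r.
  rewrite addr0; move: ij; rewrite leq_eqVlt => /orP[/eqP/val_inj ->|ij].
    by rewrite ltnn add0r phi_j ?E ?leqnn ?add0r //; [exact: half|exact: PB].
  by rewrite ij phi_lt ?E ?(ltnW ij) ?addr0 //; [exact: half|exact: PB].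
have eta_theta z : D z -> D (theta z) -> eta (theta z) = z.
  move=> Dz Dt; have [zT zd] := DB z Dz.
  have zT' : `|- z 0 j| < T / 2 by rewrite normrN.
  have ej : theta z 0 j = z 0 j.
    by rewrite !E leqnn phi_j ?E ?ltnn ?subrr ?addr0 //; [exact: half|exact: QB].
  have By : B0 (phi (- z 0 j) (Q z)) by rewrite -Ptheta //; exact: PB.
  have K := flow_inverse oO KO (hY 1%N) hphi zT' (QB _ Dz) By.
  rewrite opprK in K; rewrite /eta Ptheta // ej K.
  apply/rowP => i; rewrite [LHS]mxE !E; case: (ltnP i j) => ij; last by rewrite add0r.
  by rewrite (ltnW ij) phi_lt ?E ?ij ?addr0 //; [exact: half|exact: QB].
have zero0 (m : pred 'I_n) : (\row_i (if m i then (0 : 'rV[R]_n) 0 i else 0) : 'rV[R]_n) = 0.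
  by apply/rowP => i; rewrite !mxE; case: ifP.
have zero1 (m : pred 'I_n) : (\row_i (if m i then 0 else (0 : 'rV[R]_n) 0 i) : 'rV[R]_n) = 0.
  by apply/rowP => i; rewrite !mxE; case: ifP.
have B00 : B0 0 by apply/B0E; rewrite normr0.
have D0 : D 0 by rewrite /D /= normr0 lt_min d0 divr_gt0.
have [phi00 _] := hphi _ B00.
have eta0 : eta 0 = 0 by rewrite /eta /S /P zero0 zero1 mxE phi00 addr0.
have theta0 : theta 0 = 0 by rewrite /theta /S' /Q zero0 zero1 mxE oppr0 phi00 addr0.
(* The two inverse identities hold at points of [D] whose image is also in [D], hence this choice of
   domains. *)
exists (D `&` theta @^-1` D), (D `&` eta @^-1` D), theta, eta; split.
- split.
  + by apply: (open_preimage_for oD oD) => x Dx; have C := Ck_cont (Ctheta 0%N) Dx; exact: C.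
  + by apply: (open_preimage_for oD oD) => x Dx; have C := Ck_cont (Ceta 0%N) Dx; exact: C.
  + by move=> k; apply: Ck_sub (Ctheta k) => x [].
  + by move=> k; apply: Ck_sub (Ceta k) => x [].
  + split.
      by move=> x [/= Dx Dt]; rewrite eta_theta.
    by move=> x [/= Dx Dt]; rewrite theta_eta.
- by split => //=; rewrite theta0.
- by split => //; split => //=; rewrite eta0.
move=> w [Dw Dew]; split.
  move=> b bj; apply: is_derive_reparam (is_derive_id (eta w) (delta_mx 0 b)) => h.
  have bj' : b != j by apply: contraTneq bj => ->; rewrite ltnn.
  have -> : eta (h *: delta_mx 0 b + w) = S (h *: delta_mx 0 b + w) + phi (w 0 j) (P (h *: delta_mx 0 b + w)).
    by rewrite /eta; congr (_ + phi _ _); rewrite !mxE /= (eq_sym j) (negPf bj') mulr0 add0r.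
  have -> : P (h *: delta_mx 0 b + w) = P w.
    apply/rowP => i; rewrite !E !mxE /=; case: ifP => // ij.
    have [ib|] := eqVneq i b; last by rewrite mulr0 add0r.
    by rewrite ib (ltnW bj) in ij.
  rewrite addrA; congr (_ + _); apply/rowP => i; rewrite !mxE /=.
  case: ifP => // ij; rewrite addr0.
  by have [ib|] := eqVneq i b; [rewrite ib bj in ij|rewrite mulr0].
have [wT _] := DB w Dw.
have [_ /(_ _ (half _ wT))[_ Dphi]] := hphi _ (PB _ Dw).
(* [eta w] and the point reached by the flow differ only in coordinates of index below [j], which
   [Y] does not involve. *)
have YE : Y (eta w) = Y (phi (w 0 j) (P w)).
  rewrite -(Qeta w Dw); apply: Yinv => i ij; by rewrite QE ltnNge ij.
rewrite YE -[Y _]add0r.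
have D1 := is_deriveD (@is_derive_cst R R^o _ (S w) (w 0 j) 1) Dphi.
apply: is_derive_reparam D1 => h; rewrite /eta /=.
have -> : P (h *: delta_mx 0 j + w) = P w.
  apply/rowP => i; rewrite !E !mxE /=; case: ifP => // ij.
  have [ib|] := eqVneq i j; last by rewrite mulr0 add0r.
  by rewrite ib leqnn in ij.
have -> : S (h *: delta_mx 0 j + w) = S w.
  apply/rowP => i; rewrite !E !mxE /=; case: ifP => // ij.
  have [ib|] := eqVneq i j; last by rewrite mulr0 add0r.
  by rewrite ib ltnn in ij.
by rewrite !mxE !eqxx.
Qed.

End FlowBox.

(** * Functions in involution *)

Section SymplecticCoordinates.
Context {R : realType}.

Lemma Ck_det n m k (A : set 'rV[R]_n) (Om : 'rV[R]_n -> 'M[R]_m) : open A ->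
  (forall i j, Ck_on k A (fun x => Om x i j : R^o)) -> Ck_on k A (fun x => \det (Om x) : R^o).
Proof.
move=> oA h; rewrite /determinant; apply: Ck_sum => // s _.
by apply: Ck_M => //; [exact: Ck_cst|apply: Ck_prod].
Qed.

(** By Cramer's formula the entries are cofactors divided by the determinant. *)
Lemma Ck_invmx n m k (A : set 'rV[R]_n) (Om : 'rV[R]_n -> 'M[R]_m) : open A ->
  (forall x, A x -> Om x \in unitmx) ->
  (forall i j, Ck_on k A (fun x => Om x i j : R^o)) ->
  forall i j, Ck_on k A (fun x => invmx (Om x) i j : R^o).
Proof.
move=> oA u h i j.
apply: (@Ck_ext _ _ _ _ _ (fun x => (\det (Om x))^-1 * cofactor (Om x) j i)) => //.
  by move=> x Ax; rewrite /invmx u // !mxE.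
apply: Ck_M => //.
  apply: Ck_V => //; last exact: Ck_det.
  by move=> x Ax; have := u x Ax; rewrite unitmxE unitfE.
apply: Ck_M => //; first exact: Ck_cst.
apply: Ck_det => // a b.
by apply: Ck_ext (h (lift j a) (lift i b)) => // x _; rewrite !mxE.
Qed.

Lemma Ck_dir n k (A : set 'rV[R]_n) (f : 'rV[R]_n -> R^o) v : open A ->
  Ck_on k.+1 A f -> Ck_on k A (fun x => 'D_v f x).
Proof.
move=> oA hf; apply: (@Ck_ext _ _ _ _ _ (fun x => \sum_i v 0 i * 'D_(delta_mx 0 i) f x)) => //.
  move=> x Ax; rewrite (derive_partial _ oA _ Ax) //.
  by elim: k hf => // k IH /CkW.
by apply: Ck_sum => // i _; apply: Ck_Z => //; exact: CkS hf.
Qed.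

Lemma dir_comm n (A : set 'rV[R]_n) (f : 'rV[R]_n -> R^o) x u v :
  open A -> Ck_on 2 A f -> A x ->
  'D_u (fun z => 'D_v f z) x = 'D_v (fun z => 'D_u f z) x.
Proof.
move=> oA hf Ax; have hu := Ck_dir u oA hf; have hv := Ck_dir v oA hf.
apply: (mixed_partials oA Ax).
- by move=> y Ay; apply/diff_derivable; have [] := partial_differentiable oA (CkW hf) Ay.
- by move=> y Ay; apply/diff_derivable; have [] := partial_differentiable oA (CkW hf) Ay.
- by move=> y Ay; apply/diff_derivable; have [] := partial_differentiable oA hv Ay.
- by move=> y Ay; apply/diff_derivable; have [] := partial_differentiable oA hu Ay.
- have C := Ck_cont (Ck_dir u oA hv) Ax; exact: C.
- have C := Ck_cont (Ck_dir v oA hu) Ax; exact: C.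
Qed.

Definition bil n (Om : 'rV[R]_n -> 'M[R]_n) (x u v : 'rV[R]_n) : R := (u *m Om x *m v^T) 0 0.

Lemma bilE n Om (x u v : 'rV[R]_n) :
  bil Om x u v = \sum_j \sum_i u 0 i * Om x i j * v 0 j.
Proof.
rewrite /bil mxE; apply: eq_bigr => j _; rewrite mxE mulr_suml; apply: eq_bigr => i _.
by rewrite mxE.
Qed.

Lemma bilBl n Om (x u u' v : 'rV[R]_n) : bil Om x (u - u') v = bil Om x u v - bil Om x u' v.
Proof. by rewrite /bil !mulmxBl !mxE. Qed.

Definition grad n (f : 'rV[R]_n -> R^o) x : 'rV[R]_n := \row_i 'D_(delta_mx 0 i) f x.

(** The solution [u] of [u *m Om x = grad f x], that is, of [i_u omega = df] in row vectors. *)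
Definition ham n (Om : 'rV[R]_n -> 'M[R]_n) (f : 'rV[R]_n -> R^o) x : 'rV[R]_n :=
  grad f x *m invmx (Om x).

Lemma derive_grad n (A : set 'rV[R]_n) (f : 'rV[R]_n -> R^o) x v :
  open A -> Ck_on 1 A f -> A x -> 'D_v f x = (grad f x *m v^T) 0 0.
Proof.
move=> oA hf Ax; rewrite (derive_partial _ oA hf Ax) mxE; apply: eq_bigr => i _.
by rewrite !mxE mulrC.
Qed.

Section Symplectic.
Context {n : nat} (Om : 'rV[R]_n -> 'M[R]_n) (V : set 'rV[R]_n).
Hypotheses (oV : open V) (smO : forall i j, smooth_on V (fun x => Om x i j : R^o))
  (unO : forall x, V x -> Om x \in unitmx)
  (skO : forall x u v, V x -> bil Om x u v = - bil Om x v u)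
  (clO : forall x u v w, V x ->
    'D_u (fun y => bil Om y v w : R^o) x + 'D_v (fun y => bil Om y w u : R^o) x
    + 'D_w (fun y => bil Om y u v : R^o) x = 0).

Lemma Ck_ham k f : Ck_on k.+1 V f -> Ck_on k V (ham Om f).
Proof.
move=> hf; apply/Ck_coord => // j.
apply: (@Ck_ext _ _ _ _ _ (fun x => \sum_i 'D_(delta_mx 0 i) f x * invmx (Om x) i j)) => //.
  by move=> x _; rewrite mxE; apply: eq_bigr => i _; rewrite mxE.
apply: Ck_sum => // i _; apply: Ck_M => //; first exact: CkS hf.
by apply: Ck_invmx => // a b; exact: smO.
Qed.

Lemma bil_ham f x v : Ck_on 1 V f -> V x -> bil Om x (ham Om f x) v = 'D_v f x.
Proof.
by move=> hf Vx; rewrite (derive_grad _ oV hf Vx) /bil /ham mulmxKV // unO.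
Qed.

Lemma ham_skew f g x : Ck_on 1 V f -> Ck_on 1 V g -> V x ->
  'D_(ham Om f x) g x = - 'D_(ham Om g x) f x.
Proof. by move=> hf hg Vx; rewrite -!bil_ham // skO. Qed.

Lemma bil_eq0 x u : V x -> (forall v, bil Om x u v = 0) -> u = 0.
Proof.
move=> Vx h; rewrite -(mulmxK (unO Vx) u) (_ : u *m Om x = 0) ?mul0mx //.
apply/rowP => j; rewrite [RHS]mxE; have := h (delta_mx 0 j); rewrite /bil => <-.
by rewrite trmx_delta -colE [RHS]mxE.
Qed.

Lemma is_derive_bil (a b : 'rV[R]_n -> 'rV[R]_n) x w : V x ->
  differentiable a x -> differentiable b x ->
  'D_w (fun y => bil Om y (a y) (b y) : R^o) x =
  'D_w (fun y => bil Om y (a x) (b x) : R^o) x + bil Om x ('D_w a x) (b x) + bil Om x (a x) ('D_w b x).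
Proof.
move=> Vx da db.
have dO i j : derivable (fun y => Om y i j : R^o) x w.
  by apply/diff_derivable; have [] := partial_differentiable oV (smO i j 1%N) Vx.
have dai i : derivable (fun y => a y 0 i : R^o) x w.
  by have /derivable_mxP/(_ 0 i) := diff_derivable (v := w) da.
have dbi i : derivable (fun y => b y 0 i : R^o) x w.
  by have /derivable_mxP/(_ 0 i) := diff_derivable (v := w) db.
have Da i : ('D_w a x) 0 i = 'D_w (fun y => a y 0 i : R^o) x.
  by rewrite derive_mx ?mxE //; exact: diff_derivable.
have Db i : ('D_w b x) 0 i = 'D_w (fun y => b y 0 i : R^o) x.
  by rewrite derive_mx ?mxE //; exact: diff_derivable.
have T (p q : 'I_n -> 'rV[R]_n -> R^o) : (forall i, derivable (p i) x w) -> (forall i, derivable (q i) x w) ->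
  'D_w (fun y => \sum_j \sum_i p i y * Om y i j * q j y : R^o) x =
  \sum_j \sum_i ('D_w (p i) x * Om x i j * q j x + p i x * 'D_w (fun y => Om y i j : R^o) x * q j x
     + p i x * Om x i j * 'D_w (q j) x).
  move=> dp dq.
  have I : is_derive x w (fun y => \sum_j \sum_i p i y * Om y i j * q j y : R^o)
   (\sum_j \sum_i ('D_w (p i) x * Om x i j * q j x + p i x * 'D_w (fun y => Om y i j : R^o) x * q j x
     + p i x * Om x i j * 'D_w (q j) x)).
    rewrite (_ : (fun y => _) = \sum_j \sum_i (p i * (fun y => Om y i j : R^o) * q j)); last first.
      by apply: funext => y; rewrite fct_sumE; apply: eq_bigr => j _; rewrite fct_sumE.
    apply: is_derive_sum => j; apply: is_derive_sum => i.
    have := is_deriveM (is_deriveM (derivableP (dp i)) (derivableP (dO i j))) (derivableP (dq j)).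
    move=> D; apply: is_derive_eq; rewrite /GRing.scale /=.
    rewrite -[(p i * _) x]/(p i x * Om x i j); ring.
  by case: I.
under eq_fun => y do rewrite bilE.
rewrite (T (fun i y => a y 0 i) (fun i y => b y 0 i)) //.
have -> : 'D_w (fun y => bil Om y (a x) (b x) : R^o) x =
    'D_w (fun y => \sum_j \sum_i a x 0 i * Om y i j * b x 0 j : R^o) x.
  by under eq_fun => y do rewrite bilE.
rewrite (T (fun i _ => a x 0 i) (fun i _ => b x 0 i)); try by move=> i; exact: derivable_cst.
rewrite !bilE -!big_split /=; apply: eq_bigr => j _; rewrite -!big_split /=; apply: eq_bigr => i _.
by rewrite !derive_cst Da Db !mulr0 !mul0r; ring.
Qed.

(** Differentiating [omega(X_f, v) = 'D_v f] along [w] shows that each side is a second derivative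
    of [f], and these commute. *)
Lemma ham_symmetric f x v w : Ck_on 2 V f -> V x ->
  'D_w (fun y => bil Om y (ham Om f x) v : R^o) x + bil Om x ('D_w (ham Om f) x) v =
  'D_v (fun y => bil Om y (ham Om f x) w : R^o) x + bil Om x ('D_v (ham Om f) x) w.
Proof.
move=> hf Vx.
have dh : differentiable (ham Om f) x by exact: C1_differentiable oV (Ck_ham hf) Vx.
have key u u' : 'D_u' (fun z => 'D_u f z) x =
   'D_u' (fun y => bil Om y (ham Om f x) u : R^o) x + bil Om x ('D_u' (ham Om f) x) u.
  transitivity ('D_u' (fun y => bil Om y (ham Om f y) u : R^o) x).
    apply: near_eq_derive; have : nbhs x V by exact: open_nbhs_nbhs.
    by apply: filterS => y Vy; rewrite bil_ham //; exact: CkW.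
  rewrite (is_derive_bil (b := fun=> u)) ?derive_cst //.
  by rewrite /bil [X in _ + (_ *m X) 0 0]trmx0 mulmx0 [X in _ + X]mxE addr0.
by rewrite -!key; exact: (dir_comm _ _ oV hf Vx).
Qed.

(** The linear algebra behind [ham_commute]: [p1], [p2], [q1], [q2], [r] stand for derivatives of
    the form on constant vectors, and [x], [y], [z], [w], [u] for its values on derivatives of the
    two fields. *)
Lemma cyclic_arith (p1 p2 q1 q2 r x y z u w : R) :
  p1 + x = q1 + y -> p2 + z = q2 + w -> 0 = q1 + y + u -> q1 + p2 + r = 0 ->
  w = - u -> q2 = - q1 -> p1 = - r -> z - x = 0.
Proof. lra. Qed.

(** The difference is paired with an arbitrary [v]. Its value cancels by closedness of the form, the
    symmetry of the Hessians of [f] and [g], and the derivative along [v] of the identity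
    [omega(X_f, X_g) = 0], which is why the bracket must vanish on all of [V]. *)
Lemma ham_commute (f g : 'rV[R]_n -> R^o) x : Ck_on 2 V f -> Ck_on 2 V g ->
  (forall y, V y -> 'D_(ham Om f y) g y = 0) -> V x ->
  'D_(ham Om f x) (ham Om g) x = 'D_(ham Om g x) (ham Om f) x.
Proof.
move=> hf hg fg0 Vx; set a := ham Om f x; set b := ham Om g x.
have da : differentiable (ham Om f) x by exact: C1_differentiable oV (Ck_ham hf) Vx.
have db : differentiable (ham Om g) x by exact: C1_differentiable oV (Ck_ham hg) Vx.
apply/subr0_eq/(bil_eq0 Vx) => v; rewrite bilBl.
have E1 := ham_symmetric v b hf Vx; have E2 := ham_symmetric v a hg Vx.
rewrite -/a in E1; rewrite -/b in E2.
have E3 : 0 = 'D_v (fun y => bil Om y a b : R^o) x + bil Om x ('D_v (ham Om f) x) b + bil Om x a ('D_v (ham Om g) x).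
  rewrite -(is_derive_bil v Vx da db) -[LHS](@derive_cst R _ R^o 0 x v).
  apply: near_eq_derive; have : nbhs x V by exact: open_nbhs_nbhs.
  apply: filterS => y Vy; rewrite /= skO // bil_ham //; last exact: CkW.
  by rewrite fg0 ?oppr0.
have swap p q w : 'D_w (fun y => bil Om y p q : R^o) x = - 'D_w (fun y => bil Om y q p : R^o) x.
  rewrite -deriveN; last first.
    apply/diff_derivable; apply: (@proj1 _ _ (partial_differentiable oV _ Vx)).
    apply: (@Ck_ext _ _ _ _ _ (fun y => \sum_j \sum_i q 0 i * Om y i j * p 0 j)) => //.
      by move=> y _; rewrite bilE.
    apply: Ck_sum => // j _; apply: Ck_sum => // i _.
    by apply: Ck_M => //; [apply: Ck_Z => //; exact: smO|exact: Ck_cst].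
  apply: near_eq_derive; have : nbhs x V by exact: open_nbhs_nbhs.
  by apply: filterS => y Vy; rewrite skO.
have C := clO v a b Vx.
have S1 := skO ('D_v (ham Om g) x) a Vx.
exact: cyclic_arith E1 E2 E3 C S1 (swap b a v) (swap a v b).
Qed.

(** Leibniz rule: the first term differentiates the field [b], the second differentiates [h] with
    [b] frozen at [x]. *)
Lemma derive_vf (a b : 'rV[R]_n -> 'rV[R]_n) (h : 'rV[R]_n -> R^o) x : V x ->
  Ck_on 1 V b -> Ck_on 2 V h ->
  'D_(a x) (fun y => 'D_(b y) h y) x = 'D_('D_(a x) b x) h x + 'D_(a x) (fun y => 'D_(b x) h y) x.
Proof.
move=> Vx hb hh.
have db : differentiable b x by exact: C1_differentiable oV hb Vx.
have dbi i : derivable (fun y => b y 0 i : R^o) x (a x).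
  by have /derivable_mxP/(_ 0 i) := diff_derivable (v := a x) db.
have dhi i : derivable (fun y => 'D_(delta_mx 0 i) h y) x (a x).
  by apply/diff_derivable; have [] := partial_differentiable oV (CkS i hh) Vx.
have T (p : 'I_n -> 'rV[R]_n -> R^o) : (forall i, derivable (p i) x (a x)) ->
  'D_(a x) (fun y => \sum_i p i y * 'D_(delta_mx 0 i) h y : R^o) x =
  \sum_i ('D_(a x) (p i) x * 'D_(delta_mx 0 i) h x + p i x * 'D_(a x) (fun y => 'D_(delta_mx 0 i) h y) x).
  move=> dp.
  have I : is_derive x (a x) (fun y => \sum_i p i y * 'D_(delta_mx 0 i) h y : R^o)
     (\sum_i ('D_(a x) (p i) x * 'D_(delta_mx 0 i) h x + p i x * 'D_(a x) (fun y => 'D_(delta_mx 0 i) h y) x)).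
    rewrite (_ : (fun y => _) = \sum_i (p i * (fun y => 'D_(delta_mx 0 i) h y))); last first.
      by apply: funext => y; rewrite fct_sumE.
    apply: is_derive_sum => i.
    have := is_deriveM (derivableP (dp i)) (derivableP (dhi i)).
    by move=> D; apply: is_derive_eq; rewrite /GRing.scale /=; ring.
  by case: I.
have N (c : 'rV[R]_n -> 'rV[R]_n) : 'D_(a x) (fun y => 'D_(c y) h y) x = 'D_(a x) (fun y => \sum_i c y 0 i * 'D_(delta_mx 0 i) h y : R^o) x.
  apply: near_eq_derive; have : nbhs x V by exact: open_nbhs_nbhs.
  by apply: filterS => y Vy; rewrite (derive_partial _ oV (CkW hh) Vy).
rewrite (N b) (N (fun=> b x)) (T (fun i y => b y 0 i)) // (T (fun i _ => b x 0 i)); last by move=> i; exact: derivable_cst.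
rewrite (derive_partial _ oV (CkW hh) Vx) -big_split /=; apply: eq_bigr => i _.
rewrite derive_cst mul0r add0r; congr (_ * _ + _).
by rewrite derive_mx ?mxE //; exact: diff_derivable.
Qed.

(** Used with a coordinate of the chart as [h]: if [h] is constant along [X_f], then so is the
    component [X_g h] of [X_g]. *)
Lemma ham_bracket (f g h : 'rV[R]_n -> R^o) x : Ck_on 2 V f -> Ck_on 2 V g -> Ck_on 2 V h ->
  (forall y, V y -> 'D_(ham Om f y) g y = 0) -> V x ->
  'D_(ham Om f x) (fun y : 'rV[R]_n => 'D_(ham Om g y) h y : R^o) x = 'D_(ham Om g x) (fun y : 'rV[R]_n => 'D_(ham Om f y) h y : R^o) x.
Proof.
move=> hf hg hh fg0 Vx.
have E1 := derive_vf (ham Om f) Vx (Ck_ham hg) hh.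
have E2 := derive_vf (ham Om g) Vx (Ck_ham hf) hh.
rewrite [LHS]E1.
rewrite [RHS]E2.
rewrite (ham_commute hf hg fg0 Vx).
exact: (congr1 (fun t : R^o => 'D_('D_(ham Om g x) (ham Om f) x) h x + t) (dir_comm (ham Om f x) (ham Om g x) oV hh Vx)).
Qed.

End Symplectic.
End SymplecticCoordinates.

(** * Charts adapted to functions in involution *)

Section Frames.
Context {R : realType}.

Lemma derive_eq_on n m (V : set 'rV[R]_n) (f g : 'rV[R]_n -> 'rV[R]_m) x v :
  open V -> (forall y, V y -> f y = g y) -> V x -> 'D_v f x = 'D_v g x.
Proof.
move=> oV fg Vx; apply: near_eq_derive; have : nbhs x V by exact: open_nbhs_nbhs.
by apply: filterS => y; exact: fg.
Qed.

Lemma derive_eq0_on n (V : set 'rV[R]_n) (f : 'rV[R]_n -> R^o) x v :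
  open V -> (forall y, V y -> f y = 0) -> V x -> 'D_v f x = 0.
Proof.
move=> oV f0 Vx; rewrite -[RHS](@derive_cst R _ R^o 0 x v).
apply: near_eq_derive; have : nbhs x V by exact: open_nbhs_nbhs.
by apply: filterS => y; exact: f0.
Qed.

Lemma derive_linear n m (f : 'rV[R]_n -> 'rV[R]_m) z v : linear f -> 'D_v f z = f v.
Proof.
move=> lf; pose fM := GRing.isLinear.Build _ _ _ _ _ lf.
pose fL : {linear 'rV[R]_n -> 'rV[R]_m} := HB.pack f fM.
have cf : continuous fL.
  move=> x; have C := Ck_cont (Ck_linear 0%N (@openT _) lf) (I : setT x); exact: C.
rewrite -[f]/(fL : _ -> _) deriveE; first by rewrite diff_lin.
exact: linear_differentiable.
Qed.

Lemma derive_coord n m (f : 'rV[R]_n -> 'rV[R]_m) x v i : differentiable f x ->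
  ('D_v f x) 0 i = 'D_v (fun y => f y 0 i : R^o) x.
Proof. by move=> df; rewrite derive_mx ?mxE //; exact: diff_derivable. Qed.

Section LocalDiffeo.
Context {n : nat} (V W : set 'rV[R]_n) (F G : 'rV[R]_n -> 'rV[R]_n).
Hypothesis LD : local_diffeo V W F G.

Lemma local_diffeo_sym : local_diffeo W V G F.
Proof. by case: LD => a b c d [e f]; split. Qed.

Lemma local_diffeo_diffl x : V x -> differentiable F x.
Proof. by case: LD => oV _ sF _ _ Vx; exact: C1_differentiable oV (sF 1%N) Vx. Qed.

Lemma local_diffeo_diffr z : W z -> differentiable G z.
Proof. by case: LD => _ oW _ sG _ Wz; exact: C1_differentiable oW (sG 1%N) Wz. Qed.

Lemma local_diffeo_derive z v : W z -> 'D_('D_v G z) F (G z) = v.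
Proof.
move=> Wz; case: LD => oV oW _ _ [_ WG]; have [VGz _] := WG z Wz.
rewrite -derive_chain; [|exact: local_diffeo_diffr|exact: local_diffeo_diffl].
rewrite (derive_eq_on (g := id) _ oW _ Wz) ?derive_id //.
by move=> y /WG[].
Qed.

End LocalDiffeo.

Lemma local_diffeo_derive_inv n (V W : set 'rV[R]_n) F G x u : local_diffeo V W F G ->
  V x -> 'D_('D_u F x) G (F x) = u.
Proof. by move=> LD Vx; exact: (local_diffeo_derive (local_diffeo_sym LD)). Qed.

Lemma local_diffeo_comp n (V W A B C : set 'rV[R]_n) F G theta eta :
  local_diffeo V W F G -> local_diffeo A B theta eta -> open C -> C `<=` B ->
  (forall w, C w -> W (eta w)) ->
  local_diffeo (V `&` F @^-1` (A `&` theta @^-1` C)) C (theta \o F) (G \o eta).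
Proof.
move=> [oV oW sF sG [VF WG]] [oA oB st se [At Be]] oC CB CW.
have cF x : V x -> {for x, continuous F} by move=> Vx; have C1 := Ck_cont (sF 0%N) Vx; exact: C1.
have ct x : A x -> {for x, continuous theta} by move=> Vx; have C1 := Ck_cont (st 0%N) Vx; exact: C1.
have oV' : open (V `&` F @^-1` (A `&` theta @^-1` C)).
  by apply: (open_preimage_for oV _ cF); exact: (open_preimage_for oA oC ct).
split => //.
- move=> k; apply: (@Ck_comp_rV _ _ _ _ _ _ A F theta oV' oA) => //; first by move=> x [_ []].
  by apply: Ck_sub (sF k) => x [].
- move=> k; apply: (@Ck_comp_rV _ _ _ _ _ _ W eta G oC oW) => //.
  by apply: Ck_sub (se k).
- split; first by move=> x [/= /VF[WFx GFx] [AFx CtF]]; split => //; rewrite (At _ AFx).2.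
  move=> w Cw /=; have [VG FG] := WG _ (CW w Cw); have [Ae te] := Be _ (CB w Cw).
  by rewrite FG te; split => //; split => //=; rewrite FG te.
Qed.

Definition swap n (a b i : 'I_n) : 'I_n := if i == a then b else if i == b then a else i.

Lemma swapK n (a b : 'I_n) : involutive (swap a b).
Proof.
move=> i; rewrite /swap; have [->|ia] := eqVneq i a.
  by rewrite eqxx; case: eqVneq => [->|].
have [->|ib] := eqVneq i b; first by rewrite eqxx.
by rewrite (negPf ia) (negPf ib).
Qed.

Lemma Ck_vf_derive n m k (V : set 'rV[R]_n) (a : 'rV[R]_n -> 'rV[R]_n) (F : 'rV[R]_n -> 'rV[R]_m) :
  open V -> Ck_on k V a -> Ck_on k.+1 V F -> Ck_on k V (fun x => 'D_(a x) F x).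
Proof.
move=> oV ha hF.
apply: (@Ck_ext _ _ _ _ _ (fun x => \sum_i a x 0 i *: 'D_(delta_mx 0 i) F x)) => //.
  move=> x Vx; rewrite -(derive_partial_rV _ oV _ Vx) //.
  by elim: k hF {ha} => // k IH /CkW.
apply: Ck_sum => // i _; apply: Ck_scale => //; last exact: CkS hF.
exact: (Ck_coord _ _ oV).1.
Qed.

Section Induction.
Context {n : nat} (Om : 'rV[R]_n -> 'M[R]_n) (V0 : set 'rV[R]_n) (x0 : 'rV[R]_n).
Hypotheses (smO : forall i j, smooth_on V0 (fun x => Om x i j : R^o))
  (unO : forall x, V0 x -> Om x \in unitmx)
  (skO : forall x u v, V0 x -> bil Om x u v = - bil Om x v u)
  (clO : forall x (u v w : 'rV[R]_n), V0 x ->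
    'D_u (fun y => bil Om y v w : R^o) x + 'D_v (fun y => bil Om y w u : R^o) x
    + 'D_w (fun y => bil Om y u v : R^o) x = 0).

(* Only [f 0], ..., [f (j - 1)] matter. *)
Definition frame_state (j : nat) (f : nat -> 'rV[R]_n -> R^o) V F G (e : R) : Prop :=
  [/\ local_diffeo V [set z | `|z| < e] F G, 0 < e, V `<=` V0, G 0 = x0 &
   [/\ forall a, (a < j)%N -> smooth_on V (f a),
       forall a b x, (a < j)%N -> (b < j)%N -> V x -> 'D_(ham Om (f a) x) (f b) x = 0,
       forall a x (i : 'I_n), (a < j)%N -> V x -> (j <= i)%N -> ('D_(ham Om (f a) x) F x) 0 i = 0 &
       forall z (b : 'I_n), `|z| < e -> (b < j)%N ->
         exists c : nat -> R, 'D_(delta_mx 0 b) G z = \sum_(a < j) c a *: ham Om (f a) (G z)]].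

(** The conditions treat all coordinates of index [>= j] alike, so any of them can be moved into
    position [j] before the next step. *)
Lemma frame_state_swap j f V F G e (i1 i2 : 'I_n) :
  frame_state j f V F G e -> (j <= i1)%N -> (j <= i2)%N ->
  let t := fun z : 'rV[R]_n => \row_i z 0 (swap i1 i2 i) : 'rV[R]_n in
  frame_state j f V (t \o F) (G \o t) e.
Proof.
move=> [LD e0 VV0 G0 [sf ff fF cG]] j1 j2 t.
have tl : linear t by move=> a u v; apply/rowP => i; rewrite !mxE.
have tK z : t (t z) = z by apply/rowP => i; rewrite !mxE swapK.
have tn z : `|t z| <= `|z| by apply: rVnorm_le => // i; rewrite mxE rVnorm_coord.
have ts m k (A : set 'rV[R]_m) (h : 'rV[R]_m -> 'rV[R]_n) : open A -> Ck_on k A h -> Ck_on k A (t \o h).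
  move=> oA hh; have oT : open (@setT 'rV[R]_n) by exact: openT.
  by apply: (@Ck_comp_rV _ _ _ _ _ _ setT h t oA oT) => //; exact: Ck_linear.
have td z : differentiable t z.
  by apply: (@C1_differentiable R _ _ setT); [exact: openT|apply: Ck_linear => //; exact: openT|].
have Dt v z : 'D_v t z = t v by exact: derive_linear.
have [oV oW sF sG [VF WG]] := LD.
have LD' : local_diffeo V [set z | `|z| < e] (t \o F) (G \o t).
  split => //.
  - by move=> k; exact: ts.
  - move=> k; apply: (@Ck_comp_rV _ _ _ _ _ _ _ t G oW oW) => //; last by exact: Ck_linear.
    by move=> z /= h; exact: le_lt_trans h.
  split; first by move=> x /VF[h1 h2] /=; rewrite tK; split => //; exact: le_lt_trans h1.
  move=> z Wz /=; have Wtz : [set z | `|z| < e] (t z) by exact: le_lt_trans Wz.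
  by have [h1 h2] := WG _ Wtz; rewrite h2 tK.
split => //.
  by rewrite /= (_ : t 0 = 0) //; apply/rowP => i; rewrite !mxE.
split => //.
  move=> a x i aj Vx ij.
  have -> : 'D_(ham Om (f a) x) (t \o F) x = t ('D_(ham Om (f a) x) F x).
    by rewrite (derive_chain (g := t)) ?Dt //; exact: (local_diffeo_diffl LD).
  rewrite mxE; apply: fF => //; rewrite /swap; case: ifP => // _; by case: ifP.
move=> z b ze bj.
have Wtz : `|t z| < e by exact: le_lt_trans ze.
have [c hc] := cG (t z) b Wtz bj; exists c; rewrite -hc.
apply: etrans (derive_chain (delta_mx 0 b) (td z) (local_diffeo_diffr LD Wtz)) _.
rewrite Dt; congr ('D_ _ _ _); apply/rowP => i; rewrite !mxE /=; congr (_%:R).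
have b1 : b != i1 by apply: contraTneq bj => ->; rewrite -leqNgt.
have b2 : b != i2 by apply: contraTneq bj => ->; rewrite -leqNgt.
rewrite (can2_eq (swapK i1 i2) (swapK i1 i2)) (_ : swap i1 i2 b = b) //.
by rewrite /swap (negPf b1) (negPf b2).
Qed.

Lemma bil_sub V : V `<=` V0 ->
  [/\ forall i j, smooth_on V (fun x => Om x i j : R^o),
      forall x, V x -> Om x \in unitmx,
      forall x u v, V x -> bil Om x u v = - bil Om x v u &
      forall x (u v w : 'rV[R]_n), V x ->
    'D_u (fun y => bil Om y v w : R^o) x + 'D_v (fun y => bil Om y w u : R^o) x
    + 'D_w (fun y => bil Om y u v : R^o) x = 0].
Proof.
move=> VV; split.
- by move=> i j k; exact: Ck_sub VV (smO i j k).
- by move=> x /VV; exact: unO.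
- by move=> x u v /VV; exact: skO.
- by move=> x u v w /VV; exact: clO.
Qed.

(** [g] is left general so as to cover both [H], at the first step, and a coordinate of the current
    chart, at the later ones. The nonzero component sits at index exactly [j], so that the
    straightened direction is the next axis. *)
Lemma frame_state_step j f V F G e g (J : 'I_n) :
  frame_state j f V F G e -> J = j :> nat ->
  smooth_on V g -> (forall a x, (a < j)%N -> V x -> 'D_(ham Om (f a) x) g x = 0) ->
  ('D_(ham Om g x0) F x0) 0 J <> 0 ->
  exists V' F' G' e', frame_state j.+1 (fun a => if a == j then g else f a) V' F' G' e'.
Proof.
move=> [LD e0 VV0 G0 [sf ff fF cG]] Jj sg fg gJ.
have [oV oW sF sG [VF WG]] := LD.
have [smV unV skV clV] := bil_sub VV0.
set W := [set z | `|z| < e] in LD oW VF WG sG.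
have W0 : W 0 by rewrite /W /= normr0.
have DFG z u : W z -> 'D_('D_u F (G z)) G z = u.
  move=> Wz; have [VGz FGz] := WG z Wz.
  by have := local_diffeo_derive_inv u LD VGz; rewrite FGz.
(* The components of [X_g] in the chart [F], as functions of the original point; [Cz] below is the
   same field in the new coordinates. *)
pose Cv x := 'D_(ham Om g x) F x.
have sCv k : Ck_on k V Cv.
  by apply: Ck_vf_derive => //; apply: Ck_ham => //; exact: sg.
have Cvi x i : V x -> Cv x 0 i = 'D_(ham Om g x) (fun y => F y 0 i : R^o) x.
  by move=> Vx; apply: derive_coord; exact: (local_diffeo_diffl LD).
have sFi i k : Ck_on k V (fun y => F y 0 i : R^o) by apply: (Ck_coord _ _ oV).1; exact: sF.
(* [X_(f_a) (X_g F_i) = X_g (X_(f_a) F_i)], and [X_(f_a) F_i] vanishes for [i >= j]. *)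
have Cv_const a (i : 'I_n) x : (a < j)%N -> (j <= i)%N -> V x ->
    'D_(ham Om (f a) x) (fun y => Cv y 0 i : R^o) x = 0.
  move=> aj ji Vx.
  have -> : 'D_(ham Om (f a) x) (fun y => Cv y 0 i : R^o) x =
      'D_(ham Om (f a) x) (fun y : 'rV[R]_n => 'D_(ham Om g y) (fun y => F y 0 i : R^o) y : R^o) x.
    apply: near_eq_derive; have : nbhs x V by exact: open_nbhs_nbhs.
    by apply: filterS => y; exact: Cvi.
  have E := ham_bracket oV smV unV skV clV (sf a aj 2%N) (sg 2%N) (sFi i 2%N) (fun y => fg a y aj) Vx.
  rewrite [LHS]E; apply: (derive_eq0_on _ oV _ Vx) => y Vy.
  by have := fF a y i aj Vy ji; rewrite (derive_coord _ _ (local_diffeo_diffl LD Vy)).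
pose Cz z := Cv (G z).
have sCz k : Ck_on k W Cz.
  by apply: (@Ck_comp_rV _ _ _ _ _ _ V G Cv oW oV) => // z /WG[].
have sCzi i k : Ck_on k W (fun z => Cz z 0 i : R^o) by apply: (Ck_coord _ _ oW).1.
have Cz_const (b i : 'I_n) z : (b < j)%N -> (j <= i)%N -> W z ->
    'D_(delta_mx 0 b) (fun z => Cz z 0 i : R^o) z = 0.
  move=> bj ji Wz; have [VGz _] := WG z Wz.
  have dC : differentiable (fun y => Cv y 0 i : R^o) (G z).
    by have [] := partial_differentiable oV ((Ck_coord _ _ oV).1 (sCv 1%N) i) VGz.
  rewrite (derive_chain (g := fun y => Cv y 0 i : R^o)) //; last exact: (local_diffeo_diffr LD).
  have [c ->] := cG z b Wz bj.
  rewrite deriveE // linear_sum big1 // => a _; rewrite linearZ /= -deriveE //.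
  by rewrite Cv_const // scaler0.
pose Q (z : 'rV[R]_n) : 'rV[R]_n := \row_i (if (i < j)%N then 0 else z 0 i).
have Qlin : linear Q.
  by move=> a u v; apply/rowP => i; rewrite !mxE; case: ifP => _; rewrite ?mulr0 ?addr0.
have QW z : W z -> W (Q z).
  move=> Wz; apply: le_lt_trans Wz; apply: rVnorm_le => // i.
  by rewrite mxE; case: ifP => _; rewrite ?normr0 ?rVnorm_coord.
(* The segment from [Q z] to [z] stays in the sup-norm ball and runs along the first [j] axes only,
   where the derivative of this component is 0. *)
have Cz_Q z (i : 'I_n) : W z -> (j <= i)%N -> Cz z 0 i = Cz (Q z) 0 i.
  move=> Wz ji; pose p s := Q z + s *: (z - Q z).
  have Wp s : 0 <= s <= 1 -> W (p s).
    move=> /andP[s0 s1]; apply: le_lt_trans Wz; apply: rVnorm_le => // l; rewrite !mxE.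
    case: ifP => _; last by rewrite subrr mulr0 addr0 rVnorm_coord.
    by rewrite subr0 add0r normrM ger0_norm // (le_trans _ (rVnorm_coord z l)) // ler_piMl.
  have dC q : W q -> 'D_(z - Q z) (fun z => Cz z 0 i : R^o) q = 0.
    move=> Wq; rewrite (derive_partial _ oW (sCzi i 1%N) Wq) big1 // => l _; rewrite !mxE.
    by case: (ltnP l j) => lj; [rewrite Cz_const // mulr0|rewrite subrr mul0r].
  have [s sI] := @MVT01 R (fun s => Cz (p s) 0 i) (fun s => 'D_(z - Q z) (fun z => Cz z 0 i : R^o) (p s))
    (fun s hs => is_derive_line (diff_derivable (partial_differentiable oW (sCzi i 1%N) (Wp s hs)).1)).
  by rewrite dC; [rewrite /p scale1r scale0r addr0 subrKC => /subr0_eq|exact: Wp].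
(* Modulo the span of the [X_(f_a)], the field of [g] is a multiple of [Y]; its
   components of index [>= j] are constant along the [X_(f_a)], which commute
   with it. *)
pose Y z : 'rV[R]_n := \row_i (if (i < j)%N then 0 else Cz (Q z) 0 i / Cz (Q z) 0 J).
have sCQ i k : Ck_on k W (fun z => Cz (Q z) 0 i : R^o).
  by apply: (@Ck_comp R _ _ k W W Q (fun z => Cz z 0 i : R^o)) => //; exact: Ck_linear.
pose O := W `&` (fun z => Cz (Q z) 0 J) @^-1` [set r : R | r != 0].
have oO : open O.
  apply: (open_preimage_for oW (@open_neq _ 0)) => z Wz.
  by have C := Ck_cont (sCQ J 0%N) Wz; exact: C.
have Q0 : Q 0 = 0 by apply/rowP => i; rewrite !mxE; case: ifP.
have CzJ0 : Cz 0 0 J != 0 by apply/eqP; rewrite /Cz G0.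
have O0 : O 0 by split; [exact: W0|rewrite /= Q0].
have sY : smooth_on O Y.
  move=> k; apply/Ck_coord => // i.
  apply: (@Ck_ext _ _ _ _ _ (fun z => if (i < j)%N then 0 else Cz (Q z) 0 i / Cz (Q z) 0 J : R^o)) => //.
    by move=> z _; rewrite mxE.
  case: (i < j)%N; first exact: Ck_cst.
  have sub : O `<=` W by move=> z [].
  apply: (Ck_M oO (Ck_sub sub (sCQ i k))).
  exact: (Ck_V oO (fun z (hz : O z) => hz.2) (Ck_sub sub (sCQ J k))).
have Y1 z : O z -> (forall i : 'I_n, (i < J)%N -> Y z 0 i = 0) /\ Y z 0 J = 1.
  move=> [_ /= nz]; split; first by move=> i; rewrite Jj mxE => ->.
  by rewrite mxE Jj ltnn divff.
(* This holds for all [z] and [z'], on [W] or not, because [Y] is defined through [Q z]. *)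
have Yinv (z z' : 'rV[R]_n) : (forall i : 'I_n, (J <= i)%N -> z 0 i = z' 0 i) -> Y z = Y z'.
  move=> h; rewrite /Y (_ : Q z = Q z') //; apply/rowP => i; rewrite !mxE.
  by case: ltnP => // ji; apply: h; rewrite Jj.
have [A [B [theta [eta [LE A0 [B0 eta0] Deta]]]]] := flow_box oO O0 sY Y1 Yinv.
have [oA oB st se [At Be]] := LE.
have ce w : B w -> {for w, continuous eta} by move=> Bw; have C := Ck_cont (se 0%N) Bw; exact: C.
have oBO : open (B `&` eta @^-1` O) := open_preimage_for oB oO ce.
have BO0 : (B `&` eta @^-1` O) 0 by split; [exact: B0|rewrite /= eta0].
have [e' e'0 he'] := (open_normP _).1 oBO 0 BO0.
pose W' : set 'rV[R]_n := [set w | `|w| < e'].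
have W'BO w : W' w -> B w /\ O (eta w) by move=> h; apply: he'; rewrite subr0.
have LD' : local_diffeo (V `&` F @^-1` (A `&` theta @^-1` W')) W' (theta \o F) (G \o eta).
  apply: (local_diffeo_comp LD LE); first exact: open_norm_lt.
    by move=> w /W'BO[].
  by move=> w /W'BO[_ []].
have deriv_eta w (nu : 'rV[R]_n) (c : R) : W' w -> (forall i : 'I_n, (j <= i)%N -> nu 0 i = 0) ->
    'D_(nu + c *: delta_mx 0 J) eta w = nu + c *: Y (eta w).
  move=> /W'BO[Bw _] hnu; have [D1 D2] := Deta w Bw.
  rewrite (derive_partial_rV _ oB (se 1%N) Bw).
  rewrite [in RHS](row_sum_coord nu) (_ : c *: Y (eta w) = \sum_(i < n) (if i == J then c *: Y (eta w) else 0)); last first.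
    by rewrite -big_mkcond big_pred1_eq.
  rewrite -big_split; apply: eq_bigr => i _ /=; rewrite !mxE /=.
  have [->|iJ] := eqVneq i J.
    by rewrite hnu ?Jj // add0r mulr1 scale0r add0r; have [_ ->] := D2.
  rewrite mulr0 !addr0; case: (ltnP i j) => ij; last by rewrite hnu // !scale0r.
  by have [|_ ->] := D1 i; first by rewrite Jj.
have chain w mu : W' w -> 'D_mu (G \o eta) w = 'D_('D_mu eta w) G (eta w).
  move=> /W'BO[Bw [We _]].
  exact: (derive_chain mu (C1_differentiable oB (se 1%N) Bw) (local_diffeo_diffr LD We)).
have Wderiv z nu : W z -> 'D_nu G z = \sum_i nu 0 i *: 'D_(delta_mx 0 i) G z.
  by move=> Wz; exact: derive_partial_rV oW (sG 1%N) Wz.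
(* In the chart [F] the field of [g] is [nuF + C_J Y], where [nuF] has only components of index
   below [j]. *)
pose nuF z := Cz z - Cz z 0 J *: Y z.
have nuF0 z (i : 'I_n) : O z -> (j <= i)%N -> nuF z 0 i = 0.
  move=> [Wz /= nz] ij; rewrite !mxE ltnNge ij /= (Cz_Q z i) // (Cz_Q z J) ?Jj //.
  by rewrite mulrCA divff // mulr1 subrr.
(* Since [eta] carries each of the first [j] coordinate directions to itself, [X_(f_a)] keeps its
   components in the new chart. *)
have span_f a w : (a < j)%N -> W' w -> exists2 nu : 'rV[R]_n, (forall i : 'I_n, (j <= i)%N -> nu 0 i = 0) &
    ham Om (f a) (G (eta w)) = 'D_nu (G \o eta) w.
  move=> aj W'w; have [Bw [We _]] := W'BO w W'w; have [VG FG] := WG _ We.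
  exists ('D_(ham Om (f a) (G (eta w))) F (G (eta w))); first by move=> i ij; exact: fF.
  rewrite chain // -[X in 'D_X eta w]addr0 -(scale0r (delta_mx 0 J)) deriv_eta //; last by move=> i ij; exact: fF.
  by rewrite scale0r addr0 DFG.
have span_g w : W' w -> ham Om g (G (eta w)) = 'D_(nuF (eta w) + Cz (eta w) 0 J *: delta_mx 0 J) (G \o eta) w.
  move=> W'w; have [Bw Oe] := W'BO w W'w; have [We _] := Oe; have [VG FG] := WG _ We.
  rewrite chain // deriv_eta //; last by move=> i ij; exact: nuF0.
  by rewrite /nuF subrK /Cz /Cv DFG.
have fE a : (a < j)%N -> (if a == j then g else f a) = f a.
  by move=> aj; rewrite ltn_eqF.
have gE : (if j == j then g else f j) = g by rewrite eqxx.
exists (V `&` F @^-1` (A `&` theta @^-1` W')), (theta \o F), (G \o eta), e'; split => //.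
- by move=> x [/VV0].
- by rewrite /= eta0.
have SV : V `&` F @^-1` (A `&` theta @^-1` W') `<=` V by move=> x [].
split.
- move=> a; rewrite ltnS leq_eqVlt => /orP[/eqP ea|aj] k.
    by rewrite ea gE; exact: Ck_sub SV (sg k).
  by rewrite (fE a aj); exact: Ck_sub SV (sf a aj k).
- have skf (p q : 'rV[R]_n -> R^o) x : smooth_on V p -> smooth_on V q -> V x ->
      'D_(ham Om p x) q x = - 'D_(ham Om q x) p x.
    by move=> sp sq Vx; rewrite (ham_skew oV unV skV).
  move=> a b x aj bj /SV Vx; move: aj bj; rewrite !ltnS (leq_eqVlt a) (leq_eqVlt b).
  case/orP => [/eqP ea|aj]; case/orP => [/eqP eb|bj].
  + by rewrite ea eb gE; have := skf g g x sg sg Vx; lra.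
  + by rewrite ea gE (fE b bj) (skf g (f b) x sg (sf b bj) Vx) (fg b x bj Vx) oppr0.
  + by rewrite eb gE (fE a aj); exact: fg.
  + by rewrite (fE a aj) (fE b bj); exact: ff.
- have [_ _ _ _ [VF' WG']] := LD'.
  move=> a x i aj Vx ij; have [W'w Gw] := VF' x Vx.
  have Dm mu : 'D_('D_mu (G \o eta) ((theta \o F) x)) (theta \o F) x = mu.
    by have := local_diffeo_derive LD' mu W'w; rewrite Gw.
  move: aj; rewrite ltnS leq_eqVlt => /orP[/eqP ea|aj].
    rewrite ea gE; have := span_g _ W'w; rewrite -[G (eta _)]/((G \o eta) _) Gw => ->.
    have [_ Oe] := W'BO _ W'w; have iJ : i == J = false.
      by apply: contraTF ij => /eqP ->; rewrite Jj ltnn.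
    by rewrite Dm [LHS]mxE (nuF0 _ i Oe (ltnW ij)) add0r [LHS]mxE [delta_mx _ _ _ _]mxE iJ andbF mulr0.
  rewrite (fE a aj); have [nu hnu E] := span_f a _ aj W'w.
  by move: E; rewrite -[G (eta _)]/((G \o eta) _) Gw => ->; rewrite Dm hnu // ltnW.
move=> w b W'w; have [Bw Oe] := W'BO w W'w; have [We /= nz] := Oe; have [VG FG] := WG _ We.
have old (b' : 'I_n) : (b' < j)%N -> 'D_(delta_mx 0 b') eta w = delta_mx 0 b'.
  by move=> b'j; have [/(_ b')] := Deta w Bw; rewrite Jj => /(_ b'j)[_ ->].
have recr (c : nat -> R) c' : \sum_(a < j) c a *: ham Om (f a) (G (eta w)) + c' *: ham Om g (G (eta w)) =
   \sum_(a < j.+1) (if a == j :> nat then c' else c a) *: ham Om (if a == j :> nat then g else f a) ((G \o eta) w).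
  rewrite [RHS]big_ord_recr /= eqxx; congr (_ + _); apply: eq_bigr => a _.
  by rewrite ltn_eqF.
rewrite ltnS leq_eqVlt => /orP[/eqP bJ|bj]; last first.
  have [c hc] := cG _ b We bj; exists (fun a => if a == j then 0 else c a).
  by rewrite -recr scale0r addr0 chain // old.
have {}bJ : b = J by apply/val_inj; rewrite /= bJ Jj.
have /choice[c hc] : forall b' : 'I_n, exists c : nat -> R, (b' < j)%N ->
    'D_(delta_mx 0 b') G (eta w) = \sum_(a < j) c a *: ham Om (f a) (G (eta w)).
  move=> b'; case: (ltnP b' j) => b'j; last by exists (fun=> 0).
  by have [c hc] := cG _ b' We b'j; exists c.
have CJ : Cz (eta w) 0 J != 0 by rewrite Cz_Q ?Jj.
have E1 : 'D_(nuF (eta w)) G (eta w) = \sum_(a < j) (\sum_b' nuF (eta w) 0 b' * c b' a) *: ham Om (f a) (G (eta w)).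
  rewrite Wderiv //; under [RHS]eq_bigr do rewrite scaler_suml.
  rewrite exchange_big /=; apply: eq_bigr => b' _.
  case: (ltnP b' j) => b'j; last by rewrite nuF0 // scale0r big1 // => a _; rewrite mul0r scale0r.
  by rewrite hc // scaler_sumr; apply: eq_bigr => a _; rewrite scalerA.
(* The new axis is carried to [Y], which is [(X_g - nuF) / C_J]; by [E1], [nuF] lies in the span of
   the [X_(f_a)]. *)
have E2 : 'D_(delta_mx 0 b) (G \o eta) w = (Cz (eta w) 0 J)^-1 *: (ham Om g (G (eta w)) - 'D_(nuF (eta w)) G (eta w)).
  rewrite chain // bJ; have [_ [_ ->]] := Deta w Bw.
  have -> : ham Om g (G (eta w)) = 'D_(Cz (eta w)) G (eta w).
    by rewrite /Cz /Cv DFG.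
  have dG := local_diffeo_diffr LD We.
  rewrite !(deriveE _ dG) -linearB -linearZ /=; congr ('d G _ _).
  by rewrite /nuF opprB addrC subrK scalerA mulVf // scale1r.
exists (fun a => if a == j then (Cz (eta w) 0 J)^-1 else - ((Cz (eta w) 0 J)^-1 * \sum_b' nuF (eta w) 0 b' * c b' a)).
rewrite -(recr (fun a => - ((Cz (eta w) 0 J)^-1 * \sum_b' nuF (eta w) 0 b' * c b' a))) E2 E1 scalerBr addrC; congr (_ + _).
rewrite scaler_sumr -sumrN; apply: eq_bigr => a _.
by rewrite scalerA scaleNr.
Qed.

End Induction.
End Frames.

(** * Existence of adapted charts and isotropy of their slices *)

Section FrameExistence.
Context {R : realType}.

(** The last [n - j] rows of [P] are independent, and their entries vanish outside the first [j]
    columns, so [n - j <= j]. *)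
Lemma zero_block_bound n j (P : 'M[R]_n) : (j <= n)%N -> P \in unitmx ->
  (forall l i : 'I_n, (j <= l)%N -> (j <= i)%N -> P l i = 0) -> (n <= j + j)%N.
Proof.
move=> jn uP P0.
pose D : 'M[R]_n := copid_mx j.
have DE : D = diag_mx (\row_i (j <= i)%:R).
  apply/matrixP => a b; rewrite !mxE (inj_eq val_inj); have [->|_] := eqVneq a b.
    by rewrite /= mulr1n; case: leqP => _; rewrite ?subrr ?subr0.
  by rewrite /= mulr0n subr0.
have DPD : D *m P *m D = 0.
  rewrite DE mul_diag_mx mul_mx_diag; apply/matrixP => a b; rewrite !mxE.
  case: (leqP j a) => ja; last by rewrite !mul0r.
  by case: (leqP j b) => jb; rewrite ?mulr0 // P0 // mulr0 mul0r.
have rk : \rank (D *m P) = (n - j)%N.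
  by rewrite mxrankMfree ?row_free_unit // rank_copid_mx.
have E : D *m P = D *m P *m pid_mx j.
  by rewrite -[in RHS](subKr 1%:M (pid_mx j)) mulmxBr mulmx1 DPD subr0.
rewrite -leq_subLR -rk E (leq_trans (mxrankM_maxr _ _)) // rank_pid_mx //.
Qed.

Section Existence.
Context {n : nat} (Om : 'rV[R]_n -> 'M[R]_n) (V0 : set 'rV[R]_n) (x0 : 'rV[R]_n).
Hypotheses (oV0 : open V0) (Vx0 : V0 x0)
  (smO : forall i j, smooth_on V0 (fun x => Om x i j : R^o))
  (unO : forall x, V0 x -> Om x \in unitmx)
  (skO : forall x u v, V0 x -> bil Om x u v = - bil Om x v u)
  (clO : forall x (u v w : 'rV[R]_n), V0 x ->
    'D_u (fun y => bil Om y v w : R^o) x + 'D_v (fun y => bil Om y w u : R^o) x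
    + 'D_w (fun y => bil Om y u v : R^o) x = 0).

(** A transposition brings the nonzero component from index [i] to index [j], where
    [frame_state_step] expects it. *)
Lemma frame_state_extend j f V F G e g (i : 'I_n) :
  frame_state Om V0 x0 j f V F G e -> (j <= i)%N ->
  smooth_on V g -> (forall a x, (a < j)%N -> V x -> 'D_(ham Om (f a) x) g x = 0) ->
  ('D_(ham Om g x0) F x0) 0 i <> 0 ->
  exists V' F' G' e', frame_state Om V0 x0 j.+1 (fun a => if a == j then g else f a) V' F' G' e'.
Proof.
move=> st ji sg fg gi.
pose J := Ordinal (leq_ltn_trans ji (ltn_ord i)).
pose t (z : 'rV[R]_n) : 'rV[R]_n := \row_a z 0 (swap J i a).
have st' : frame_state Om V0 x0 j f V (t \o F) (G \o t) e by exact: (frame_state_swap st (leqnn j : (j <= J)%N) ji).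
have [LD e0 _ G0 _] := st.
have Vx : V x0.
  have [_ _ _ _ [_ WG]] := LD; rewrite -G0; case: (WG 0) => //=.
  by rewrite normr0.
have tl : linear t by move=> a u v; apply/rowP => b; rewrite !mxE.
have dF := local_diffeo_diffl LD Vx.
have dt : differentiable t (F x0).
  apply: (@C1_differentiable R _ _ setT); [exact: openT| |by []].
  by apply: Ck_linear => //; exact: openT.
have Dt : 'D_(ham Om g x0) (t \o F) x0 = t ('D_(ham Om g x0) F x0).
  by apply: etrans (derive_chain _ dF dt) _; exact: derive_linear.
apply: (frame_state_step smO unO skO clO st' (erefl : J = j :> nat) sg fg).
by rewrite Dt mxE /swap eqxx.
Qed.

Lemma frame_state_generator j f V F G e : frame_state Om V0 x0 j f V F G e -> (j + j < n)%N ->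
  exists l i : 'I_n, [/\ (j <= l)%N, (j <= i)%N &
    ('D_(ham Om (fun y => F y 0 l : R^o) x0) F x0) 0 i <> 0].
Proof.
move=> [LD e0 VV0 G0 _] jjn; have [oV oW sF sG [VF WG]] := LD.
have W0 : `|0 : 'rV[R]_n| < e by rewrite normr0.
have Vx : V x0 by rewrite -G0; case: (WG 0 W0).
apply: contrapT => no.
(* Jacobians acting on row vectors: ['D_u F] is [u *m J], and [K *m J = 1] is the chain rule for
   [F \o G], so [J] is invertible. *)
pose J : 'M[R]_n := \matrix_(i, l) ('D_(delta_mx 0 i) F x0) 0 l.
pose K : 'M[R]_n := \matrix_(i, l) ('D_(delta_mx 0 i) G 0) 0 l.
have DJ u : 'D_u F x0 = u *m J.
  rewrite (derive_partial_rV _ oV (sF 1%N) Vx); apply/rowP => l; rewrite summxE mxE.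
  by apply: eq_bigr => i _; rewrite !mxE.
have KJ : K *m J = 1%:M.
  apply/row_matrixP => b; rewrite row_mul.
  have -> : row b K = 'D_(delta_mx 0 b) G 0 by apply/rowP => l; rewrite !mxE.
  by rewrite -DJ -G0 (local_diffeo_derive LD _ W0) row1.
have [_ uJ] := mulmx1_unit KJ.
(* [P l i] is the Poisson bracket of the coordinates [F_l] and [F_i]. *)
pose P := J^T *m invmx (Om x0) *m J.
have uP : P \in unitmx by rewrite /P !unitmx_mul unitmx_tr uJ unitmx_inv unO.
have PE l i : P l i = ('D_(ham Om (fun y => F y 0 l : R^o) x0) F x0) 0 i.
  rewrite DJ /ham /P.
  have -> : grad (fun y => F y 0 l : R^o) x0 = row l J^T.
    by apply/rowP => a; rewrite !mxE (derive_coord _ _ (local_diffeo_diffl LD Vx)).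
  by rewrite -!row_mul [RHS]mxE.
have jn : (j <= n)%N by exact: leq_trans (leq_addr _ _) (ltnW jjn).
have := zero_block_bound jn uP; rewrite leqNgt jjn => H; apply: notF; apply: H => l i jl ji.
rewrite PE; apply: contrapT => ne; apply: no; by exists l, i.
Qed.

Lemma exists_frame (H : 'rV[R]_n -> R^o) v k : smooth_on V0 H -> 'D_v H x0 <> 0 ->
  (0 < k)%N -> (k + k <= n)%N ->
  exists f V F G e, frame_state Om V0 x0 k f V F G e /\ f 0%N = H.
Proof.
move=> sH dH; elim: k => // -[_ _ n2|k IH _ kn].
  (* A translation centred at [x0] is a valid chart for zero functions. Then [X_H] is nonzero at
     [x0] because [dH] is, and a nonzero component of it serves to add [H]. *)
  have [e e0 he] := (open_normP _).1 oV0 x0 Vx0.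
  pose V := [set x | `|x - x0| < e].
  pose F (x : 'rV[R]_n) := x - x0; pose G (z : 'rV[R]_n) := z + x0.
  have lid : linear (fun x : 'rV[R]_n => x) by [].
  have oV : open V.
    apply: (open_comp (f := F) (D := [set z | `|z| < e])); last exact: open_norm_lt.
    by move=> x _; apply: continuousB; [exact: id|exact: cst_continuous].
  have CF k (A : set 'rV[R]_n) c : open A -> Ck_on k A (fun x => x + c).
    by move=> oA; apply: Ck_D => //; [exact: Ck_linear|exact: Ck_cst].
  have LD : local_diffeo V [set z | `|z| < e] F G.
    split; [exact: oV|exact: open_norm_lt| | |].
    - by move=> k; exact: CF.
    - by move=> k; apply: CF; exact: open_norm_lt.
    - split; first by move=> x Vx; rewrite /G /F subrK.
      by move=> z Wz; rewrite /F /G /V /= addrK.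
  have st : frame_state Om V0 x0 0 (fun=> H) V F G e.
    split; [exact: LD|exact: e0|by move=> x; exact: he|by rewrite /G add0r|by split].
  have Vx : V x0 by rewrite /V /= subrr normr0.
  have DF u : 'D_u F x0 = u.
    rewrite /F deriveB; [|exact: derivable_id|exact: derivable_cst].
    by rewrite derive_id derive_cst subr0.
  have [i hi] : exists i, ham Om H x0 0 i <> 0.
    apply: contrapT => no; apply: dH.
    rewrite -(bil_ham oV0 unO v (sH 1%N) Vx0) (_ : ham Om H x0 = 0) ?/bil ?mul0mx ?mxE //.
    apply/rowP => i; rewrite [RHS]mxE; apply: contrapT => ne; apply: no; by exists i.
  have sV : V `<=` V0 by move=> x; exact: he.
  have [|//||V' [F' [G' [e' st']]]] := @frame_state_extend 0 (fun=> H) V F G e H i st (leq0n _).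
  - by move=> k; exact: Ck_sub sV (sH k).
  - by rewrite DF.
  by exists (fun a => if a == 0%N then H else H), V', F', G', e'.
have [//||f [V [F [G [e [st f0]]]]]] := IH.
  by apply: leq_trans kn; rewrite leq_add.
have [|l [i [kl ki ne]]] := frame_state_generator st.
  by apply: leq_trans kn; rewrite !(addSn, addnS).
have [LD e0 VV0 G0 [_ _ fF _]] := st; have [oV _ sF _ _] := LD.
have [||V' [F' [G' [e' st']]]] := frame_state_extend (g := fun y => F y 0 l : R^o) st ki _ _ ne.
- by move=> k'; apply: (Ck_coord _ _ oV).1; exact: sF.
- move=> a x ak Vx.
  by rewrite -(fF a x l ak Vx kl) (derive_coord _ _ (local_diffeo_diffl LD Vx)).
by exists (fun a => if a == k.+1 then (fun y => F y 0 l : R^o) else f a), V', F', G', e'.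
Qed.

Lemma frame_span j f V F G e z (u : 'rV[R]_n) : frame_state Om V0 x0 j f V F G e -> `|z| < e ->
  (forall i : 'I_n, (j <= i)%N -> u 0 i = 0) ->
  exists c : nat -> R, 'D_u G z = \sum_(a < j) c a *: ham Om (f a) (G z).
Proof.
move=> [LD e0 VV0 G0 [_ _ _ cG]] Wz u0; have [_ oW _ sG _] := LD.
have /choice[c hc] : forall b : 'I_n, exists c : nat -> R, (b < j)%N ->
    'D_(delta_mx 0 b) G z = \sum_(a < j) c a *: ham Om (f a) (G z).
  move=> b; case: (ltnP b j) => bj; last by exists (fun=> 0).
  by have [c hc] := cG z b Wz bj; exists c.
exists (fun a => \sum_b u 0 b * c b a).
rewrite (derive_partial_rV _ oW (sG 1%N) Wz); under [RHS]eq_bigr do rewrite scaler_suml.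
rewrite exchange_big /=; apply: eq_bigr => b _.
case: (ltnP b j) => bj; last by rewrite u0 // scale0r big1 // => a _; rewrite mul0r scale0r.
by rewrite hc // scaler_sumr; apply: eq_bigr => a _; rewrite scalerA.
Qed.

(** Bilinearity reduces the claim to [omega(X_(f_a), X_(f_b)) = X_(f_a) f_b], which vanishes by
    involution. *)
Lemma frame_isotropic j f V F G e z (u w : 'rV[R]_n) : frame_state Om V0 x0 j f V F G e -> `|z| < e ->
  (forall i : 'I_n, (j <= i)%N -> u 0 i = 0) -> (forall i : 'I_n, (j <= i)%N -> w 0 i = 0) ->
  bil Om (G z) ('D_u G z) ('D_w G z) = 0.
Proof.
move=> st Wz u0 w0; have [LD _ VV0 _ [sf ff _ _]] := st; have [oV _ _ _ [_ WG]] := LD.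
have [_ unV _ _] := bil_sub smO unO skO clO VV0.
have [VGz _] := WG z Wz.
have [c ->] := frame_span st Wz u0; have [c' ->] := frame_span st Wz w0.
rewrite /bil !mulmx_suml summxE big1 // => a _; rewrite -!scalemxAl mxE.
rewrite -[X in _ * X]/(bil Om (G z) (ham Om (f a) (G z)) _).
rewrite (bil_ham oV unV _ (sf a (ltn_ord a) 1%N) VGz).
have [df _] := partial_differentiable oV (sf a (ltn_ord a) 1%N) VGz.
rewrite (deriveE _ df) linear_sum big1 ?mulr0 // => b _.
by rewrite linearZ /= -(deriveE _ df) ff ?scaler0.
Qed.

End Existence.
End FrameExistence.

(** * Tangent vectors in charts *)

Section Charts.
Context {R : realType} {T : topologicalType} {n : nat}.
Implicit Types (c : chart R T n) (A : atlas R T n).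

(** The local part of [is_manifold], on which the calculus of tangent vectors rests; it passes to
    open submanifolds. *)
Definition compatible A := (forall c, A c -> is_chart c) /\
  (forall c c', A c -> A c' -> smooth_on (cmap c @` (cdom c `&` cdom c')) (cmap c' \o cinv c)).

Lemma chart_imageE c (O : set T) x : is_chart c ->
  (cmap c @` (cdom c `&` O)) x <-> (cmap c @` cdom c) x /\ O (cinv c x).
Proof.
move=> [_ _ cK _ _]; split.
  by move=> [p [cp Op] <-]; split; [exists p|rewrite cK].
by move=> [[p cp <-]]; rewrite cK // => Op; exists p.
Qed.

Lemma chart_invP c x : is_chart c -> (cmap c @` cdom c) x -> cdom c (cinv c x) /\ cmap c (cinv c x) = x.
Proof. by move=> [_ _ cK _ _] [p cp <-]; rewrite cK. Qed.

Lemma chart_open_image c O : is_chart c -> open O -> open (cmap c @` (cdom c `&` O)).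
Proof.
move=> hc oO; have [_ oc _ _ ci] := hc.
have -> : cmap c @` (cdom c `&` O) = (cmap c @` cdom c) `&` cinv c @^-1` O.
  by apply/seteqP; split => x /(chart_imageE O x hc).
exact: open_preimage_for.
Qed.

Lemma chart_open_preimage c W : is_chart c -> open W -> open (cdom c `&` cmap c @^-1` W).
Proof. by move=> [oc _ _ cc _] oW; exact: open_preimage_for. Qed.

Lemma smooth_near_chart A c p (f : T -> R) W : compatible A -> A c -> cdom c p ->
  open W -> W (cmap c p) -> W `<=` cmap c @` cdom c -> smooth_on W (f \o cinv c : _ -> R^o) ->
  smooth_near A p f.
Proof.
move=> [Ac AA] hc cp oW Wp WD sf; have cc := Ac _ hc.
exists (cdom c `&` cmap c @^-1` W); split; [exact: chart_open_preimage|by split|].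
move=> c' hc' k; have cc' := Ac _ hc'.
set O := cmap c' @` _.
have oO : open O by apply: chart_open_image => //; exact: chart_open_preimage.
have [_ _ cK _ _] := cc; have [_ _ cK' _ _] := cc'.
apply: (@Ck_ext _ _ _ _ O ((f \o cinv c) \o (cmap c \o cinv c') : _ -> R^o)) => //.
  by move=> _ [q [c'q [cq _]] <-] /=; rewrite cK' // cK.
apply: (@Ck_comp _ _ _ k O W (cmap c \o cinv c') (f \o cinv c : _ -> R^o)) => //.
- by move=> _ [q [c'q [_ Wq]] <-] /=; rewrite cK'.
- apply: Ck_sub (AA _ _ hc' hc k); move=> _ [q [c'q [cq _]] <-].
  by exists q.
Qed.

Lemma smooth_nearP A c p (f : T -> R) : compatible A -> A c -> cdom c p -> smooth_near A p f ->
  exists W, [/\ open W, W (cmap c p), W `<=` cmap c @` cdom c & smooth_on W (f \o cinv c : _ -> R^o)].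
Proof.
move=> [Ac AA] hc cp [V [oV Vp sf]]; have cc := Ac _ hc.
exists (cmap c @` (cdom c `&` V)); split; [exact: chart_open_image|by exists p| |exact: sf].
by move=> _ [q [cq _] <-]; exists q.
Qed.

Lemma smooth_near_diff A c p (f : T -> R) : compatible A -> A c -> cdom c p -> smooth_near A p f ->
  differentiable (f \o cinv c : _ -> R^o) (cmap c p).
Proof.
move=> cA hc cp sf; have [W [oW Wp _ sW]] := smooth_nearP cA hc cp sf.
by have [] := partial_differentiable oW (sW 1%N) Wp.
Qed.

Lemma coord_tvecE A c v p f : smooth_near A p f ->
  coord_tvec A c v p f = 'D_v (f \o cinv c : _ -> R^o) (cmap c p).
Proof. by move=> sf; rewrite /coord_tvec asboolT. Qed.

Lemma coord_tvec_out A c v p f : ~ smooth_near A p f -> coord_tvec A c v p f = 0.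
Proof. by move=> sf; rewrite /coord_tvec asboolF. Qed.

Lemma coord_tvec_linear A c p a v w : compatible A -> A c -> cdom c p ->
  coord_tvec A c (a *: v + w) p = (fun f => a * coord_tvec A c v p f + coord_tvec A c w p f).
Proof.
move=> cA hc cp; apply/funext => f.
have [sf|nf] := pselect (smooth_near A p f); last by rewrite !coord_tvec_out // mulr0 addr0.
rewrite !coord_tvecE //; have df := smooth_near_diff cA hc cp sf.
by rewrite !(deriveE _ df) linearP.
Qed.

Lemma coord_tvec0 A c p : compatible A -> A c -> cdom c p -> coord_tvec A c 0 p = fun=> 0.
Proof.
move=> cA hc cp; apply/funext => f.
have [sf|nf] := pselect (smooth_near A p f); last by rewrite coord_tvec_out.
by rewrite coord_tvecE // deriveE ?linear0 //; exact: smooth_near_diff cA hc cp sf.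
Qed.

(** The two operators are compared on the coordinate functions of [c], which are smooth near [p] and
    return the components. *)
Lemma coord_tvec_inj A c p v w : compatible A -> A c -> cdom c p ->
  coord_tvec A c v p = coord_tvec A c w p -> v = w.
Proof.
move=> cA hc cp E; have cc := cA.1 _ hc; have [_ oc _ _ _] := cc.
have cmp : (cmap c @` cdom c) (cmap c p) by exists p.
apply/rowP => i; pose f q := cmap c q 0 i.
have fE x : (cmap c @` cdom c) x -> (f \o cinv c) x = x 0 i.
  by move=> Dx; rewrite /f /=; have [_ ->] := chart_invP cc Dx.
have sf : smooth_near A p f.
  apply: (smooth_near_chart cA hc cp oc cmp) => // k.
  exact: (@Ck_ext _ _ _ _ _ (fun x => x 0 i : R^o) _ oc (fun x Dx => esym (fE x Dx)) (Ck_proj _ _ _)).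
have D u : 'D_u (f \o cinv c : _ -> R^o) (cmap c p) = u 0 i.
  have -> : 'D_u (f \o cinv c : _ -> R^o) (cmap c p) = 'D_u (fun x : 'rV[R]_n => x 0 i : R^o) (cmap c p).
    apply: near_eq_derive; have : nbhs (cmap c p) (cmap c @` cdom c) by exact: open_nbhs_nbhs.
    by apply: filterS => y; exact: fE.
  by rewrite -(derive_coord (f := id)) ?derive_id.
by have := congr1 (fun u => u f) E; rewrite !coord_tvecE // !D.
Qed.

End Charts.

(** * Tangent maps in coordinates *)

Section Push.
Context {R : realType} {T1 T2 : topologicalType} {n1 n2 : nat}.

Section Representative.
Context (A : atlas R T1 n1) (B : atlas R T2 n2) (F : T1 -> T2) (c : chart R T1 n1)
  (c' : chart R T2 n2) (p : T1) (W : set 'rV[R]_n1).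
Hypotheses (cA : compatible A) (cB : compatible B) (hc : A c) (hc' : B c') (cp : cdom c p)
  (oW : open W) (Wp : W (cmap c p)) (WD : W `<=` cmap c @` cdom c)
  (Wc' : forall x, W x -> cdom c' (F (cinv c x)))
  (sF : smooth_on W (cmap c' \o F \o cinv c)).

Let h := cmap c' \o F \o cinv c.

(** In the chart [c], [g \o F] is the expression of [g] in [c'] composed with [h], on the open part
    of [W] that [h] maps to points where that expression is smooth. *)
Lemma representative_pull g : smooth_near B (F p) g ->
  [/\ smooth_near A p (g \o F), differentiable (g \o cinv c' : _ -> R^o) (h (cmap c p)) &
    \forall x \near cmap c p, ((g \o cinv c') \o h) x = ((g \o F) \o cinv c) x].
Proof.
move=> sg; have [_ _ cK _ _] := cA.1 _ hc; have [_ _ cK' _ _] := cB.1 _ hc'.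
have c'Fp : cdom c' (F p) by have := Wc' Wp; rewrite cK.
have [Z [oZ Zp ZD sZ]] := smooth_nearP cB hc' c'Fp sg.
have hp : h (cmap c p) = cmap c' (F p) by rewrite /h /= cK.
have ch x : W x -> {for x, continuous h}.
  by move=> Wx; have C := Ck_cont (sF 0%N) Wx; exact: C.
have oW' : open (W `&` h @^-1` Z) by exact: open_preimage_for.
have W'p : (W `&` h @^-1` Z) (cmap c p) by split => //=; rewrite hp.
have E x : (W `&` h @^-1` Z) x -> ((g \o cinv c') \o h) x = ((g \o F) \o cinv c) x.
  by move=> [Wx _] /=; rewrite /h /= cK' //; exact: Wc'.
split.
- apply: (smooth_near_chart cA hc cp oW' W'p) => [x [/WD]|k]//.
  apply: (@Ck_ext _ _ _ _ _ ((g \o cinv c') \o h : _ -> R^o) _ oW' E).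
  apply: (@Ck_comp _ _ _ k _ Z h (g \o cinv c' : _ -> R^o) oW' oZ) => //; first by move=> x [].
  by apply: Ck_sub (sF k) => x [].
- by rewrite hp; exact: smooth_near_diff cB hc' c'Fp sg.
- have : nbhs (cmap c p) (W `&` h @^-1` Z) by exact: open_nbhs_nbhs.
  by apply: filterS => y /E.
Qed.

Lemma push_coord v :
  push B F p (coord_tvec A c v p) = coord_tvec B c' ('D_v h (cmap c p)) (F p).
Proof.
have [_ _ cK _ _] := cA.1 _ hc; apply/funext => g; rewrite /push.
(* On functions that are not smooth near [F p], both sides have the default value 0. *)
case: asboolP => [sg|ng]; last by rewrite coord_tvec_out.
have [sgF dg E] := representative_pull sg.
rewrite (coord_tvecE _ _ sgF) (coord_tvecE _ _ sg).
have -> : 'D_v (g \o F \o cinv c : _ -> R^o) (cmap c p) = 'D_v ((g \o cinv c') \o h : _ -> R^o) (cmap c p).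
  by apply: near_eq_derive; apply: filterS E => y ->.
have dh := C1_differentiable oW (sF 1%N) Wp.
by apply: etrans (derive_chain v dh dg) _; rewrite /h /= cK.
Qed.

End Representative.
End Push.

(** * Open submanifolds *)

Section Restriction.
Context {R : realType} {T : topologicalType} {n : nat}.
Implicit Types (c : chart R T n) (A : atlas R T n).

Lemma compatible_restr A (U : set T) : open U -> compatible A -> compatible (restr A U).
Proof.
move=> oU [Ac AA]; split.
  move=> _ [c hc <-]; have cc := Ac _ hc; have [oc oD cK cm ci] := cc.
  split => /=; [exact: openI|exact: chart_open_image| | |].
  - by move=> p [cp _]; exact: cK.
  - by move=> p [cp _]; exact: cm.
  - by move=> x [p [cp _] px]; apply: ci; exists p.
move=> _ _ [c hc <-] [c' hc' <-] k; apply: Ck_sub (AA _ _ hc hc' k).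
by move=> _ [p [[cp _] [c'p _]] <-]; exists p.
Qed.

Lemma carrier_restr A (U : set T) : carrier (restr A U) = carrier A `&` U.
Proof.
apply/seteqP; split => p.
  by move=> [_ [c hc <-] [cp Up]]; split => //; exists c.
by move=> [[c hc cp] Up]; exists (restr_chart c U) => //; exists c.
Qed.

Lemma smooth_near_restr A (U : set T) p f : open U -> U p ->
  smooth_near (restr A U) p f <-> smooth_near A p f.
Proof.
move=> oU Up; split => -[V [oV Vp sf]].
  exists (V `&` U); split; [exact: openI|by []|].
  move=> c hc k; have h : restr A U (restr_chart c U) by exists c.
  apply: Ck_sub (sf _ h k) => _ [q [cq [Vq Uq]] <-].
  by exists q.
exists V; split => // _ [c hc <-] k; apply: Ck_sub (sf _ hc k).
by move=> _ [q [[cq _] Vq] <-]; exists q.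
Qed.

Lemma coord_tvec_restr A (U : set T) c v p : open U -> U p ->
  coord_tvec (restr A U) (restr_chart c U) v p = coord_tvec A c v p.
Proof.
move=> oU Up; apply/funext => f; rewrite /coord_tvec.
by congr (if _ then _ else _); apply: asbool_equiv_eq; exact: smooth_near_restr.
Qed.

Lemma tangent_restr A (U : set T) p : open U -> U p -> tangent (restr A U) p = tangent A p.
Proof.
move=> oU Up; apply/funext => u; apply/propext; split.
  move=> [_ [v [[c hc <-] [cp _] ->]]]; exists c, v; split => //.
  exact: coord_tvec_restr.
move=> [c [v [hc cp ->]]]; exists (restr_chart c U), v; split; [by exists c|by []|].
by rewrite coord_tvec_restr.
Qed.

Lemma ham_vf_restr A omega H (U : set T) p : open U -> U p ->
  ham_vf (restr A U) omega H p = ham_vf A omega H p.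
Proof. by move=> oU Up; rewrite /ham_vf tangent_restr. Qed.

End Restriction.

(** * The symplectic form and Hamiltonian fields in a chart *)

Section SymplecticCharts.
Context {R : realType} {T : topologicalType} {n : nat} (A : atlas R T n)
  (omega : T -> tvec R T -> tvec R T -> R).
Hypotheses (cA : compatible A) (so : symplectic_form A omega).

Lemma linear_coord (f : 'rV[R]_n -> R) : (forall a u v, f (a *: u + v) = a * f u + f v) ->
  forall v, f v = \sum_i v 0 i * f (delta_mx 0 i).
Proof.
move=> lf v; have f0 : f 0 = 0.
  by have := lf 1 0 0; rewrite scaler0 addr0 mul1r => /esym/eqP; rewrite -subr_eq0 addrK => /eqP.
rewrite {1}(row_sum_coord v); apply: (big_ind2 (fun x y => f x = y)) => //.
  by move=> x1 y1 x2 y2 h1 h2; rewrite -[x1]scale1r lf h1 h2 mul1r.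
by move=> i _; rewrite -[_ *: _]addr0 lf f0 addr0.
Qed.

Definition form_mx (c : chart R T n) x : 'M[R]_n :=
  \matrix_(i, j) form_coord A omega c (delta_mx 0 i) (delta_mx 0 j) x.

Lemma tangent_coord c p v : A c -> cdom c p -> tangent A p (coord_tvec A c v p).
Proof. by move=> hc cp; exists c, v. Qed.

Lemma carrier_chart c p : A c -> cdom c p -> carrier A p.
Proof. by move=> hc cp; exists c. Qed.

(** A two-form is given as linear in its first argument; skew-symmetry transfers this to the second,
    and the matrix determines the rest. *)
Lemma form_bil c p v w : A c -> cdom c p ->
  omega p (coord_tvec A c v p) (coord_tvec A c w p) = bil (form_mx c) (cmap c p) v w.
Proof.
move=> hc cp; have [[lin sk _] _ _] := so; have cc := cA.1 _ hc; have [_ _ cK _ _] := cc.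
have Ap := carrier_chart hc cp; have tc v' := tangent_coord v' hc cp.
have l1 w' a u v' : omega p (coord_tvec A c (a *: u + v') p) (coord_tvec A c w' p) =
   a * omega p (coord_tvec A c u p) (coord_tvec A c w' p) + omega p (coord_tvec A c v' p) (coord_tvec A c w' p).
  by rewrite coord_tvec_linear // lin.
have l2 u w' : omega p (coord_tvec A c u p) (coord_tvec A c w' p) =
    \sum_j w' 0 j * omega p (coord_tvec A c u p) (coord_tvec A c (delta_mx 0 j) p).
  rewrite (sk _ _ _ Ap (tc u) (tc w')) [X in - X](linear_coord (l1 u) w') -sumrN.
  by apply: eq_bigr => j _; rewrite -mulrN -(sk _ _ _ Ap (tc u) (tc _)).
rewrite (linear_coord (l1 w) v) bilE exchange_big /=; apply: eq_bigr => i _.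
rewrite l2 mulr_sumr; apply: eq_bigr => j _.
rewrite mulrA mulrAC; congr (_ * _ * _).
by rewrite mxE /form_coord cK.
Qed.

Lemma form_coord_bil c v w x : A c -> (cmap c @` cdom c) x ->
  form_coord A omega c v w x = bil (form_mx c) x v w.
Proof.
move=> hc Dx; have [cp px] := chart_invP (cA.1 _ hc) Dx.
by rewrite /form_coord (form_bil v w hc cp) px.
Qed.

Lemma form_mx_smooth c i j : A c -> smooth_on (cmap c @` cdom c) (fun x => form_mx c x i j : R^o).
Proof.
move=> hc k; have [[_ _ sm] _ _] := so; have [_ oD _ _ _] := cA.1 _ hc.
by apply: Ck_ext (sm c (delta_mx 0 i) (delta_mx 0 j) hc k) => // x _; rewrite mxE.
Qed.

Lemma form_mx_unit c x : A c -> (cmap c @` cdom c) x -> form_mx c x \in unitmx.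
Proof.
move=> hc Dx; have [_ _ nd] := so; have [cp px] := chart_invP (cA.1 _ hc) Dx.
rewrite unitmxE unitfE; apply/negP => /det0P[v /eqP v0 vO]; apply: v0.
apply: (coord_tvec_inj cA hc cp); rewrite (coord_tvec0 cA hc cp).
apply: (nd _ _ (carrier_chart hc cp) (tangent_coord v hc cp)) => w [c' [w' [hc' c'p ->]]].
(* The test vector comes in an arbitrary chart [c']; written as its own push along the identity, it
   can be read in [c]. *)
have -> : coord_tvec A c' w' (cinv c x) = push A id (cinv c x) (coord_tvec A c' w' (cinv c x)).
  apply/funext => g; rewrite /push; case: asboolP => // ng.
  by rewrite coord_tvec_out.
have cc := cA.1 _ hc; have cc' := cA.1 _ hc'; have [oc _ _ _ _] := cc.
have [_ _ cK' _ _] := cc'.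
rewrite (push_coord (c' := c) cA cA hc' hc c'p (chart_open_image cc' oc)).
- by rewrite form_bil // px /bil vO mul0mx mxE.
- by exists (cinv c x).
- by move=> _ [q [c'q _] <-]; exists q.
- by move=> _ [q [c'q cq] <-]; rewrite cK'.
- exact: cA.2.
Qed.

(** A change of chart is the push along the identity, whose representative is the transition map. *)
Lemma tangentP c p u : A c -> cdom c p -> tangent A p u -> exists v, u = coord_tvec A c v p.
Proof.
move=> hc cp [c' [v [hc' c'p ->]]].
have cc := cA.1 _ hc; have cc' := cA.1 _ hc'; have [oc _ _ _ _] := cc.
have [_ _ cK' _ _] := cc'.
have E : coord_tvec A c' v p = push A id p (coord_tvec A c' v p).
  apply/funext => g; rewrite /push; case: asboolP => // ng.
  by rewrite coord_tvec_out.
exists ('D_v (cmap c \o id \o cinv c') (cmap c' p)); rewrite E.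
apply: (push_coord cA cA hc' hc c'p (chart_open_image cc' oc)).
- by exists p.
- by move=> _ [q [c'q _] <-]; exists q.
- by move=> _ [q [c'q cq] <-]; rewrite cK'.
- exact: cA.2.
Qed.

Lemma form_mx_skew c x u v : A c -> (cmap c @` cdom c) x ->
  bil (form_mx c) x u v = - bil (form_mx c) x v u.
Proof.
move=> hc Dx; have [[_ sk _] _ _] := so; have [cp px] := chart_invP (cA.1 _ hc) Dx.
rewrite -px -!form_bil // sk //; [exact: carrier_chart hc cp|exact: tangent_coord|exact: tangent_coord].
Qed.

Lemma form_mx_closed c x (u v w : 'rV[R]_n) : A c -> (cmap c @` cdom c) x ->
  'D_u (fun y => bil (form_mx c) y v w : R^o) x + 'D_v (fun y => bil (form_mx c) y w u : R^o) x
  + 'D_w (fun y => bil (form_mx c) y u v : R^o) x = 0.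
Proof.
move=> hc Dx; have [_ cl _] := so; have [_ oD _ _ _] := cA.1 _ hc.
have E u1 v1 w1 : 'D_u1 (fun y => bil (form_mx c) y v1 w1 : R^o) x = 'D_u1 (form_coord A omega c v1 w1) x.
  apply: near_eq_derive; have : nbhs x (cmap c @` cdom c) by exact: open_nbhs_nbhs.
  by apply: filterS => y Dy; rewrite form_coord_bil.
by rewrite !E; exact: cl.
Qed.

Lemma smooth_fun_near c p (f : T -> R) : A c -> cdom c p -> smooth_fun A (carrier A) f ->
  smooth_near A p f.
Proof.
move=> hc cp sf; exists (carrier A); split; [|exact: carrier_chart hc cp|exact: sf].
by apply: bigcup_open => c' /(cA.1 _)[].
Qed.

Lemma smooth_fun_coord c (f : T -> R) : A c -> smooth_fun A (carrier A) f ->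
  smooth_on (cmap c @` cdom c) (f \o cinv c : _ -> R^o).
Proof.
move=> hc sf k; apply: Ck_sub (sf c hc k) => _ [q cq <-].
by exists q => //; split => //; exact: carrier_chart hc cq.
Qed.

Lemma ham_spec c p (f : T -> R) v : A c -> cdom c p -> smooth_fun A (carrier A) f ->
  tangent A p v ->
  omega p (coord_tvec A c (ham (form_mx c) (f \o cinv c : _ -> R^o) (cmap c p)) p) v = v f.
Proof.
move=> hc cp sf /(tangentP hc cp)[v' ->]; have [_ oD _ _ _] := cA.1 _ hc.
have Dp : (cmap c @` cdom c) (cmap c p) by exists p.
rewrite (form_bil _ _ hc cp) (coord_tvecE _ _ (smooth_fun_near hc cp sf)).
exact: (bil_ham oD (fun x Dx => form_mx_unit hc Dx) v' (smooth_fun_coord hc sf 1%N) Dp).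
Qed.

(** Invertibility of the matrix makes the defining equation uniquely solvable, so the choice made in
    [ham_vf] is the coordinate formula. *)
Lemma ham_vf_coord c p (f : T -> R) : A c -> cdom c p -> smooth_fun A (carrier A) f ->
  ham_vf A omega f p = coord_tvec A c (ham (form_mx c) (f \o cinv c : _ -> R^o) (cmap c p)) p.
Proof.
move=> hc cp sf; have Dp : (cmap c @` cdom c) (cmap c p) by exists p.
apply: xget_unique; first by split; [exact: tangent_coord|move=> v; exact: ham_spec].
move=> u [/(tangentP hc cp)[u' ->] hu]; congr (coord_tvec A c _ p).
apply/subr0_eq; apply: (@bil_eq0 _ _ (form_mx c) _ (fun x Dx => form_mx_unit hc Dx) (cmap c p) _ Dp) => v.
have tv := tangent_coord v hc cp.
by rewrite bilBl -!(form_bil _ _ hc cp) (hu _ tv) (ham_spec hc cp sf tv) subrr.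
Qed.

Lemma ham_vfP c p (f : T -> R) v : A c -> cdom c p -> smooth_fun A (carrier A) f ->
  tangent A p v -> omega p (ham_vf A omega f p) v = v f.
Proof. by move=> hc cp sf tv; rewrite (ham_vf_coord hc cp sf) ham_spec. Qed.

End SymplecticCharts.

(** * The complete solution *)

Section EuclideanPieces.
Context {R : realType}.

(** For the sup norm a ball is a product of balls, so the domain of [G] splits into a base ball and
    a parameter ball of the same radius. *)
Lemma norm_row_mx_lt k l (y : 'rV[R]_k) (z : 'rV[R]_l) e : 0 < e ->
  `|row_mx y z| < e <-> `|y| < e /\ `|z| < e.
Proof.
move=> e0; split.
  move=> h; split; apply: rVnorm_lt => // i; apply: le_lt_trans h.
    by rewrite -(row_mxEl y z) rVnorm_coord.
  by rewrite -(row_mxEr y z) rVnorm_coord.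
move=> [hy hz]; apply: rVnorm_lt => // i; case: (split_ordP i) => j ->.
  by rewrite row_mxEl (le_lt_trans (rVnorm_coord _ _)).
by rewrite row_mxEr (le_lt_trans (rVnorm_coord _ _)).
Qed.

Lemma norm_castmx m n (h : m = n) (x : 'rV[R]_m) : `|castmx (erefl 1%N, h) x| = `|x|.
Proof. by subst n; rewrite castmx_id. Qed.

Lemma castmx_linear m n (h : m = n) : linear (fun x : 'rV[R]_m => castmx (erefl 1%N, h) x).
Proof. by subst n => a u v; rewrite !castmx_id. Qed.

Lemma rV_second_countable n : exists2 B : set (set 'rV[R]_n), countable B &
  (forall O, B O -> open O) /\
  forall p V, open V -> V p -> exists O, [/\ B O, O p & O `<=` V].
Proof.
pose b (q : 'rV[rat]_n * rat) := [set x : 'rV[R]_n | `|x - map_mx ratr q.1| < ratr q.2].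
exists (range b); first exact: (sub_countable (card_image_le b setT) (countableP _)).
split.
  move=> _ [q _ <-].
  apply: (open_comp (f := fun x : 'rV[R]_n => x - map_mx ratr q.1) (D := [set z | `|z| < ratr q.2])).
    by move=> x _; apply: continuousB; [exact: id|exact: cst_continuous].
  exact: open_norm_lt.
move=> p V /open_normP oV /oV[d d0 dV].
(* A radius below [d / 2] keeps every point of a ball containing [p] within [d] of [p]. *)
have [r rd] : exists r : rat, 0 < (ratr r : R) < d / 2.
  have /rat_in_itvoo[r] : 0 < d / 2 by rewrite divr_gt0.
  by rewrite in_itv /= => h; exists r.
have [r0 rd2] := andP rd.
have /choice[q hq] : forall i : 'I_n, exists q : rat, `|p 0 i - ratr q| < ratr r.
  move=> i; have /rat_in_itvoo[q] : p 0 i - ratr r < p 0 i + ratr r.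
    by rewrite ltrBlDr -addrA ltrDl addr_gt0.
  by rewrite in_itv /= => /andP[h1 h2]; exists q; rewrite ltr_norml ltrBrDr; apply/andP; split; lra.
exists (b (\row_i q i, r)); split.
- by exists (\row_i q i, r).
- by apply: rVnorm_lt => // i; rewrite !mxE.
- have hp : `|p - map_mx ratr (\row_i q i)| < ratr r by apply: rVnorm_lt => // i; rewrite !mxE.
  move=> x; rewrite /b /= => hx; apply: dV.
  rewrite (_ : x - p = (x - map_mx ratr (\row_i q i)) - (p - map_mx ratr (\row_i q i))); last first.
    by rewrite opprB addrA subrK.
  by apply: le_lt_trans (ler_normB _ _) _; lra.
Qed.

Lemma image_id_setI n (A : set 'rV[R]_n) : id @` (setT `&` A) = A.
Proof. by rewrite setTI image_id. Qed.

Lemma euclid_compatible n : compatible (euclid R n).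
Proof.
split.
  move=> _ ->; split => /=; [exact: openT|by rewrite image_id; exact: openT|by []| |].
    by move=> p _; exact: id.
  by move=> p _; exact: id.
move=> _ _ -> -> k; apply: Ck_linear => //=.
by rewrite image_id_setI; exact: openT.
Qed.

Lemma euclid_manifold n (Q : set 'rV[R]_n) : open Q -> is_manifold (restr (euclid R n) Q).
Proof.
move=> oQ; have [h1 h2] := compatible_restr oQ (euclid_compatible n).
split; [exact: h1|exact: h2| |].
  move=> p q _ _ pq; pose r := `|p - q| / 2.
  have r0 : 0 < r by rewrite divr_gt0 // normr_gt0 subr_eq0; exact/eqP.
  have oB (a : 'rV[R]_n) : open [set x | `|x - a| < r].
    apply: (open_comp (f := fun x : 'rV[R]_n => x - a) (D := [set z | `|z| < r])); last exact: open_norm_lt.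
    by move=> x _; apply: continuousB; [exact: id|exact: cst_continuous].
  exists [set x | `|x - p| < r], [set x | `|x - q| < r]; split.
  - exact: oB.
  - exact: oB.
  - by rewrite /= subrr normr0.
  - by rewrite /= subrr normr0.
  - rewrite -subset0 => x [/= xp xq].
    have : `|p - q| <= `|x - p| + `|x - q| by rewrite distrC; apply: le_trans (ler_distD x _ _) _; rewrite (distrC q) addrC.
    rewrite (_ : `|p - q| = 2 * r); last by rewrite /r mulrC divfK.
    lra.
have [B cB [oB hB]] := rV_second_countable n.
by exists B => //; split => // p V _; exact: hB.
Qed.

Section Product.
Context {k l : nat} (P : set 'rV[R]_k) (Q : set 'rV[R]_l).
Hypotheses (oP : open P) (oQ : open Q).

Let cP := restr_chart (Chart (@setT 'rV[R]_k) id id) P.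
Let cQ := restr_chart (Chart (@setT 'rV[R]_l) id id) Q.

(** Each factor is an open piece of a Euclidean space with a single chart, so this is the only chart
    of the product atlas. *)
Definition product_chart : chart R ('rV[R]_k * 'rV[R]_l)%type (k + l) := prod_chart cP cQ.

Lemma product_atlas c :
  prod_atlas (restr (euclid R k) P) (restr (euclid R l) Q) c <-> c = product_chart.
Proof.
split; first by move=> [_ [_ [[_ -> <-] [_ -> <-] ->]]].
by move=> ->; exists cP, cQ; split => //; [exists (Chart setT id id)|exists (Chart setT id id)].
Qed.

Lemma product_chart_dom z : cdom product_chart z <-> P z.1 /\ Q z.2.
Proof. by split=> [[[_ ?] [_ ?]]|[? ?]]. Qed.

Lemma product_chart_image :
  cmap product_chart @` cdom product_chart = lsubmx @^-1` P `&` rsubmx @^-1` Q.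
Proof.
apply/seteqP; split=> x.
  by move=> [z [[_ Pz] [_ Qz]] <-]; split; rewrite /= ?row_mxKl ?row_mxKr.
move=> [Px Qx]; exists (lsubmx x, rsubmx x); first by split; split.
exact: hsubmxK.
Qed.

Lemma product_compatible :
  compatible (prod_atlas (restr (euclid R k) P) (restr (euclid R l) Q)).
Proof.
have cl (x : 'rV[R]_(k + l)) : {for x, continuous (lsubmx : 'rV[R]_(k + l) -> 'rV[R]_k)}.
  by have C := Ck_cont (@Ck_lsubmx R k l 0%N _ (@openT _)) (I : setT x); exact: C.
have cr (x : 'rV[R]_(k + l)) : {for x, continuous (rsubmx : 'rV[R]_(k + l) -> 'rV[R]_l)}.
  by have C := Ck_cont (@Ck_rsubmx R k l 0%N _ (@openT _)) (I : setT x); exact: C.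
have oI : open (cmap product_chart @` cdom product_chart).
  rewrite product_chart_image; apply: openI.
    by have := open_preimage_for (@openT _) oP (fun x _ => cl x); rewrite setTI; exact.
  by have := open_preimage_for (@openT _) oQ (fun x _ => cr x); rewrite setTI; exact.
split.
  move=> _ /product_atlas ->; split; [|exact: oI| | |].
  - have -> : cdom product_chart = (setT `&` fst @^-1` P) `&` (setT `&` snd @^-1` Q).
      by apply/seteqP; split=> z; [move=> [[_ ?] [_ ?]]|move=> [[_ ?] [_ ?]]].
    apply: openI; [apply: (open_preimage_for openT oP)|apply: (open_preimage_for openT oQ)] => z _.
      exact: cvg_fst.
    exact: cvg_snd.
  - by move=> [y z] _ /=; rewrite row_mxKl row_mxKr.
  - move=> z _; apply/continuous_rV => i; case: (split_ordP i) => j ->.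
      have -> : (fun y => cmap product_chart y 0 (lshift l j) : R^o) =
          (fun x : 'rV[R]_k => x 0 j : R^o) \o fst.
        by apply/funext => y; rewrite /= row_mxEl.
      by apply: continuous_comp; [exact: cvg_fst|exact: coord_continuous].
    have -> : (fun y => cmap product_chart y 0 (rshift k j) : R^o) =
        (fun x : 'rV[R]_l => x 0 j : R^o) \o snd.
      by apply/funext => y; rewrite /= row_mxEr.
    by apply: continuous_comp; [exact: cvg_snd|exact: coord_continuous].
  - by move=> x _; exact: (cvg_pair (cl x) (cr x)).
move=> _ _ /product_atlas -> /product_atlas -> j; rewrite setIid.
apply: (@Ck_ext _ _ _ _ _ id _ oI); last by apply: Ck_linear.
by move=> x _ /=; rewrite hsubmxK.
Qed.

End Product.

End EuclideanPieces.

(** * Smooth maps given in one chart *)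

Section SmoothThroughChart.
Context {R : realType} {T : topologicalType} {n : nat} (A : atlas R T n).
Hypothesis cA : compatible A.

Lemma smooth_from_chart m c0 c1 (V : set 'rV[R]_n) (g : 'rV[R]_n -> 'rV[R]_m) :
  A c0 -> A c1 -> open V -> smooth_on V g ->
  smooth_on (cmap c1 @` (cdom c1 `&` (cdom c0 `&` cmap c0 @^-1` V))) (g \o cmap c0 \o cinv c1).
Proof.
move=> h0 h1 oV sg k; have cc0 := cA.1 _ h0; have cc1 := cA.1 _ h1.
have [_ _ cK1 _ _] := cc1.
set O := cmap c1 @` _; have oO : open O by exact: chart_open_image cc1 (chart_open_preimage cc0 oV).
have OV x : O x -> V (cmap c0 (cinv c1 x)).
  by move=> [p [c1p [_ Vp]] <-]; rewrite cK1.
have sub : O `<=` cmap c1 @` (cdom c1 `&` cdom c0).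
  by move=> _ [p [c1p [c0p _]] <-]; exists p.
exact: (Ck_comp_rV oO oV OV (Ck_sub sub (cA.2 _ _ h1 h0 k)) (sg k)).
Qed.

Lemma smooth_to_chart m c0 c1 (B : set 'rV[R]_m) (g : 'rV[R]_m -> 'rV[R]_n) :
  A c0 -> A c1 -> open B -> smooth_on B g -> (forall x, B x -> (cmap c0 @` cdom c0) (g x)) ->
  open (B `&` g @^-1` (cmap c0 @` (cdom c0 `&` cdom c1))) /\
  smooth_on (B `&` g @^-1` (cmap c0 @` (cdom c0 `&` cdom c1))) (cmap c1 \o cinv c0 \o g).
Proof.
move=> h0 h1 oB sg gB; have cc0 := cA.1 _ h0; have [oc1 _ _ _ _] := cA.1 _ h1.
set Z := cmap c0 @` (cdom c0 `&` cdom c1).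
have oZ : open Z by exact: chart_open_image.
have cg x : B x -> {for x, continuous g} by move=> Bx; have C := Ck_cont (sg 0%N) Bx; exact: C.
have oO := open_preimage_for oB oZ cg; split => // k.
have sub : B `&` g @^-1` Z `<=` B by move=> x [].
exact: (Ck_comp_rV oO oZ (fun x h => h.2) (Ck_sub sub (sg k)) (cA.2 _ _ h0 h1 k)).
Qed.

End SmoothThroughChart.

(** * Fibration and complete solution defined by an adapted chart *)

Section Solution.
Context {R : realType} {d k : nat} (dk : (k + (d - k))%N = d).
Context {T : topologicalType} (M : atlas R T d) (omega : T -> tvec R T -> tvec R T -> R).
Context (H : T -> R) (c0 : chart R T d) (x0 : 'rV[R]_d).
Context (f : nat -> 'rV[R]_d -> R^o) (V : set 'rV[R]_d) (F G : 'rV[R]_d -> 'rV[R]_d) (e : R).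
Hypotheses (cM : compatible M) (so : symplectic_form M omega)
  (sH : smooth_fun M (carrier M) H) (Mc0 : M c0)
  (st : frame_state (form_mx M omega c0) (cmap c0 @` cdom c0) x0 k f V F G e)
  (f0 : f 0%N = (H \o cinv c0)) (k0 : (0 < k)%N).

Local Notation D0 := (cmap c0 @` cdom c0).

(** A cast along [k + (d - k) = d], needed because concatenating a base vector and a parameter has
    the dimension on the left. *)
Definition join (x : 'rV[R]_(k + (d - k))) : 'rV[R]_d := castmx (erefl 1%N, dk) x.
Definition unjoin (x : 'rV[R]_d) : 'rV[R]_(k + (d - k)) := castmx (erefl 1%N, esym dk) x.

Lemma joinK : cancel join unjoin.
Proof. by move=> x; rewrite /join /unjoin castmx_comp castmx_id. Qed.

Lemma unjoinK : cancel unjoin join.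
Proof. by move=> x; rewrite /join /unjoin castmx_comp castmx_id. Qed.

Lemma join_linear : linear join. Proof. exact: castmx_linear. Qed.
Lemma unjoin_linear : linear unjoin. Proof. exact: castmx_linear. Qed.

Definition chart_proj (x : 'rV[R]_d) : 'rV[R]_k := lsubmx (unjoin (F x)).
Definition sol_dom : set T := cdom c0 `&` cmap c0 @^-1` V.
Definition sol_proj (p : T) : 'rV[R]_k := chart_proj (cmap c0 p).
Definition sol_map (z : 'rV[R]_k * 'rV[R]_(d - k)) : T := cinv c0 (G (join (row_mx z.1 z.2))).
Definition base_ball : set 'rV[R]_k := [set y | `|y| < e].
Definition param_ball : set 'rV[R]_(d - k) := [set y | `|y| < e].
Definition ball_chart : chart R 'rV[R]_k k := restr_chart (Chart setT id id) base_ball.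

Local Notation MU := (restr M sol_dom).
Local Notation cU := (restr_chart c0 sol_dom).
Local Notation N := (restr (euclid R k) base_ball).
Local Notation L := (restr (euclid R (d - k)) param_ball).
Local Notation NL := (prod_atlas N L).
Local Notation cNL := (product_chart base_ball param_ball).
Local Notation W := [set z : 'rV[R]_d | `|z| < e].

Lemma sol_LD : local_diffeo V W F G. Proof. by case: st. Qed.

Lemma sol_e0 : 0 < e. Proof. by case: st. Qed.

Lemma sol_V x : V x -> D0 x. Proof. by case: st => _ _ h _ _; exact: h. Qed.

Lemma sol_join_ball y z : W (join (row_mx y z)) <-> base_ball y /\ param_ball z.
Proof. by rewrite /= norm_castmx; apply: norm_row_mx_lt; exact: sol_e0. Qed.

Lemma sol_oV : open V. Proof. by case: sol_LD. Qed.

Lemma sol_oW : open W. Proof. by case: sol_LD. Qed.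

Lemma sol_FV x : V x -> W (F x) /\ G (F x) = x.
Proof. by case: sol_LD => _ _ _ _ [h _]; exact: h. Qed.

Lemma sol_GW z : W z -> V (G z) /\ F (G z) = z.
Proof. by case: sol_LD => _ _ _ _ [_ h]; exact: h. Qed.

Lemma sol_chart : is_chart c0. Proof. exact: cM.1. Qed.

Lemma sol_open : open sol_dom.
Proof. exact: chart_open_preimage sol_chart sol_oV. Qed.

Lemma sol_compatible : compatible MU. Proof. exact: compatible_restr sol_open cM. Qed.

Lemma base_compatible : compatible N.
Proof. by apply: compatible_restr (@euclid_compatible R k); exact: open_norm_lt. Qed.

Lemma prod_compatible : compatible NL.
Proof. by apply: product_compatible; exact: open_norm_lt. Qed.

Lemma sol_carrier : carrier MU = sol_dom.
Proof.
rewrite carrier_restr; apply/seteqP; split => p; first by case.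
by move=> Up; split => //; exists c0 => //; case: Up.
Qed.

Lemma base_carrier : carrier N = base_ball.
Proof.
rewrite carrier_restr; apply/seteqP; split => y; first by case.
by move=> By; split => //; exists (Chart setT id id).
Qed.

Lemma param_carrier : carrier L = param_ball.
Proof.
rewrite carrier_restr; apply/seteqP; split => y; first by case.
by move=> By; split => //; exists (Chart setT id id).
Qed.

Lemma prod_carrier z : carrier NL z <-> base_ball z.1 /\ param_ball z.2.
Proof.
split; first by move=> [_ /product_atlas -> /product_chart_dom].
by move=> h; exists cNL; [exact/product_atlas|exact/product_chart_dom].
Qed.

Lemma base_chart : N ball_chart. Proof. by exists (Chart setT id id). Qed.

Lemma sol_chart_in : MU cU. Proof. by exists c0. Qed.

Lemma sol_domP p : sol_dom p -> [/\ cdom c0 p, V (cmap c0 p) & cdom cU p].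
Proof. by move=> Up; split; [case: Up|case: Up|case: (Up)]. Qed.

Lemma sol_chart_image : cmap cU @` cdom cU = V.
Proof.
have [_ _ cK _ _] := sol_chart; apply/seteqP; split.
  by move=> _ [p [_ [_ Vp]] <-].
move=> x Vx; have [cp px] := chart_invP sol_chart (sol_V Vx).
by exists (cinv c0 x); rewrite //; split => //; split => //=; rewrite px.
Qed.

Lemma sol_inv x : V x -> sol_dom (cinv c0 x) /\ cmap c0 (cinv c0 x) = x.
Proof.
move=> Vx; have [cp px] := chart_invP sol_chart (sol_V Vx).
by split => //; split => //=; rewrite px.
Qed.

Lemma sol_mapP z : base_ball z.1 -> param_ball z.2 ->
  sol_dom (sol_map z) /\ cmap c0 (sol_map z) = G (join (row_mx z.1 z.2)).
Proof.
move=> Bz Pz; have Wz : W (join (row_mx z.1 z.2)) by exact/sol_join_ball.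
by apply: sol_inv; have [] := sol_GW Wz.
Qed.

Lemma sol_proj_map z : base_ball z.1 -> param_ball z.2 -> sol_proj (sol_map z) = z.1.
Proof.
move=> Bz Pz; have [_ E] := sol_mapP Bz Pz; rewrite /sol_proj /chart_proj E.
have Wz : W (join (row_mx z.1 z.2)) by exact/sol_join_ball.
by have [_ ->] := sol_GW Wz; rewrite joinK row_mxKl.
Qed.

Lemma sol_proj_ball p : sol_dom p -> base_ball (sol_proj p) /\ param_ball (rsubmx (unjoin (F (cmap c0 p)))).
Proof.
move=> /sol_domP[_ Vp _]; have [WF _] := sol_FV Vp.
by apply/sol_join_ball; rewrite hsubmxK unjoinK.
Qed.

Lemma sol_map_proj p : sol_dom p ->
  sol_map (sol_proj p, rsubmx (unjoin (F (cmap c0 p)))) = p.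
Proof.
move=> /sol_domP[cp Vp _]; have [_ GF] := sol_FV Vp; have [_ _ cK _ _] := sol_chart.
by rewrite /sol_map /= hsubmxK unjoinK GF cK.
Qed.

Lemma sol_proj_image : sol_proj @` sol_dom = base_ball.
Proof.
apply/seteqP; split; first by move=> _ [p Up <-]; have [] := sol_proj_ball Up.
move=> y By; have P0 : param_ball 0 by rewrite /param_ball /= normr0; exact: sol_e0.
exists (sol_map (y, 0)); first by have [] := @sol_mapP (y, 0) By P0.
exact: (@sol_proj_map (y, 0)).
Qed.

Lemma sol_map_image : sol_map @` carrier NL = sol_dom.
Proof.
apply/seteqP; split; first by move=> _ [z /prod_carrier[Bz Pz] <-]; have [] := sol_mapP Bz Pz.
move=> p Up; exists (sol_proj p, rsubmx (unjoin (F (cmap c0 p)))); last exact: sol_map_proj.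
by apply/prod_carrier; exact: sol_proj_ball.
Qed.

Lemma chart_proj_smooth : smooth_on V chart_proj.
Proof.
move=> j; have [_ _ sF _ _] := sol_LD.
apply: (Ck_comp_rV (g := fun x => lsubmx (unjoin x)) sol_oV (@openT 'rV[R]_d) _ (sF j)); first by [].
by apply: Ck_linear; [exact: openT|move=> a u v; rewrite unjoin_linear linearP].
Qed.

Lemma sol_map_smooth : smooth_on [set x | `|x| < e] (G \o join).
Proof.
move=> j; have [_ _ _ sG _] := sol_LD.
have oB : open [set x : 'rV[R]_(k + (d - k)) | `|x| < e] by exact: open_norm_lt.
have BW (x : 'rV[R]_(k + (d - k))) : `|x| < e -> W (join x) by rewrite /= norm_castmx.
exact: (Ck_comp_rV oB sol_oW BW (Ck_linear j oB join_linear) (sG j)).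
Qed.


Lemma push_sol_proj p v : sol_dom p ->
  push N sol_proj p (coord_tvec MU cU v p) =
  coord_tvec N ball_chart (lsubmx (unjoin ('D_v F (cmap c0 p)))) (sol_proj p).
Proof.
move=> Up; have [cp Vp cUp] := sol_domP Up.
have E x : V x -> (cmap ball_chart \o sol_proj \o cinv cU) x = chart_proj x.
  by move=> /sol_inv[_ Ex]; rewrite /= /sol_proj Ex.
rewrite (push_coord (c' := ball_chart) sol_compatible base_compatible sol_chart_in base_chart cUp sol_oV Vp).
- congr (coord_tvec _ _ _ _); rewrite (derive_eq_on v sol_oV E Vp).
  have lin : linear (fun x : 'rV[R]_d => lsubmx (unjoin x) : 'rV[R]_k).
    by move=> a u w; rewrite unjoin_linear linearP.
  have dl : differentiable (fun x : 'rV[R]_d => lsubmx (unjoin x) : 'rV[R]_k) (F (cmap c0 p)).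
    apply: (@C1_differentiable _ _ _ setT); [exact: openT| |by []].
    exact: Ck_linear openT lin.
  apply: etrans (derive_chain v (local_diffeo_diffl sol_LD Vp) dl) _.
  exact: derive_linear.
- by rewrite sol_chart_image.
- by move=> x /sol_inv[Ux _]; split => //=; have [] := sol_proj_ball Ux.
- by move=> j; apply: Ck_ext sol_oV (fun x Vx => esym (E x Vx)) (chart_proj_smooth j).
Qed.

Lemma derive_sol_map z v : base_ball z.1 -> param_ball z.2 ->
  'D_v (G \o join) (row_mx z.1 z.2) = 'D_(join v) G (join (row_mx z.1 z.2)).
Proof.
move=> Bz Pz; have Wz : W (join (row_mx z.1 z.2)) by exact/sol_join_ball.
have dj : differentiable join (row_mx z.1 z.2).
  apply: (@C1_differentiable _ _ _ setT); [exact: openT| |by []].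
  exact: Ck_linear openT join_linear.
apply: etrans (derive_chain v dj (local_diffeo_diffr sol_LD Wz)) _.
by rewrite (derive_linear _ _ join_linear).
Qed.

Lemma sol_map_rep z : base_ball z.1 -> param_ball z.2 ->
  let B := [set x : 'rV[R]_(k + (d - k)) | `|x| < e] in
  [/\ cdom cNL z, open B, B (cmap cNL z), B `<=` cmap cNL @` cdom cNL &
    [/\ forall x, B x -> cdom cU (sol_map (cinv cNL x)),
       smooth_on B (cmap cU \o sol_map \o cinv cNL) &
       forall x, B x -> (cmap cU \o sol_map \o cinv cNL) x = (G \o join) x]].
Proof.
move=> Bz Pz B; have oB : open B by exact: open_norm_lt.
have Wx x : B x -> base_ball (lsubmx x) /\ param_ball (rsubmx x).
  by move=> hx; apply/sol_join_ball; rewrite hsubmxK /= norm_castmx.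
have E x : B x -> (cmap cU \o sol_map \o cinv cNL) x = (G \o join) x.
  by move=> /Wx[Bx Px]; have [_] := @sol_mapP (lsubmx x, rsubmx x) Bx Px; rewrite /= hsubmxK.
split; [exact/product_chart_dom|exact: oB| | |split].
- by apply/norm_row_mx_lt => //; exact: sol_e0.
- by rewrite product_chart_image => x /Wx.
- move=> x /Wx[Px Qx]; have [U1 _] := @sol_mapP (lsubmx x, rsubmx x) Px Qx.
  by have [] := sol_domP U1.
- by move=> j; apply: Ck_ext oB (fun x hx => esym (E x hx)) (sol_map_smooth j).
- exact: E.
Qed.

Lemma product_chart_in : NL cNL. Proof. exact/product_atlas. Qed.

Lemma push_sol_map z v : base_ball z.1 -> param_ball z.2 ->
  push MU sol_map z (coord_tvec NL cNL v z) =
  coord_tvec MU cU ('D_(join v) G (join (row_mx z.1 z.2))) (sol_map z).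
Proof.
move=> Bz Pz; have [cz oB Bx sub [Dx sx E]] := sol_map_rep Bz Pz.
rewrite (push_coord prod_compatible sol_compatible product_chart_in sol_chart_in cz oB Bx sub Dx sx).
by rewrite (derive_eq_on (g := G \o join) v oB E Bx) derive_sol_map.
Qed.

Lemma push_sol_section y l v : base_ball y -> param_ball l ->
  push NL (fun n' => (n', l)) y (coord_tvec N ball_chart v y) = coord_tvec NL cNL (row_mx v 0) (y, l).
Proof.
move=> By Pl; have oB : open base_ball by exact: open_norm_lt.
have By' : cdom ball_chart y by split.
have sub : base_ball `<=` cmap ball_chart @` cdom ball_chart by rewrite image_id_setI.
have C : Ck_on 1 base_ball (fun x : 'rV[R]_k => row_mx x l).
  by apply: Ck_row_mx; [exact: oB|exact: Ck_linear|exact: Ck_cst].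
rewrite (push_coord (c' := cNL) base_compatible prod_compatible base_chart _ By' oB By sub).
- congr (coord_tvec _ _ _ _); apply/rowP => i.
  rewrite (derive_coord (f := fun x : 'rV[R]_k => row_mx x l)); last exact: C1_differentiable oB C By.
  case: (split_ordP i) => j ->.
    have -> : (fun x : 'rV[R]_k => row_mx x l 0 (lshift (d - k) j) : R^o) = (fun x => x 0 j : R^o).
      by apply/funext => x; rewrite row_mxEl.
    by rewrite row_mxEl -(derive_coord (f := id)) ?derive_id.
  have -> : (fun x : 'rV[R]_k => row_mx x l 0 (rshift k j) : R^o) = cst (l 0 j).
    by apply/funext => x; rewrite row_mxEr.
  by rewrite row_mxEr mxE derive_cst.
- exact/product_atlas.
- by move=> x Bx; split; split.
- by move=> j; apply: Ck_row_mx; [exact: oB|exact: Ck_linear|exact: Ck_cst].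
Qed.


Lemma tail0 (b : 'rV[R]_k) (i : 'I_d) : (k <= i)%N -> join (row_mx b 0) 0 i = 0.
Proof.
move=> ki; rewrite castmxE /= cast_ord_id; set j := cast_ord _ _.
case: (split_ordP j) => i' ij; last by rewrite ij row_mxEr mxE.
by have := congr1 val ij => /= E; move: ki; rewrite E leqNgt ltn_ord.
Qed.

Lemma join_tail (a : 'rV[R]_d) : (forall i : 'I_d, (k <= i)%N -> a 0 i = 0) ->
  join (row_mx (lsubmx (unjoin a)) 0) = a.
Proof.
move=> a0; rewrite -[RHS]unjoinK -[in RHS](hsubmxK (unjoin a)); congr (join (row_mx _ _)).
apply/rowP => i; rewrite !mxE castmxE /= cast_ord_id a0 //=.
exact: leq_addr.
Qed.

Lemma push_lifted z : base_ball z.1 -> param_ball z.2 ->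
  push MU sol_map z (lifted_vf MU omega H N sol_proj L sol_map z) = ham_vf M omega H (sol_map z).
Proof.
case: z => y l /= By Pl; have [Up Ep] := @sol_mapP (y, l) By Pl.
have [cp Vp cUp] := sol_domP Up; have oU := sol_open.
set p := sol_map (y, l) in Up Ep cp Vp cUp *.
rewrite (ham_vf_coord cM so Mc0 cp sH) -f0.
set Xh := ham _ _ _.
have HV : ham_vf MU omega H p = coord_tvec MU cU Xh p.
  by rewrite ham_vf_restr // (ham_vf_coord cM so Mc0 cp sH) -f0 coord_tvec_restr.
pose a := 'D_Xh F (cmap c0 p).
have PE : push N sol_proj p (ham_vf MU omega H p) = coord_tvec N ball_chart (lsubmx (unjoin a)) y.
  by rewrite HV (push_sol_proj _ Up) (@sol_proj_map (y, l) By Pl).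
have TE : lifted_vf MU omega H N sol_proj L sol_map (y, l) =
    coord_tvec NL cNL (row_mx (lsubmx (unjoin a)) 0) (y, l).
  rewrite /lifted_vf -/p PE /=; apply/funext => g.
  rewrite /tpair (push_sol_section _ By Pl).
  by rewrite [X in _ + X](_ : _ = 0) ?addr0 // /push; case: asboolP.
have [_ _ _ _ [_ _ fF _]] := st.
(* Since [f 0] is [H], the frame condition for [a = 0] says that [X_H] has no component of index
   [>= k]; projecting to the base and filling with 0 loses nothing. *)
have Ea : join (row_mx (lsubmx (unjoin a)) 0) = a.
  by apply: join_tail => i ki; exact: fF 0%N _ i k0 Vp ki.
rewrite TE (@push_sol_map (y, l) _ By Pl) Ea (coord_tvec_restr _ _ _ oU Up); congr (coord_tvec _ _ _ _).
have [_ FG] := sol_GW ((sol_join_ball y l).2 (conj By Pl)).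
rewrite -[X in 'D__ G X]FG -Ep.
exact: (local_diffeo_derive_inv Xh sol_LD Vp).
Qed.

Lemma sol_equation z v : carrier NL z -> tangent NL z v ->
  omega (sol_map z) (push MU sol_map z (lifted_vf MU omega H N sol_proj L sol_map z))
    (push MU sol_map z v) = push MU sol_map z v H.
Proof.
move=> /prod_carrier[Bz Pz] [_ [w [/product_atlas -> _ ->]]].
have [Up _] := sol_mapP Bz Pz; have [cp _ _] := sol_domP Up.
rewrite (push_lifted Bz Pz) (push_sol_map _ Bz Pz) (coord_tvec_restr _ _ _ sol_open Up).
apply: (ham_vfP cM so Mc0 cp sH); exact: tangent_coord.
Qed.

(** The slice is [sol_map] after the section [n' => (n', l)]. Functoriality of [push] requires
    [g \o sol_map] to be smooth near [(y, l)], which [representative_pull] supplies. *)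
Lemma push_sol_slice y l b : base_ball y -> param_ball l ->
  push MU (fun n' => sol_map (n', l)) y (coord_tvec N ball_chart b y) =
  coord_tvec MU cU ('D_(join (row_mx b 0)) G (join (row_mx y l))) (sol_map (y, l)).
Proof.
move=> By Pl; rewrite -(@push_sol_map (y, l) _ By Pl) -(push_sol_section _ By Pl).
apply/funext => g; rewrite [LHS]/push [RHS]/push.
case: asboolP => // sg; rewrite /push asboolT //.
have [cz oB Bx sub [Dx sx E]] := @sol_map_rep (y, l) By Pl.
by have [] := representative_pull prod_compatible sol_compatible product_chart_in sol_chart_in cz oB Bx sub Dx sx sg.
Qed.

Lemma sol_isotropic : isotropic MU omega N L sol_map.
Proof.
move=> l y u w; rewrite param_carrier base_carrier => Pl By.
move=> [_ [b [[_ -> <-] _ ->]]] [_ [b' [[_ -> <-] _ ->]]].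
have [Up Ep] := @sol_mapP (y, l) By Pl; have [cp Vp _] := sol_domP Up.
rewrite (push_sol_slice b By Pl) (push_sol_slice b' By Pl) !(coord_tvec_restr _ _ _ sol_open Up).
rewrite (form_bil cM so _ _ Mc0 cp) Ep.
apply: (frame_isotropic (fun i j => form_mx_smooth cM so i j Mc0) (fun x Dx => form_mx_unit cM so Mc0 Dx)
  (fun x a a' Dx => form_mx_skew cM so a a' Mc0 Dx)
  (fun x a a' a'' Dx => form_mx_closed cM so a a' a'' Mc0 Dx) st).
- exact/sol_join_ball.
- by move=> i; exact: tail0.
- by move=> i; exact: tail0.
Qed.

Lemma sol_fibration : is_fibration MU N sol_proj.
Proof.
have oU := sol_open; split.
- split; first by rewrite sol_carrier base_carrier => p /sol_proj_ball[].
  move=> _ _ [c1 h1 <-] [_ -> <-]; have [oc1 _ _ _ _] := cM.1 _ h1.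
  have -> : cdom (restr_chart c1 sol_dom) `&` sol_proj @^-1` cdom ball_chart = cdom c1 `&` sol_dom.
    apply/seteqP; split => [p [? _]//|p [cp Up]]; split=> //; split => //.
    by have [] := sol_proj_ball Up.
  split; first exact: openI.
  exact: (smooth_from_chart cM Mc0 h1 sol_oV chart_proj_smooth).
- by rewrite sol_carrier base_carrier sol_proj_image.
- rewrite sol_carrier => p Up w [_ [b [[_ -> <-] _ ->]]].
  have [cp Vp cUp] := sol_domP Up; have [WF GF] := sol_FV Vp.
  (* A base vector is lifted by completing it with zero parameters and applying the derivative of
     [G]. *)
  exists (coord_tvec MU cU ('D_(join (row_mx b 0)) G (F (cmap c0 p))) p).
    exact: (tangent_coord _ sol_chart_in cUp).
  rewrite (push_sol_proj _ Up) -[X in 'D__ F X]GF (local_diffeo_derive sol_LD _ WF).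
  by rewrite joinK row_mxKl.
Qed.

Lemma sol_map_smooth_map : smooth_map NL MU sol_map.
Proof.
have oU := sol_open; split.
  by rewrite sol_carrier => z /prod_carrier[Bz Pz]; have [] := sol_mapP Bz Pz.
move=> _ _ /product_atlas -> [c1 h1 <-]; have oB : open [set x : 'rV[R]_(k + (d - k)) | `|x| < e] by exact: open_norm_lt.
have gB x : `|x| < e -> D0 ((G \o join) x).
  move=> hx; apply: sol_V; have Wx : W (join x) by rewrite /= norm_castmx.
  by have [] := sol_GW Wx.
have [oO sO] := smooth_to_chart cM Mc0 h1 oB sol_map_smooth gB.
set O := _ `&` _ in oO sO.
have cc : is_chart cNL by apply: prod_compatible.1; exact/product_atlas.
have OE z : cdom cNL z -> O (cmap cNL z) <-> cdom (restr_chart c1 sol_dom) (sol_map z).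
  move=> /product_chart_dom[Bz Pz]; have [Uz Ez] := sol_mapP Bz Pz.
  have hz : `|row_mx z.1 z.2| < e by apply/norm_row_mx_lt => //; exact: sol_e0.
  have [cz _ _] := sol_domP Uz; split.
    by move=> [_ /(chart_imageE _ _ sol_chart)[_ c1z]]; split.
  move=> [c1z _]; split => //; apply/(chart_imageE _ _ sol_chart); split => //.
  exact: gB.
have -> : cdom cNL `&` sol_map @^-1` cdom (restr_chart c1 sol_dom) = cdom cNL `&` cmap cNL @^-1` O.
  by apply/seteqP; split => z [cz hz]; split => //; apply/(OE z cz).
split; first exact: chart_open_preimage.
set O' := cmap cNL @` _.
have oO' : open O'.
  by have := chart_open_image cc (chart_open_preimage cc oO); rewrite setIA setIid.
have sub : O' `<=` O by move=> _ [z [_ Oz] <-].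
have E x : O' x -> (cmap c1 \o cinv c0 \o (G \o join)) x =
    (cmap (restr_chart c1 sol_dom) \o sol_map \o cinv cNL) x.
  by move=> _; rewrite /= /sol_map /= hsubmxK.
by move=> j; exact: (Ck_ext oO' E (Ck_sub sub (sO j))).
Qed.

(** [sol_map] has a smooth inverse on the whole of [sol_dom], so a single neighbourhood, the full
    product, serves every point. *)
Lemma sol_local_diffeo : is_local_diffeo NL MU sol_map.
Proof.
split; first exact: sol_map_smooth_map.
move=> p0 Np0; have oU := sol_open.
pose Ginv p := (sol_proj p, rsubmx (unjoin (F (cmap c0 p)))).
have cc : is_chart cNL by apply: prod_compatible.1; exact/product_atlas.
have [oD _ _ _ _] := cc.
exists (carrier NL), Ginv; rewrite sol_map_image; split => //.
  rewrite (_ : carrier NL = cdom cNL) //; apply/seteqP; split => z.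
        by move/prod_carrier => h; exact/product_chart_dom.
      by move/product_chart_dom => h; exact/prod_carrier.
split.
  move=> [y l] /prod_carrier[By Pl]; rewrite /Ginv (@sol_proj_map (y, l)) //.
  have [_ ->] := @sol_mapP (y, l) By Pl.
  have [_ ->] := sol_GW ((sol_join_ball y l).2 (conj By Pl)).
  by rewrite joinK row_mxKr.
split.
  rewrite !carrier_restr => p [[Mp Up] _]; have h := sol_proj_ball Up.
  by split; apply/prod_carrier.
move=> _ _ [_ [c1 h1 <-] <-] [c' /product_atlas -> <-]; have [oc1 _ _ _ _] := cM.1 _ h1.
rewrite (_ : _ `&` _ = cdom c1 `&` sol_dom); last first.
  apply/seteqP; split => [p [[[? ?] _] _]//|p [cp Up]]; split=> //; have h := sol_proj_ball Up.
  by split; [exact/product_chart_dom|exact/prod_carrier].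
split; first exact: openI.
have sF : smooth_on V (unjoin \o F).
  have [_ _ sF _ _] := sol_LD.
  by move=> j; apply: (Ck_comp_rV sol_oV (@openT 'rV[R]_d) _ (sF j) (Ck_linear j (@openT _) unjoin_linear)).
move=> j; have S := smooth_from_chart cM Mc0 h1 sol_oV sF j.
apply: Ck_ext _ _ S; last by move=> x _ /=; rewrite hsubmxK.
exact: chart_open_image (cM.1 _ h1) oU.
Qed.

Lemma sol_complete :
  complete_solution MU omega H N sol_proj L sol_map /\ isotropic MU omega N L sol_map.
Proof.
split; last exact: sol_isotropic.
split.
- by apply: euclid_manifold; exact: open_norm_lt.
- exact: sol_local_diffeo.
- by rewrite sol_map_image sol_carrier.
- by move=> z /prod_carrier[Bz Pz]; exact: sol_proj_map.
- exact: sol_equation.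
Qed.

End Solution.

Theorem theorem3 (R : realType) (s : nat) (TM : topologicalType)
    (M : atlas R TM (2 * s)) (omega : TM -> tvec R TM -> tvec R TM -> R)
    (H : TM -> R) (m : TM)
    (hM : is_manifold M) (homega : symplectic_form M omega)
    (hH : smooth_fun M (carrier M) H) (hm : carrier M m)
    (hdH : exists2 v, tangent M m v & v H <> 0)
    (k : nat) (hk : (1 <= k <= s)%N) :
  exists (U : set TM) (Pi : TM -> 'rV[R]_k),
    [/\ open U /\ U `<=` carrier M, U m, open (Pi @` U),
        is_fibration (restr M U) (restr (euclid R k) (Pi @` U)) Pi &
        exists (TL : topologicalType) (L : atlas R TL (2 * s - k))
               (Sigma : 'rV[R]_k * TL -> TM),
          complete_solution (restr M U) omega H
            (restr (euclid R k) (Pi @` U)) Pi L Sigma /\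
          isotropic (restr M U) omega (restr (euclid R k) (Pi @` U)) L Sigma].
Proof.
have [k0 ks] := andP hk; have cM : compatible M by case: hM.
have [c0 Mc0 c0m] := hm; have [_ oD cK _ _] := cM.1 _ Mc0.
have Dm : (cmap c0 @` cdom c0) (cmap c0 m) by exists m.
have [v0 /(tangentP cM Mc0 c0m)[v ->]] := hdH.
rewrite (coord_tvecE _ _ (smooth_fun_near cM Mc0 c0m hH)) => dH.
(* The bound [k <= s] becomes the dimension condition of [exists_frame]. *)
have kk : (k + k <= 2 * s)%N by rewrite mul2n -addnn leq_add.
have dk : (k + (2 * s - k) = 2 * s)%N by rewrite subnKC // (leq_trans (leq_addr k k)).
have [f [V [F [G [e [st f0]]]]]] := exists_frame oD Dm
  (fun i j => form_mx_smooth cM homega i j Mc0) (fun x Dx => form_mx_unit cM homega Mc0 Dx)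
  (fun x a a' Dx => form_mx_skew cM homega a a' Mc0 Dx)
  (fun x a a' a'' Dx => form_mx_closed cM homega a a' a'' Mc0 Dx)
  (smooth_fun_coord Mc0 hH) dH k0 kk.
exists (sol_dom c0 V), (sol_proj dk c0 F).
have E := sol_proj_image dk cM Mc0 st.
rewrite E; split.
- split; first exact: sol_open cM Mc0 st.
  by move=> p [c0p _]; exists c0.
- split => //=.
  (* The coordinates of [m] are [G 0], and 0 belongs to the ball on which [G] is defined. *)
  have [[oV oW _ _ [_ WG]] e0 _ G0 _] := st.
  by rewrite -G0; have [|] := WG 0 => //=; rewrite normr0.
- exact: open_norm_lt.
- exact (sol_fibration dk cM Mc0 st).
- exists 'rV[R]_(2 * s - k), (restr (euclid R (2 * s - k)) (param_ball e)), (sol_map dk c0 G).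
  exact (sol_complete dk cM homega hH Mc0 st f0 k0).
Qed.
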